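(* Let $N\ge 1$ and $m\ge 2$ be integers and consider the system $$(P)\qquad \begin{cases}\dfrac{\partial u_i}{\partial t}-\Delta u_i=f_i(u_1,\dots,u_m), & x\in\mathbb{R}^N_+,\ t\in\mathbb{R},\ i=1,\dots,m,\\[2mm] u_i=0, & x\in\partial\mathbb{R}^N_+,\ t\in\mathbb{R},\ i=1,\dots,m,\end{cases}$$ where $f_i:[0,\infty)^m\to\mathbb{R}$, $i=1,\dots,m$, are $C^1$ functions such that: (1) $f_i(0,\dots,0)=0$ for $i=1,\dots,m$; (2) $\frac{\partial f_i}{\partial u_j}(u_1,\dots,u_m)\ge 0$ for all $(u_1,\dots,u_m)\in[0,\infty)^m$ and all $i\neq j$; (3) $\sum_{j=1}^m\frac{\partial f_i}{\partial u_j}(0,\dots,0)\le 0$ for all $i$; (4) any nontrivial, nonnegative, bounded solution of $(P)$ is positive in $\mathbb{R}^N_+\times\mathbb{R}$ (i.e. all of its components are positive there). Then any nontrivial, nonnegative, bounded solution $U=(u_1,\dots,u_m)$ of $(P)$ is increasing in $x_1$: $$\frac{\partial u_i}{\partial x_1}(x,t)>0,\qquad x\in\mathbb{R}^N_+,\ t\in\mathbb{R},\ i=1,\dots,m.$$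
   Context: $\mathbb{R}^N_+=\{x=(x_1,\dots,x_N)\in\mathbb{R}^N: x_1>0\}$, and $\Delta$ is the Laplacian in $x$. Solutions are understood in the classical sense: components $u_i$ of class $C^{2,1}$ (that is, $C^2$ in $x$ and $C^1$ in $t$) in $\mathbb{R}^N_+\times\mathbb{R}$, continuous up to $\partial\mathbb{R}^N_+\times\mathbb{R}$, satisfying the equations and the boundary conditions pointwise. Nonnegative means $u_i\ge 0$ for every $i$; nontrivial means that $U$ is not identically $(0,\dots,0)$. *)

(* Defs.v *)
From HB Require Import structures.
From mathcomp Require Import all_boot all_order all_algebra.
From mathcomp Require Import all_classical all_reals all_analysis.

Set Implicit Arguments.
Unset Strict Implicit.
Unset Printing Implicit Defensive.

Import Order.TTheory GRing.Theory Num.Theory.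
Import numFieldNormedType.Exports.

Local Open Scope classical_set_scope.
Local Open Scope ring_scope.

Definition basis_vec {R : realType} {k : nat} (j : 'I_k) : 'rV[R]_k :=
  delta_mx 0 j.

Definition orthant {R : realType} {m : nat} : set 'rV[R]_m :=
  [set a | forall j, 0 <= a 0 j].

(* Partial derivative relative to D: increments are restricted to those keeping
   the point in D. On the orthant this is the usual partial derivative when the
   j-th coordinate is positive, and the right derivative when it is zero, so
   values of g outside the orthant play no role. *)
Definition diff_quot (R : realType) (m : nat) (g : 'rV[R]_m -> R)
    (j : 'I_m) (a : 'rV[R]_m) (h : R) : R :=
  h^-1 * (g (a + h *: basis_vec j) - g a).

Definition increments (R : realType) (m : nat) (D : set 'rV[R]_m)
    (j : 'I_m) (a : 'rV[R]_m) : set_system R :=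
  within [set h | D (a + h *: basis_vec j)] 0^'.

Definition partial_on (R : realType) (m : nat) (D : set 'rV[R]_m)
    (g : 'rV[R]_m -> R) (j : 'I_m) (a : 'rV[R]_m) : R :=
  lim (diff_quot g j a @ increments D j a).

Definition C1_on (R : realType) (m : nat) (D : set 'rV[R]_m)
    (g : 'rV[R]_m -> R) : Prop :=
  {within D, continuous g} /\
  forall j : 'I_m,
    (forall a, D a -> cvg (diff_quot g j a @ increments D j a)) /\
    {within D, continuous (partial_on D g j)}.

(* The space dimension is N = n.+1, and x_1 is the coordinate x 0 ord0. *)
Definition half_space {R : realType} {n : nat} : set 'rV[R]_n.+1 :=
  [set x | 0 < x 0 ord0].

Definition half_space_boundary {R : realType} {n : nat} : set 'rV[R]_n.+1 :=
  [set x | x 0 ord0 = 0].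

Definition closed_half_space {R : realType} {n : nat} : set 'rV[R]_n.+1 :=
  half_space `|` half_space_boundary.

Definition dx (R : realType) (k : nat) (j : 'I_k) (v : 'rV[R]_k -> R -> R)
    (x : 'rV[R]_k) (t : R) : R :=
  'D_(basis_vec j) (v ^~ t) x.

Definition dt (R : realType) (k : nat) (v : 'rV[R]_k -> R -> R)
    (x : 'rV[R]_k) (t : R) : R :=
  derive1 (v x) t.

Definition laplacian (R : realType) (k : nat) (v : 'rV[R]_k -> R -> R)
    (x : 'rV[R]_k) (t : R) : R :=
  \sum_(j < k) dx j (dx j v) x t.

(* Continuity is joint in (x, t). *)
Definition continuous_on (R : realType) (k : nat) (D : set 'rV[R]_k)
    (v : 'rV[R]_k -> R -> R) : Prop :=
  {within D `*` [set: R],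
    continuous (fun p : 'rV[R]_k * R => v p.1 p.2)}.

(* Intended for open D, where the partial derivatives below do not depend on
   the values of v outside D. *)
Definition C21_on (R : realType) (k : nat) (D : set 'rV[R]_k)
    (v : 'rV[R]_k -> R -> R) : Prop :=
  [/\ continuous_on D v,
      (forall x t, D x -> derivable (v x) t 1) /\ continuous_on D (dt v),
      forall j : 'I_k,
        (forall x t, D x -> derivable (v ^~ t) x (basis_vec j)) /\
        continuous_on D (dx j v) &
      forall i j : 'I_k,
        (forall x t, D x -> derivable (dx j v ^~ t) x (basis_vec i)) /\
        continuous_on D (dx i (dx j v))].

Definition state (R : realType) (n m : nat)
    (u : 'I_m -> 'rV[R]_n.+1 -> R -> R) (x : 'rV[R]_n.+1) (t : R) : 'rV[R]_m :=
  \row_(j < m) u j x t.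

(* A solution lives on the closed half-space; the total functions u i are
   unconstrained elsewhere. *)
Definition solution (R : realType) (n m : nat) (f : 'I_m -> 'rV[R]_m -> R)
    (u : 'I_m -> 'rV[R]_n.+1 -> R -> R) : Prop :=
  forall i : 'I_m,
    [/\ C21_on (half_space) (u i),
        continuous_on (closed_half_space) (u i),
        forall x t, half_space x ->
          dt (u i) x t - laplacian (u i) x t = f i (state u x t) &
        forall x t, half_space_boundary x -> u i x t = 0].

Definition nonnegative (R : realType) (n m : nat)
    (u : 'I_m -> 'rV[R]_n.+1 -> R -> R) : Prop :=
  forall i x t, closed_half_space x -> 0 <= u i x t.

Definition bounded_sol (R : realType) (n m : nat)
    (u : 'I_m -> 'rV[R]_n.+1 -> R -> R) : Prop :=
  exists M : R, forall i x t, closed_half_space x -> `|u i x t| <= M.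

Definition nontrivial (R : realType) (n m : nat)
    (u : 'I_m -> 'rV[R]_n.+1 -> R -> R) : Prop :=
  exists i x t, closed_half_space x /\ u i x t <> 0.

(* Main.v *)
(* Moving planes in the direction x_1.  For a plane x_1 = l put
   w_i = u_i(reflected point) - u_i; linearizing f along coordinate segments,
   cooperativity gives w_t - Lap w = C w with nonnegative off-diagonal
   coefficients.  If some w_i < 0 in the strip 0 < x_1 < l, take an almost
   minimum point of w_i relative to phi = c + x_1 (l - x_1) and localize it by a
   quadratic term in a bounded box of space-time.  Since -phi'' = 2, the rows of
   C must have a sum of order 1 / phi there; this forces x_1 to stay away from 0
   and l, and, by condition (3), some u_j to stay away from 0.  In particular
   narrow strips are ordered.

   If the infimum l* of the bad positions were finite, translating along points
   of failure for planes tending to l* would give, along an ultrafilter, a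
   limit solution that is ordered at l*, nontrivial, hence positive by
   condition (4), but not strictly ordered at an interior point of the strip.
   Positivity of the difference on {x_1 = 0} propagates inward along a moving
   ball and contradicts this.  The same propagation applied to difference
   quotients in x_1 turns monotonicity into strict positivity of the
   derivative.

   The compactness needed for the limit comes from interior estimates obtained
   by comparison only: first differences and mixed second differences of a
   bounded solution of the heat equation are controlled by barriers that depend
   on the increments as additional variables, which bounds the gradient, the
   Hessian and a Hoelder modulus of the Hessian. *)
Require Import Defs.
From mathcomp Require Import all_boot all_order all_algebra.
From mathcomp Require Import all_classical all_reals all_analysis.
From mathcomp Require Import ring lra.

Set Implicit Arguments.
Unset Strict Implicit.
Unset Printing Implicit Defensive.

Import Order.TTheory GRing.Theory Num.Theory.
Import numFieldNormedType.Exports.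

Local Open Scope classical_set_scope.
Local Open Scope ring_scope.

(** * Derivatives through difference quotients *)

(** A single component obeys no maximum principle of its own, so the quotients [- w_i / phi] are
    maximised over all components at once: the others are then bounded below by the same multiple of
    [phi], and the coupling enters only through row sums. The source f(u) is no more regular than u
    itself, so the estimates are bootstrapped. A bounded source gives a Lipschitz bound for u; since
    f is Lipschitz, difference quotients of u again have a bounded source, hence the gradient is
    Lipschitz, and mixed differences give the Hessian a modulus of order sqrt. Time regularity has
    no barrier of its own: it comes from the equation and from interpolation between time moduli of
    u and space moduli of its derivatives. An ultrafilter is used because it makes the limits of the
    solution and of all its derivatives exist together at every point. Comparison is carried out on
    expansions at one point ([has_d1], [has_d2], [heat_at]), since at an extremum a barrier controls
    increments, not derivatives in a neighbourhood. *)

Definition has_d1 (R : realType) (g : R -> R) (c : R) : Prop :=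
  forall e : R, 0 < e -> exists2 d : R, 0 < d &
    forall s : R, `|s| < d -> `|g s - g 0 - c * s| <= e * `|s|.

(** The symmetric (Schwarz) second derivative at 0. It presupposes no first derivative, is invariant
    under reversing [s], hence compatible with reflections, and its sign at an extremum is
    immediate. *)
Definition has_d2 (R : realType) (g : R -> R) (c : R) : Prop :=
  forall e : R, 0 < e -> exists2 d : R, 0 < d &
    forall s : R, `|s| < d -> `|g s + g (- s) - 2 * g 0 - c * s ^+ 2| <= e * s ^+ 2.

Lemma has_d1_ext (R : realType) (g h : R -> R) (c : R) :
  g =1 h -> has_d1 g c -> has_d1 h c.
Proof. by move=> /funext ->. Qed.

Lemma has_d2_ext (R : realType) (g h : R -> R) (c : R) :
  g =1 h -> has_d2 g c -> has_d2 h c.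
Proof. by move=> /funext ->. Qed.

Lemma has_d1D (R : realType) (g h : R -> R) (a b : R) :
  has_d1 g a -> has_d1 h b -> has_d1 (fun s => g s + h s) (a + b).
Proof.
move=> ga hb e e0; have e20 : 0 < e / 2 by lra.
have [d d0 Hd] := ga _ e20; have [d' d'0 Hd'] := hb _ e20.
exists (Num.min d d'); first by rewrite lt_min d0.
move=> s; rewrite lt_min => /andP[/Hd + /Hd'].
rewrite !ler_norml; lra.
Qed.

Lemma has_d2D (R : realType) (g h : R -> R) (a b : R) :
  has_d2 g a -> has_d2 h b -> has_d2 (fun s => g s + h s) (a + b).
Proof.
move=> ga hb e e0; have e20 : 0 < e / 2 by lra.
have [d d0 Hd] := ga _ e20; have [d' d'0 Hd'] := hb _ e20.
exists (Num.min d d'); first by rewrite lt_min d0.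
move=> s; rewrite lt_min => /andP[/Hd + /Hd'].
rewrite !ler_norml; lra.
Qed.

Lemma has_d1Z (R : realType) (k : R) (g : R -> R) (a : R) :
  has_d1 g a -> has_d1 (fun s => k * g s) (k * a).
Proof.
move=> ga e e0.
have k1 : 0 < `|k| + 1 by rewrite ltr_wpDl.
have e20 : 0 < e / (`|k| + 1) by rewrite divr_gt0.
have [d d0 Hd] := ga _ e20; exists d => // s /Hd Hs.
rewrite (_ : _ - _ - _ = k * (g s - g 0 - a * s)); last by ring.
rewrite normrM; apply: (le_trans (ler_wpM2l _ Hs)) => //.
rewrite mulrA ler_wpM2r// mulrCA ler_piMr ?(ltW e0)//.
by rewrite ler_pdivrMr// mul1r lerDl.
Qed.

Lemma has_d2Z (R : realType) (k : R) (g : R -> R) (a : R) :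
  has_d2 g a -> has_d2 (fun s => k * g s) (k * a).
Proof.
move=> ga e e0.
have k1 : 0 < `|k| + 1 by rewrite ltr_wpDl.
have e20 : 0 < e / (`|k| + 1) by rewrite divr_gt0.
have [d d0 Hd] := ga _ e20; exists d => // s /Hd Hs.
rewrite (_ : _ - _ - _ = k * (g s + g (- s) - 2 * g 0 - a * s ^+ 2)); last by ring.
rewrite normrM; apply: (le_trans (ler_wpM2l _ Hs)) => //.
rewrite mulrA ler_wpM2r ?sqr_ge0// mulrCA ler_piMr ?(ltW e0)//.
by rewrite ler_pdivrMr// mul1r lerDl.
Qed.

Lemma has_d1B (R : realType) (g h : R -> R) (a b : R) :
  has_d1 g a -> has_d1 h b -> has_d1 (fun s => g s - h s) (a - b).
Proof.
move=> ga hb; rewrite -(mulN1r b); apply: has_d1_ext (has_d1D ga (has_d1Z (-1) hb)).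
by move=> s /=; rewrite mulN1r.
Qed.

Lemma has_d2B (R : realType) (g h : R -> R) (a b : R) :
  has_d2 g a -> has_d2 h b -> has_d2 (fun s => g s - h s) (a - b).
Proof.
move=> ga hb; rewrite -(mulN1r b); apply: has_d2_ext (has_d2D ga (has_d2Z (-1) hb)).
by move=> s /=; rewrite mulN1r.
Qed.

Lemma has_d1_oppl (R : realType) (g : R -> R) (a : R) :
  has_d1 g a -> has_d1 (fun s => g (- s)) (- a).
Proof.
move=> ga e /ga[d d0 Hd]; exists d => // s; rewrite -normrN => /Hd.
by rewrite oppr0 mulNr mulrN.
Qed.

Lemma has_d2_oppl (R : realType) (g : R -> R) (a : R) :
  has_d2 g a -> has_d2 (fun s => g (- s)) a.
Proof.
move=> ga e /ga[d d0 Hd]; exists d => // s /Hd.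
by rewrite oppr0 opprK (addrC (g (- s))).
Qed.

Lemma has_d1_sqr (R : realType) (x : R) : has_d1 (fun s => (x + s) ^+ 2) (2 * x).
Proof.
move=> e e0; exists e => // s se.
rewrite (_ : _ - _ - _ = s * s); last by ring.
by rewrite normrM ler_wpM2r// ltW.
Qed.

(** Only increments towards negative arguments enter, because in the parabolic comparisons the
    extremum may lie at the final time. The quadratic slack [B] absorbs second-order terms of the
    test functions. *)
Lemma has_d1_le (R : realType) (g : R -> R) (c b B : R) :
  has_d1 g c ->
  (exists2 d : R, 0 < d & forall s : R, 0 < s < d -> g 0 - g (- s) <= b * s + B * s ^+ 2) ->
  c <= b.
Proof.
move=> gc [d d0 Hd]; apply/ler_addgt0Pr => e e0.
have e20 : 0 < e / 2 by lra.
have [d' d'0 Hd'] := gc _ e20.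
have B1 : 0 < `|B| + 1 by rewrite ltr_wpDl.
pose s := Num.min (Num.min d d') (e / (`|B| + 1)) / 2.
have m0 : 0 < Num.min (Num.min d d') (e / (`|B| + 1)).
  by rewrite !lt_min d0 d'0 divr_gt0.
have s0 : 0 < s by rewrite divr_gt0.
have sm : s < Num.min (Num.min d d') (e / (`|B| + 1)) by rewrite /s; lra.
move: (sm); rewrite !lt_min => /andP[/andP[sd sd'] sB].
have := Hd s; rewrite s0 sd => /(_ isT) h1.
have := Hd' (- s); rewrite normrN gtr0_norm// => /(_ sd'); rewrite ler_norml => /andP[_ h2].
have h3 : B * s <= e / 2.
  apply: (@le_trans _ _ ((`|B| + 1) * s)).
    by rewrite ler_wpM2r ?(ltW s0)// (le_trans (ler_norm _))// lerDl.
  have : s <= e / (`|B| + 1) / 2.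
    by rewrite /s ler_wpM2r// ge_min lexx orbT.
  by move=> hs; rewrite -ler_pdivlMl// (mulrC _^-1) mulrAC.
have : s * c <= s * (b + e).
  have : B * s * s <= e / 2 * s by rewrite ler_wpM2r// ltW.
  by move: h1 h2; rewrite expr2; lra.
by rewrite ler_pM2l.
Qed.

Lemma has_d2_le (R : realType) (g : R -> R) (c b : R) :
  has_d2 g c ->
  (exists2 d : R, 0 < d & forall s : R, 0 < s < d -> g s + g (- s) - 2 * g 0 <= b * s ^+ 2) ->
  c <= b.
Proof.
move=> gc [d d0 Hd]; apply/ler_addgt0Pr => e e0.
have [d' d'0 Hd'] := gc _ e0.
pose s := Num.min d d' / 2.
have m0 : 0 < Num.min d d' by rewrite lt_min d0.
have s0 : 0 < s by rewrite divr_gt0.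
have sm : s < Num.min d d' by rewrite /s; lra.
move: (sm); rewrite !lt_min => /andP[sd sd'].
have := Hd s; rewrite s0 sd => /(_ isT) h1.
have := Hd' s; rewrite gtr0_norm// => /(_ sd'); rewrite ler_norml => /andP[h2 _].
have s20 : 0 < s ^+ 2 by rewrite exprn_gt0.
by rewrite -(ler_pM2r s20); lra.
Qed.

Lemma has_d1_is_derive (R : realType) (V : normedModType R) (f : V -> R) (x v : V) (c : R) :
  is_derive x v f c <-> has_d1 (fun s => f (x + s *: v)) c.
Proof.
split=> [Hd e e0|H].
  have [Hdv Hc] := (@ex_derive _ _ _ _ _ _ _ Hd, @derive_val _ _ _ _ _ _ _ Hd).
  have : (fun h => h^-1 *: (f (h *: v + x) - f x)) @ 0^' --> c.
    by rewrite -Hc; exact: Hdv.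
  move/cvgrPdist_le => /(_ e e0); rewrite near_withinE => /nbhs_normP[d /= d0 Hball].
  exists d => // s sd; have [->|s0] := eqVneq s 0.
    by rewrite scale0r addr0 !subrr mulr0 subr0 normr0 mulr0.
  have := Hball s; rewrite /ball_ /= sub0r normrN => /(_ sd s0).
  rewrite scale0r addr0 (addrC _ x) => Hs.
  rewrite (_ : _ - _ - _ = - s * (c - s^-1 *: (f (x + s *: v) - f x))).
    by rewrite normrM normrN mulrC ler_wpM2r.
  by rewrite /GRing.scale/=; field.
have Hcv : (fun h => h^-1 *: (f (h *: v + x) - f x)) @ 0^' --> c.
  apply/cvgrPdist_le => e e0; have [d d0 Hd] := H e e0.
  rewrite near_withinE; apply/nbhs_normP; exists d => //= s.
  rewrite /ball_ /= sub0r normrN => /Hd + s0.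
  rewrite scale0r addr0 (addrC x) => Hs.
  rewrite -(ler_pM2r (_ : 0 < `|s|)) ?normr_gt0// -normrM.
  apply: le_trans Hs; rewrite -[leLHS]normrN le_eqVlt; apply/orP; left.
  by apply/eqP; congr `|_|; rewrite /GRing.scale/=; field.
split; first by apply/cvg_ex; exists c.
exact: cvg_lim Hcv.
Qed.

Lemma has_d1_R (R : realType) (g : R -> R) (s c : R) :
  is_derive s 1 g c <-> has_d1 (fun h => g (s + h)) c.
Proof.
rewrite has_d1_is_derive (_ : (fun h => g (s + h *: 1)) = (fun h => g (s + h)))//.
by apply/funext => h; rewrite /GRing.scale/= mulr1.
Qed.

Lemma has_d1_cont (R : realType) (g : R -> R) (s c : R) :
  has_d1 (fun h => g (s + h)) c -> {for s, continuous g}.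
Proof.
move=> /has_d1_R H; apply: differentiable_continuous.
by apply/derivable1_diffP; apply: ex_derive.
Qed.

Lemma MVT_d1 (R : realType) (g g' : R -> R) (a b : R) : a < b ->
  (forall s, a <= s <= b -> has_d1 (fun h => g (s + h)) (g' s)) ->
  exists2 c, a < c < b & g b - g a = g' c * (b - a).
Proof.
move=> ab H.
have [||c /[!in_itv]/= cab ->] := @MVT R g g' a b ab; last by exists c.
  by move=> x /[!in_itv]/= /andP[ax xb]; apply/has_d1_R/H; rewrite !ltW.
apply: continuous_in_subspaceT => x /[!inE]/= /[!in_itv]/= xab.
exact: has_d1_cont (H _ xab).
Qed.

(** One application of the mean value theorem, to [g s + g (- s) - c * s ^+ 2]: symmetrization
    removes the first-order term, and the derivative [g' s - g' (- s) - c * (2 * s)] is o(s) by the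
    expansion of [g']. *)
Lemma has_d2_of_d1 (R : realType) (g g' : R -> R) (c : R) :
  (exists2 d : R, 0 < d & forall s : R, `|s| < d -> has_d1 (fun h => g (s + h)) (g' s)) ->
  has_d1 g' c -> has_d2 g c.
Proof.
move=> [d d0 Hg] gc e e0; have e20 : 0 < e / 2 by lra.
have [d' d'0 Hd'] := gc _ e20.
exists (Num.min d d'); first by rewrite lt_min d0.
suff pos (s : R) : 0 < s -> s < Num.min d d' ->
    `|g s + g (- s) - 2 * g 0 - c * s ^+ 2| <= e * s ^+ 2.
  move=> s sm; have [s0|s0|<-] := ltgtP 0 s.
  - by apply: pos => //; rewrite -(gtr0_norm s0).
  - have := pos (- s); rewrite opprK sqrrN (addrC (g (- s))).
    apply; first by rewrite oppr_gt0.
    by rewrite -(ltr0_norm s0).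
  - by rewrite oppr0 expr0n/= !mulr0 subr0 (_ : _ - _ = 0) ?normr0//; ring.
rewrite lt_min => s0 /andP[sd sd'].
have [|x /andP[x0 xs]] := @MVT_d1 R (fun s => g s + g (- s) - c * s ^+ 2)
    (fun s => g' s - g' (- s) - c * (2 * s)) 0 s s0.
  move=> x /andP[x0 xs]; apply: has_d1B; last exact: has_d1Z (has_d1_sqr x).
  apply: has_d1D; first by apply: Hg; rewrite ger0_norm//; lra.
  have /has_d1_oppl : has_d1 (fun h => g (- x + h)) (g' (- x)).
    by apply: Hg; rewrite normrN ger0_norm//; lra.
  by apply: has_d1_ext => h; rewrite opprD.
have Hx := Hd' x; have Hx' := Hd' (- x).
move: Hx Hx'; rewrite normrN gtr0_norm// => /(_ (lt_trans xs sd')) Hx /(_ (lt_trans xs sd')) Hx'.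
rewrite oppr0 expr0n/= mulr0 !subr0 addr0 => E.
rewrite (_ : _ - _ - _ = (g' x - g' (- x) - c * (2 * x)) * s); last by rewrite -E; ring.
rewrite normrM (gtr0_norm s0) expr2 mulrA ler_wpM2r ?(ltW s0)//.
apply: (@le_trans _ _ (e * x)); last by rewrite ler_wpM2l ?ltW.
by move: Hx Hx'; rewrite !ler_norml; lra.
Qed.

(** * The heat operator and the tests at an extremum *)

Lemma basis_vecE (R : realType) (k : nat) (i j : 'I_k) :
  (basis_vec i : 'rV[R]_k) 0 j = (j == i)%:R.
Proof. by rewrite /basis_vec mxE eqxx. Qed.

Lemma addZbasisE (R : realType) (k : nat) (x : 'rV[R]_k) (s : R) (i j : 'I_k) :
  (x + s *: basis_vec i) 0 j = x 0 j + s * (j == i)%:R.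
Proof. by rewrite mxE mxE basis_vecE. Qed.

(** The squared Euclidean norm. The norm carried by row vectors is the maximum norm, which is not
    smooth enough for barriers. *)
Definition sqn (R : realType) (k : nat) (x : 'rV[R]_k) : R :=
  \sum_j (x 0 j) ^+ 2.

Lemma sqn_ge0 (R : realType) (k : nat) (x : 'rV[R]_k) : 0 <= sqn x.
Proof. by apply: sumr_ge0 => j _; rewrite sqr_ge0. Qed.

Lemma sqn0 (R : realType) (k : nat) : sqn (0 : 'rV[R]_k) = 0.
Proof. by rewrite /sqn big1// => j _; rewrite mxE expr0n. Qed.

Lemma sqr_le_sqn (R : realType) (k : nat) (x : 'rV[R]_k) (j : 'I_k) :
  (x 0 j) ^+ 2 <= sqn x.
Proof.
by rewrite /sqn (bigD1 j)//= lerDl; apply: sumr_ge0 => i _; rewrite sqr_ge0.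
Qed.

Lemma sqn_addZbasis (R : realType) (k : nat) (x : 'rV[R]_k) (s : R) (i : 'I_k) :
  sqn (x + s *: basis_vec i) = sqn x + 2 * s * x 0 i + s ^+ 2.
Proof.
rewrite /sqn (bigD1 i)//= [in RHS](bigD1 i)//= addZbasisE eqxx mulr1.
rewrite (_ : \sum_(j < k | j != i) _ = \sum_(j < k | j != i) x 0 j ^+ 2); first by ring.
by apply: eq_bigr => j /negbTE ji; rewrite addZbasisE ji mulr0 addr0.
Qed.

Lemma sqn_d2 (R : realType) (k : nat) (x v : 'rV[R]_k) (s : R) (i : 'I_k) :
  sqn (x + s *: basis_vec i - v) + sqn (x - s *: basis_vec i - v) - 2 * sqn (x - v) =
  2 * s ^+ 2.
Proof. by rewrite -scaleNr !(addrAC x _ (- v)) !sqn_addZbasis; ring. Qed.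

Lemma sqn_continuous (R : realType) (k : nat) : continuous (@sqn R k).
Proof.
move=> x; rewrite /sqn /continuous_at; have FF : Filter (nbhs x) by exact: nbhs_filter.
elim: (index_enum _) => [|j r IH].
  under eq_fun do rewrite big_nil; rewrite big_nil; exact: cvg_cst.
under eq_fun do rewrite big_cons expr2; rewrite big_cons expr2; apply: cvgD => //.
by apply: cvgM; exact: coord_continuous.
Qed.

Lemma within_comp (R : realType) (k : nat) (T : topologicalType) (K : set T)
    (D : set 'rV[R]_k) (z : 'rV[R]_k -> R -> R) (X : T -> 'rV[R]_k) (tau : T -> R) :
  continuous_on D z -> (forall p, K p -> D (X p)) -> continuous X -> continuous tau ->
  {within K, continuous (fun p => z (X p) (tau p))}.
Proof.
move=> /subspace_continuousP zc KD Xc tc; apply/subspace_continuousP => p Kp.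
have H := zc (X p, tau p) (conj (KD _ Kp) I).
apply: (@cvg_comp _ _ _ (fun p => (X p, tau p)) (fun p => z p.1 p.2) _ _ _ _ H).
move=> A /= [] [B1 B2] /= [B1X B2t] sB.
have h1 := Xc p _ B1X; have h2 := tc p _ B2t.
apply: (@filterS2 _ (nbhs p) _ _ _ _ _ h1 h2) => q q1 q2 Kq.
by apply: (sB (X q, tau q)); split => //; exact: KD.
Qed.

Lemma withinB (R : realType) (T : topologicalType) (K : set T) (f g : T -> R) :
  {within K, continuous f} -> {within K, continuous g} ->
  {within K, continuous (fun p => f p - g p)}.
Proof. by move=> cf cg x; apply: continuousB; [exact: cf|exact: cg]. Qed.

Lemma withinD (R : realType) (T : topologicalType) (K : set T) (f g : T -> R) :
  {within K, continuous f} -> {within K, continuous g} ->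
  {within K, continuous (fun p => f p + g p)}.
Proof. by move=> cf cg x; apply: continuousD; [exact: cf|exact: cg]. Qed.

Lemma EVT_min (R : realType) (T : topologicalType) (K : set T) (f : T -> R) :
  K !=set0 -> compact K -> {within K, continuous f} ->
  exists2 c, K c & forall q, K q -> f c <= f q.
Proof.
move=> K0 cK cf; have [c Kc H] := compact_EVT_min K0 cK cf.
by exists c; [rewrite inE in Kc|move=> q Kq; apply: H; rewrite inE].
Qed.

Definition box (R : realType) (k : nat) (lo hi : 'I_k -> R) : set 'rV[R]_k :=
  [set x | forall j, lo j <= x 0 j <= hi j].

Lemma box_compact (R : realType) (k : nat) (lo hi : 'I_k -> R) : compact (box lo hi).
Proof.
have -> : box lo hi = [set v : 'rV[R]_k | forall i, `[lo i, hi i]%classic (v ord0 i)].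
  by apply/seteqP; split => x /= H j; have := H j; rewrite in_itv.
apply: (@rV_compact R k (fun i => `[lo i, hi i]%classic)) => i.
exact: segment_compact.
Qed.

Lemma itv_compact (R : realType) (a b : R) : compact [set y : R | a <= y <= b].
Proof.
have -> : [set y : R | a <= y <= b] = `[a, b]%classic.
  by apply/seteqP; split => x /=; rewrite in_itv.
exact: segment_compact.
Qed.

Lemma box_near (R : realType) (k : nat) (lo hi : 'I_k -> R) (x : 'rV[R]_k) (i : 'I_k) :
  box lo hi x -> lo i < x 0 i < hi i ->
  exists2 d : R, 0 < d & forall s : R, 0 < s < d ->
    box lo hi (x + s *: basis_vec i) /\ box lo hi (x - s *: basis_vec i).
Proof.
move=> bx /andP[l h]; exists (Num.min (x 0 i - lo i) (hi i - x 0 i)).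
  by rewrite lt_min !subr_gt0 l.
move=> s /andP[s0]; rewrite lt_min => /andP[sl sh].
rewrite -scaleNr; split => j; rewrite addZbasisE; have /andP[] := bx j;
  have [->|_] := eqVneq j i; rewrite ?mulr1 ?mulr0 ?addr0; lra.
Qed.

(** Records expansions at (x, t) only, not derivatives nearby. The notion is therefore stable under
    shifts, reflections and linear combinations, and it is exactly what the test at an extremum
    consumes. *)
Definition heat_at (R : realType) (k : nat) (z : 'rV[R]_k -> R -> R)
    (x : 'rV[R]_k) (t g : R) : Prop :=
  exists a (b : 'I_k -> R), [/\ has_d1 (fun s => z x (t + s)) a,
    forall j, has_d2 (fun s => z (x + s *: basis_vec j) t) (b j) &
    a - \sum_j b j = g].

Lemma heat_atB (R : realType) (k : nat) (z w : 'rV[R]_k -> R -> R) x t (g h : R) :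
  heat_at z x t g -> heat_at w x t h ->
  heat_at (fun x t => z x t - w x t) x t (g - h).
Proof.
move=> [a [b [ha hb <-]]] [a' [b' [ha' hb' <-]]].
exists (a - a'), (fun j => b j - b' j); split.
- exact: has_d1B.
- by move=> j; exact: has_d2B.
- by rewrite sumrB; ring.
Qed.

Lemma heat_atZ (R : realType) (k : nat) (c : R) (z : 'rV[R]_k -> R -> R) x t (g : R) :
  heat_at z x t g -> heat_at (fun x t => c * z x t) x t (c * g).
Proof.
move=> [a [b [ha hb <-]]]; exists (c * a), (fun j => c * b j); split.
- exact: has_d1Z.
- by move=> j; exact: has_d2Z.
- by rewrite -mulr_sumr; ring.
Qed.

Lemma heat_atN (R : realType) (k : nat) (z : 'rV[R]_k -> R -> R) x t (g : R) :
  heat_at z x t g -> heat_at (fun x t => - z x t) x t (- g).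
Proof.
move=> /(heat_atZ (-1)); rewrite mulN1r.
rewrite (_ : (fun x t => _ * _) = (fun x t => - z x t))//.
by apply/funext => y; apply/funext => s; rewrite mulN1r.
Qed.

Lemma heat_at_shiftx (R : realType) (k : nat) (z : 'rV[R]_k -> R -> R) v x t (g : R) :
  heat_at z (x + v) t g -> heat_at (fun x t => z (x + v) t) x t g.
Proof.
move=> [a [b [ha hb <-]]]; exists a, b; split => //.
by move=> j; apply: has_d2_ext (hb j) => s; rewrite addrAC.
Qed.

(** Written as a shift along the first axis: for l = x_1 + h / 2 the reflected point is x + h e_1,
    which later turns ordered reflections into monotonicity. *)
Definition refl (R : realType) (n : nat) (l : R) (x : 'rV[R]_n.+1) : 'rV[R]_n.+1 :=
  x + (2 * l - 2 * x 0 ord0) *: basis_vec ord0.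

Lemma reflE (R : realType) (n : nat) (l : R) (x : 'rV[R]_n.+1) j :
  refl l x 0 j = if j == ord0 then 2 * l - x 0 ord0 else x 0 j.
Proof.
rewrite /refl addZbasisE; case: eqP => [->|_]; last by rewrite mulr0 addr0.
by rewrite mulr1; ring.
Qed.

Lemma refl_addZ (R : realType) (n : nat) (l : R) (x : 'rV[R]_n.+1) (s : R) j :
  refl l (x + s *: basis_vec j) =
  refl l x + (if j == ord0 then - s else s) *: basis_vec j.
Proof.
apply/rowP => i; rewrite [RHS]addZbasisE !reflE !addZbasisE.
have [->|i0] := eqVneq i ord0.
  by rewrite (eq_sym ord0 j); case: (j == ord0) => /=; ring.
by have [->|_] := eqVneq j ord0; rewrite ?(negbTE i0) ?mulr0.
Qed.

Lemma heat_at_refl (R : realType) (n : nat) (l : R) (z : 'rV[R]_n.+1 -> R -> R) x t (g : R) :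
  heat_at z (refl l x) t g -> heat_at (fun x t => z (refl l x) t) x t g.
Proof.
move=> [a [b [ha hb <-]]]; exists a, b; split => //.
move=> j; have [j0|j0] := eqVneq j ord0; last first.
  by apply: has_d2_ext (hb j) => s; rewrite refl_addZ (negbTE j0).
apply: has_d2_ext (has_d2_oppl (hb j)) => s.
by rewrite refl_addZ j0 eqxx.
Qed.

Lemma addZ_continuous (R : realType) (k : nat) (T : topologicalType)
    (X : T -> 'rV[R]_k) (s : T -> R) (v : 'rV[R]_k) :
  continuous X -> continuous s -> continuous (fun p => X p + s p *: v).
Proof.
move=> cX cs p; rewrite /continuous_at; apply: (@cvgD R 'rV[R]_k); first exact: cX.
by apply: (@cvgZ R 'rV[R]_k); [exact: cs|exact: cvg_cst].
Qed.

Lemma contD (R : realType) (T : topologicalType) (f g : T -> R) :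
  continuous f -> continuous g -> continuous (fun p => f p + g p).
Proof. by move=> cf cg p; apply: cvgD; [exact: cf|exact: cg]. Qed.

Lemma contB (R : realType) (T : topologicalType) (f g : T -> R) :
  continuous f -> continuous g -> continuous (fun p => f p - g p).
Proof. by move=> cf cg p; apply: cvgB; [exact: cf|exact: cg]. Qed.

Lemma contM (R : realType) (T : topologicalType) (f g : T -> R) :
  continuous f -> continuous g -> continuous (fun p => f p * g p).
Proof. by move=> cf cg p; apply: cvgM; [exact: cf|exact: cg]. Qed.

Lemma contcst (R : realType) (T : topologicalType) (c : R) :
  continuous (fun _ : T => c).
Proof. by move=> p; exact: cvg_cst. Qed.

Lemma contcomp (T U V : topologicalType) (f : T -> U) (g : U -> V) :
  continuous f -> continuous g -> continuous (fun p => g (f p)).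
Proof. by move=> cf cg p; apply: continuous_comp; [exact: cf|exact: cg]. Qed.

Lemma contcoord (R : realType) (k : nat) (T : topologicalType) (X : T -> 'rV[R]_k) j :
  continuous X -> continuous (fun p => X p 0 j).
Proof. by move=> cX; apply: (@contcomp _ _ _ X (fun M : 'rV[R]_k => M 0 j) cX); exact: coord_continuous.
Qed.

Lemma contid (T : topologicalType) : continuous (fun p : T => p).
Proof. by move=> p; exact: cvg_id. Qed.

Lemma contfst (T U : topologicalType) : continuous (fun p : T * U => p.1).
Proof. by move=> p; exact: cvg_fst. Qed.

Lemma contsnd (T U : topologicalType) : continuous (fun p : T * U => p.2).
Proof. by move=> p; exact: cvg_snd. Qed.

Lemma refl_continuous (R : realType) (n : nat) (l : R) : continuous (@refl R n l).
Proof.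
apply: addZ_continuous; first exact: contid.
apply: contB; first exact: contcst.
by apply: contM; [exact: contcst|exact: coord_continuous].
Qed.

(** [a] and [b j] stand for the derivatives of a function touching [z] from below at (x, t). Stated
    in increments, the test applies at a final time and to test functions whose derivatives are
    never computed. *)
Lemma heat_min_test (R : realType) (k : nat) (z : 'rV[R]_k -> R -> R) x t (g a A : R)
    (b : 'I_k -> R) :
  heat_at z x t g ->
  (exists2 d : R, 0 < d & forall s : R, 0 < s < d ->
    z x t - z x (t - s) <= a * s + A * s ^+ 2) ->
  (forall j, exists2 d : R, 0 < d & forall s : R, 0 < s < d ->
    b j * s ^+ 2 <= z (x + s *: basis_vec j) t + z (x - s *: basis_vec j) t - 2 * z x t) ->
  g <= a - \sum_j b j.
Proof.
move=> [a' [b' [ha hb <-]]] [d d0 Hd] H.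
have h1 : a' <= a.
  by apply: (@has_d1_le _ _ _ a A ha); exists d => // s /Hd; rewrite addr0.
have h2 : \sum_j b j <= \sum_j b' j.
  apply: ler_sum => j _; rewrite -lerN2.
  have [d' d'0 Hd'] := H j.
  apply: (has_d2_le (g := fun s => - z (x + s *: basis_vec j) t)).
    rewrite -mulN1r; apply: has_d2_ext (has_d2Z (-1) (hb j)) => s; exact: mulN1r.
  by exists d' => // s /Hd'; rewrite scale0r addr0 scaleNr; lra.
lra.
Qed.

Lemma heat_max_test (R : realType) (k : nat) (z : 'rV[R]_k -> R -> R) x t (g a A : R)
    (b : 'I_k -> R) :
  heat_at z x t g ->
  (exists2 d : R, 0 < d & forall s : R, 0 < s < d ->
    a * s - A * s ^+ 2 <= z x t - z x (t - s)) ->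
  (forall j, exists2 d : R, 0 < d & forall s : R, 0 < s < d ->
    z (x + s *: basis_vec j) t + z (x - s *: basis_vec j) t - 2 * z x t <= b j * s ^+ 2) ->
  a - \sum_j b j <= g.
Proof.
move=> /heat_atN H [d d0 Hd] Hb.
have := @heat_min_test R k _ x t _ (- a) A (fun j => - b j) H.
rewrite sumrN opprK -lerN2 opprK opprD opprK => -> //.
- by exists d => // s /Hd; lra.
- by move=> j; have [d' d'0 Hd'] := Hb j; exists d' => // s /Hd'; lra.
Qed.

(** * Interior estimates *)

Definition halfspace_gt (R : realType) (n : nat) (a : R) : set 'rV[R]_n.+1 :=
  [set x | a < x 0 ord0].

(** No boundary data, initial data or derivative bounds are part of it, so solutions and their
    difference quotients belong to classes of the same kind and the estimates can be iterated. *)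
Definition heat_bounded (R : realType) (n : nat) (a M K : R)
    (z : 'rV[R]_n.+1 -> R -> R) : Prop :=
  continuous_on (@halfspace_gt R n a) z /\
  forall (x : 'rV[R]_n.+1) (t : R), a < x 0 ord0 ->
    `|z x t| <= M /\ exists2 g : R, `|g| <= K & heat_at z x t g.

Lemma heat_boundedN (R : realType) (n : nat) (a M K : R) (z : 'rV[R]_n.+1 -> R -> R) :
  heat_bounded a M K z -> heat_bounded a M K (fun x t => - z x t).
Proof.
move=> [cz H]; split; first by move=> p; apply: continuousN; exact: cz.
move=> x t /(H x t)[zM [g gK hg]]; rewrite normrN; split => //.
by exists (- g); rewrite ?normrN//; exact: heat_atN.
Qed.

(** Centred, so that in the variables x_j and y it is a function of x_j + y minus a function of x_j
    - y, hence formally a solution of the wave equation; a one-sided difference does not have this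
    property. *)
Definition dlt (R : realType) (k : nat) (j : 'I_k) (y : R) (z : 'rV[R]_k -> R -> R)
    (x : 'rV[R]_k) (t : R) : R :=
  z (x + y *: basis_vec j) t - z (x - y *: basis_vec j) t.

Lemma dlt0 (R : realType) (k : nat) (j : 'I_k) (z : 'rV[R]_k -> R -> R) x t :
  dlt j 0 z x t = 0.
Proof. by rewrite /dlt scale0r addr0 subr0 subrr. Qed.

Lemma dltC (R : realType) (k : nat) (i j : 'I_k) (y1 y2 : R) (z : 'rV[R]_k -> R -> R) x t :
  dlt i y1 (dlt j y2 z) x t = dlt j y2 (dlt i y1 z) x t.
Proof.
rewrite /dlt (addrAC x (y2 *: _)) (addrAC x (y2 *: _)) (addrAC x (- (y2 *: _))).
by rewrite (addrAC x (- (y2 *: _))); ring.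
Qed.

Lemma heat_at_dlt (R : realType) (k : nat) (j : 'I_k) (y : R)
    (z : 'rV[R]_k -> R -> R) x t (g h : R) :
  heat_at z (x + y *: basis_vec j) t g -> heat_at z (x - y *: basis_vec j) t h ->
  heat_at (dlt j y z) x t (g - h).
Proof. by move=> zg zh; exact: heat_atB (heat_at_shiftx zg) (heat_at_shiftx zh). Qed.

(* Second differences of [dlt j y z] in the direction [j] can be taken in the
   step [y] instead of the point: this is what lets a barrier depending on the
   steps control the Laplacian. *)
Lemma dlt_swap (R : realType) (k : nat) (j : 'I_k) (y s : R) (z : 'rV[R]_k -> R -> R) x t :
  dlt j y z (x + s *: basis_vec j) t + dlt j y z (x - s *: basis_vec j) t =
  dlt j (y + s) z x t + dlt j (y - s) z x t.
Proof.
rewrite /dlt !scalerDl !scaleNr !opprD !opprK !addrA.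
rewrite (addrAC x (s *: _) (y *: _)) (addrAC x (- (s *: _)) (y *: _)).
by rewrite (addrAC x (s *: _) (- _)) (addrAC x (- (s *: _)) (- _)); ring.
Qed.

Lemma sum_delta (R : realType) (k : nat) (j : 'I_k) (a c : R) :
  \sum_i (a - (i == j)%:R * c) = a * k%:R - c.
Proof.
rewrite sumrB sumr_const card_ord mulr_natr; congr (_ - _).
rewrite (bigD1 j)//= eqxx mulr1n mul1r big1 ?addr0//.
by move=> i /negbTE ->; rewrite mul0r.
Qed.

Definition pcyl (R : realType) (n : nat) (r : R) (x : 'rV[R]_n.+1) : set 'rV[R]_n.+1 :=
  box (fun k => x 0 k - r) (fun k => x 0 k + r).

Lemma pcyl_interior (R : realType) (n : nat) (r : R) (x y : 'rV[R]_n.+1) :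
  0 <= r -> sqn (y - x) < r ^+ 2 -> forall k, x 0 k - r < y 0 k < x 0 k + r.
Proof.
move=> r0 h k; have : `|(y - x) 0 k| ^+ 2 < r ^+ 2.
  by rewrite real_normK ?num_real//; exact: le_lt_trans (sqr_le_sqn _ k) h.
by rewrite ltr_sqr ?nnegrE// ltr_norml !mxE; lra.
Qed.

(** Maximum principle for [dlt j y z] in the variables (x, y, t), with barrier A y (2 r - y) plus a
    penalty. The second difference in direction j is taken in y, where the barrier has second
    derivative - 2 A; a large A beats the bounded sources and the penalty. *)
Lemma lip_interior_le (R : realType) (n : nat) (r M K : R) :
  0 < r -> 0 <= M -> 0 <= K -> exists2 C : R, 0 <= C &
  forall a z, @heat_bounded R n a M K z ->
  forall j (x : 'rV[R]_n.+1) t y, a + 2 * r < x 0 ord0 -> 0 <= y <= r ->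
    dlt j y z x t <= C * y.
Proof.
move=> r0 M0 K0; have r20 : 0 < r ^+ 2 by rewrite exprn_gt0.
(* With this [B] the penalty is at least 2 M, a bound for [dlt], as soon as a lateral or the initial
   face of the cylinder is reached. *)
pose B := 2 * M / r ^+ 2; have B0 : 0 <= B by rewrite divr_ge0 ?mulr_ge0// ltW.
have Br : B * r ^+ 2 = 2 * M by rewrite /B divfK// gt_eqF.
pose A := K + B * n.+2%:R + 1.
have BN : B <= B * n.+2%:R by rewrite ler_peMr// ler1n.
have A0 : 0 <= A by rewrite /A; lra.
exists (2 * r * A); first by rewrite !mulr_ge0// ltW.
move=> a z [cz Hz] j x t y xa /andP[y0 yr].
pose T : topologicalType := ('rV[R]_n.+1 * R * R)%type.
pose D : set T := (pcyl r x `*` [set y : R | 0 <= y <= r]) `*` [set s : R | t - r ^+ 2 <= s <= t].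
have inD (x' : 'rV[R]_n.+1) (y' : R) : pcyl r x x' -> 0 <= y' <= r ->
    a < (x' + y' *: basis_vec j) 0 ord0 /\ a < (x' - y' *: basis_vec j) 0 ord0.
  move=> /(_ ord0) h1 h2; rewrite -scaleNr !addZbasisE.
  by case: (ord0 == j); rewrite ?mulr1 ?mulr0; lra.
have dltM (x' : 'rV[R]_n.+1) (y' s : R) : pcyl r x x' -> 0 <= y' <= r ->
    dlt j y' z x' s <= B * r ^+ 2.
  move=> h1 h2; have [/(Hz _ s)[H1 _] /(Hz _ s)[H2 _]] := inD _ _ h1 h2.
  by rewrite Br /dlt; move: H1 H2; rewrite !ler_norml; lra.
pose F (p : T) := A * (p.1.2 * (2 * r - p.1.2)) + B * (sqn (p.1.1 - x) + (t - p.2))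
  - dlt j p.1.2 z p.1.1 p.2.
have cD : compact D.
  by apply: compact_setX; [apply: compact_setX; [exact: box_compact|]|]; exact: itv_compact.
have cp1 : continuous (fun p : T => p.1.1) by apply: contcomp; exact: contfst.
have cp2 : continuous (fun p : T => p.1.2) by apply: (contcomp (@contfst _ _)); exact: contsnd.
have cp3 : continuous (fun p : T => p.2) by exact: contsnd.
have cF : {within D, continuous F}.
  apply: withinB.
    apply: continuous_subspaceT; apply: contD.
      apply: contM; first exact: contcst.
      by apply: contM => //; apply: contB => //; exact: contcst.
    apply: contM; first exact: contcst.
    apply: contD; last by apply: contB => //; exact: contcst.
    apply: (@contcomp _ _ _ (fun p : T => p.1.1 - x) (@sqn R n.+1)); last exact: sqn_continuous.
    move=> p; apply: (@cvgB R 'rV[R]_n.+1); [exact: cp1|exact: cvg_cst].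
  apply: withinB; apply: (within_comp cz) => //.
  - by move=> [[x' y'] s] [[/= h1 h2] _]; case: (inD _ _ h1 h2).
  - exact: addZ_continuous.
  - by move=> [[x' y'] s] [[/= h1 h2] _]; case: (inD _ _ h1 h2).
  - rewrite (_ : (fun p : T => _) = (fun p : T => p.1.1 + (- p.1.2) *: basis_vec j)).
      by apply: addZ_continuous => // p; apply: cvgN; exact: cp2.
    by apply/funext => p; rewrite scaleNr.
have xx : pcyl r x x by move=> k; lra.
have D0 : D (x, y, t) by split; [split => //=; rewrite y0|move=> /=; lra].
have [[[x' y'] s] [[/= h1 h2] h3] Hmin] := EVT_min (ex_intro _ _ D0) cD cF.
suff F0 : 0 <= F (x', y', s).
  have := le_trans F0 (Hmin _ D0); rewrite /F /= subrr sqn0 subrr addr0 mulr0 addr0 subr_ge0.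
  move/le_trans; apply; rewrite (_ : 2 * r * A * y = A * (y * (2 * r))); last by ring.
  by rewrite ler_wpM2l// ler_wpM2l//; lra.
rewrite leNgt; apply/negP => F0.
have Hm (x2 : 'rV[R]_n.+1) (y2 s2 : R) : pcyl r x x2 -> 0 <= y2 <= r ->
    t - r ^+ 2 <= s2 <= t -> F (x', y', s) <= F (x2, y2, s2) by move=> *; exact: Hmin.
have q0 : 0 <= sqn (x' - x) + (t - s) by have := sqn_ge0 (x' - x); lra.
have Ay0 : 0 <= A * (y' * (2 * r - y')) by rewrite !mulr_ge0//; lra.
have Bq0 : 0 <= B * (sqn (x' - x) + (t - s)) by rewrite mulr_ge0.
(* A negative minimum lies on no face: at y = 0 the difference vanishes, at y = r the barrier is A
   r^2, which is at least 2 M, and the penalty handles the remaining faces. *)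
have ylo : 0 < y'.
  rewrite lt_neqAle eq_sym; apply/andP; split; last by lra.
  by apply/eqP => E; move: F0; rewrite /F/= E dlt0 -E; lra.
have yhi : y' < r.
  rewrite lt_neqAle; apply/andP; split; last by lra.
  apply/eqP => E; have := dltM x' y' s h1 h2; move: F0; rewrite /F/=.
  have : B * r ^+ 2 <= A * (y' * (2 * r - y')).
    rewrite E (_ : r * (2 * r - r) = r ^+ 2); last by ring.
    by rewrite ler_wpM2r ?(ltW r20)//; rewrite /A; lra.
  lra.
have qlt : sqn (x' - x) + (t - s) < r ^+ 2.
  rewrite ltNge; apply/negP => h; have := dltM x' y' s h1 h2; move: F0; rewrite /F/=.
  have : B * r ^+ 2 <= B * (sqn (x' - x) + (t - s)) by rewrite ler_wpM2l.
  lra.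
have xin := @pcyl_interior R n r x x' (ltW r0).
have {}xin : forall k, x 0 k - r < x' 0 k < x 0 k + r by apply: xin; lra.
have slo : t - r ^+ 2 < s by have := sqn_ge0 (x' - x); lra.
have [/(Hz _ s)[_ [g1 g1K H1]] /(Hz _ s)[_ [g2 g2K H2]]] := inD _ _ h1 h2.
have := @heat_max_test R n.+1 _ x' s _ (- B) 0 (fun k => 2 * B - (k == j)%:R * (2 * A + 2 * B))
  (heat_at_dlt H1 H2).
rewrite sum_delta => test; have {test} : - B - (2 * B * n.+1%:R - (2 * A + 2 * B)) <= g1 - g2.
  apply: test.
    exists (s - (t - r ^+ 2)); first by rewrite subr_gt0.
    move=> e /andP[e0 e1]; have := Hm x' y' (s - e) h1 h2; rewrite /F/= => H.
    have {}H := H ltac:(clear - e0 e1 h3; lra).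
    by move: H; rewrite !mulrDr; clear; lra.
  move=> k; have [->|kj] := eqVneq k j.
    exists (Num.min y' (r - y')); first by rewrite lt_min ylo subr_gt0.
    move=> e /andP[e0]; rewrite lt_min => /andP[e1 e2]; rewrite dlt_swap.
    have := Hm x' (y' + e) s h1; have := Hm x' (y' - e) s h1; rewrite /F/=.
    move=> E1 E2; have {}E1 := E1 ltac:(clear - e0 e1 yhi; lra) h3.
    have {}E2 := E2 ltac:(clear - e0 e2 ylo; lra) h3.
    by move: E1 E2; rewrite expr2; clear; nra.
  have [d d0 Hd] := box_near h1 (xin k).
  exists d => // e /Hd[b1 b2]; rewrite mul0r subr0.
  have := Hm _ _ _ b1 h2 h3; have := Hm _ _ _ b2 h2 h3.
  have := sqn_d2 x' x e k; rewrite /F/=.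
  move=> E; have {}E := congr1 (fun u => B * u) E; move: E => /=; clear; lra.
move: g1K g2K; rewrite !ler_norml /A -[n.+2]addn1 natrD => g1K g2K; lra.
Qed.

Lemma lip_interior (R : realType) (n : nat) (r M K : R) :
  0 < r -> 0 <= M -> 0 <= K -> exists2 C : R, 0 <= C &
  forall a z, @heat_bounded R n a M K z ->
  forall j (x : 'rV[R]_n.+1) t y, a + 2 * r < x 0 ord0 -> 0 <= y <= r ->
    `|dlt j y z x t| <= C * y.
Proof.
move=> r0 M0 K0; have [C C0 H] := @lip_interior_le R n r M K r0 M0 K0.
exists C => // a z Hz j x t y xa yr; rewrite ler_norml (H a z Hz)// andbT.
have := H a _ (heat_boundedN Hz) j x t y xa yr; rewrite /dlt; lra.
Qed.

(** Barrier for mixed differences. The product y1 y2 vanishes on both axes but is linear in each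
    variable; the division makes it strictly concave in either one. Its degree 3/2 is the origin of
    the exponent 1/2 for the Hessian. At y1 = y2 = 0, division by zero yields the right value 0. *)
Definition corner (R : realType) (y1 y2 : R) : R := y1 * y2 / Num.sqrt (y1 + y2).

Lemma cornerC (R : realType) (y1 y2 : R) : corner y1 y2 = corner y2 y1.
Proof. by rewrite /corner (mulrC y1) (addrC y1). Qed.

Lemma corner_ge0 (R : realType) (y1 y2 : R) : 0 <= y1 -> 0 <= y2 -> 0 <= corner y1 y2.
Proof. by move=> h1 h2; rewrite /corner !mulr_ge0// invr_ge0 sqrtr_ge0. Qed.

(* With [c = sqrt (y1 + y2)] fixed, [corner] is [y2 * c - y2 ^+ 2 / c], the
   difference of a concave and a convex function of [y1]. *)
Lemma corner_d2 (R : realType) (y1 y2 s : R) : 0 < y2 -> 0 < s -> s < y1 ->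
  corner (y1 + s) y2 + corner (y1 - s) y2 - 2 * corner y1 y2 <=
  - (y2 / (4 * ((y1 + y2) * Num.sqrt (y1 + y2)))) * s ^+ 2.
Proof.
move=> y20 s0 sy; rewrite /corner.
have h1 : 0 < y1 + s + y2 by lra.
have h2 : 0 < y1 - s + y2 by lra.
have h3 : 0 < y1 + y2 by lra.
have E1 := sqr_sqrtr (ltW h1); have E2 := sqr_sqrtr (ltW h2); have E3 := sqr_sqrtr (ltW h3).
have := h1; have := h2; have := h3; rewrite -sqrtr_gt0 => c0.
rewrite -sqrtr_gt0 => d0; rewrite -sqrtr_gt0 => a0.
move: E1 E2 E3 c0 d0 a0; set a := Num.sqrt (y1 + s + y2); set d := Num.sqrt (y1 - s + y2).
set c := Num.sqrt (y1 + y2) => E1 E2 E3 c0 d0 a0.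
have -> : (y1 + s) * y2 / a = y2 * a - y2 ^+ 2 / a.
  by rewrite (_ : y1 + s = a ^+ 2 - y2); [field; rewrite gt_eqF|lra].
have -> : (y1 - s) * y2 / d = y2 * d - y2 ^+ 2 / d.
  by rewrite (_ : y1 - s = d ^+ 2 - y2); [field; rewrite gt_eqF|lra].
have -> : y1 * y2 / c = y2 * c - y2 ^+ 2 / c.
  by rewrite (_ : y1 = c ^+ 2 - y2); [field; rewrite gt_eqF|lra].
rewrite -E3.
have c30 : 0 < c ^+ 3 by rewrite exprn_gt0.
have Ea : a ^+ 2 = c ^+ 2 + s by lra.
have Ed : d ^+ 2 = c ^+ 2 - s by lra.
have Dle : (a + d) ^+ 2 <= (2 * c) ^+ 2 by have := sqr_ge0 (a - d); nra.
have adc : a + d <= 2 * c by rewrite -ler_sqr ?nnegrE; lra.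
have Ead : (a - d) * (a + d) = 2 * s by rewrite -subr_sqr; lra.
have sad : s <= (a - d) * c.
  have : 0 < a - d by nra.
  by nra.
have ad2 : (s / c) ^+ 2 <= (a - d) ^+ 2.
  rewrite ler_sqr ?nnegrE; [|by rewrite divr_ge0// ltW|by nra].
  by rewrite ler_pdivrMr.
(* For the three roots, (a + d)^2 = 4 c^2 - (a - d)^2 and a - d is at least s / c, so it suffices to
   compare squares. *)
have conc : a + d <= 2 * c - s ^+ 2 / (4 * c ^+ 3).
  have s2c : s ^+ 2 <= c ^+ 4.
    have -> : c ^+ 4 = (c ^+ 2) ^+ 2 by ring.
    by rewrite ler_sqr ?nnegrE ?sqr_ge0 ?(ltW s0)//; have := sqr_ge0 d; lra.
  have p0 : 0 <= 2 * c - s ^+ 2 / (4 * c ^+ 3).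
    rewrite subr_ge0 ler_pdivrMr ?mulr_gt0//.
    rewrite (_ : 2 * c * (4 * c ^+ 3) = 8 * c ^+ 4); last by ring.
    by have := sqr_ge0 s; lra.
  rewrite -ler_sqr ?nnegrE//; last by lra.
  have -> : (2 * c - s ^+ 2 / (4 * c ^+ 3)) ^+ 2 =
    4 * c ^+ 2 - (s / c) ^+ 2 + (s ^+ 2 / (4 * c ^+ 3)) ^+ 2.
    by field; rewrite gt_eqF.
  have := sqr_ge0 (s ^+ 2 / (4 * c ^+ 3)); nra.
have conv : 2 / c <= a^-1 + d^-1.
  have -> : a^-1 + d^-1 = (a + d) / (a * d) by field; rewrite !gt_eqF.
  rewrite ler_pdivlMr ?mulr_gt0// mulrAC ler_pdivrMr//.
  by have := sqr_ge0 (a - d); nra.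
have -> : - (y2 / (4 * (c ^+ 2 * c))) * s ^+ 2 = - (y2 * (s ^+ 2 / (4 * c ^+ 3))).
  by field; rewrite gt_eqF.
have : y2 * (a + d) <= y2 * (2 * c - s ^+ 2 / (4 * c ^+ 3)) by rewrite ler_wpM2l// ltW.
have : y2 ^+ 2 * (2 / c) <= y2 ^+ 2 * (a^-1 + d^-1) by rewrite ler_wpM2l// sqr_ge0.
lra.
Qed.

(** The delicate point is the origin: there [corner] is dominated by Y1 sqrt (Y1 + Y2), a continuous
    function that vanishes. *)
Lemma corner_continuous (R : realType) (T : topologicalType) (K : set T) (Y1 Y2 : T -> R) :
  continuous Y1 -> continuous Y2 -> (forall p, K p -> 0 <= Y1 p /\ 0 <= Y2 p) ->
  {within K, continuous (fun p => corner (Y1 p) (Y2 p))}.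
Proof.
move=> c1 c2 H; apply/subspace_continuousP => p Kp.
have cs : continuous (fun p => Num.sqrt (Y1 p + Y2 p)).
  by apply: (contcomp (contD c1 c2)); exact: sqrt_continuous.
have [p1 p2] := H p Kp.
have [S0|S0] := eqVneq (Y1 p + Y2 p) 0; last first.
  apply: cvg_within_filter; apply: cvgM; first exact: contM.
  apply: cvgV; last exact: cs.
  by rewrite sqrtr_eq0 -ltNge lt_neqAle eq_sym S0 addr_ge0.
have Y10 : Y1 p = 0 by lra.
have ch : continuous (fun p => Y1 p * Num.sqrt (Y1 p + Y2 p)) by exact: contM.
apply/cvgrPdist_le => e e0; have /cvgrPdist_le/(_ e e0) := ch p.
rewrite Y10 mul0r => h; rewrite near_withinE; apply: filterS h => q + Kq.
have [q1 q2] := H q Kq.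
rewrite sub0r normrN => h; change (`|corner (Y1 p) (Y2 p) - corner (Y1 q) (Y2 q)| <= e).
rewrite {1}/corner Y10 !mul0r sub0r normrN ger0_norm; last exact: corner_ge0.
rewrite ger0_norm in h; last by rewrite mulr_ge0// sqrtr_ge0.
apply: le_trans h; rewrite /corner -mulrA ler_wpM2l//.
have [S|S] := eqVneq (Y1 q + Y2 q) 0; first by rewrite S sqrtr0 invr0 mulr0.
have Sp : 0 < Y1 q + Y2 q by rewrite lt_neqAle eq_sym S addr_ge0.
by rewrite ler_pdivrMr ?sqrtr_gt0// -expr2 sqr_sqrtr ?(ltW Sp)//; lra.
Qed.

Lemma withinZ (R : realType) (T : topologicalType) (K : set T) (c : R) (f : T -> R) :
  {within K, continuous f} -> {within K, continuous (fun p => c * f p)}.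
Proof. by move=> cf p; apply: cvgM; [exact: cvg_cst|exact: cf]. Qed.

(** The larger step y2 is at least half of y1 + y2, so the concavity in the smaller step stays
    bounded away from 0 down to the corner. *)
Lemma corner_coef (R : realType) (y1 y2 r : R) : 0 < y1 -> y1 <= y2 -> y2 <= r ->
  (8 * Num.sqrt (2 * r))^-1 <= y2 / (4 * ((y1 + y2) * Num.sqrt (y1 + y2))).
Proof.
move=> h1 h2 h3; have s0 : 0 < Num.sqrt (y1 + y2) by rewrite sqrtr_gt0; lra.
have q0 : 0 < Num.sqrt (2 * r) by rewrite sqrtr_gt0; lra.
have sq : Num.sqrt (y1 + y2) <= Num.sqrt (2 * r) by rewrite ler_wsqrtr//; lra.
rewrite ler_pdivlMr; last by rewrite !mulr_gt0//; lra.
rewrite ler_pdivrMl ?mulr_gt0//.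
apply: (@le_trans _ _ (4 * ((y1 + y2) * Num.sqrt (2 * r)))).
  by rewrite ler_wpM2l// ler_wpM2l//; lra.
nra.
Qed.

(** A is a sum of two parts: one turns the concavity in the smaller step into at least E, the other
    makes the barrier dominate C y on the face where the other step equals r. *)
Lemma corner_barrier (R : realType) (r E C : R) : 0 < r -> 0 <= E -> 0 <= C ->
  exists A : R, [/\ 0 <= A,
    forall y, 0 <= y <= r -> C * y <= A * corner r y &
    forall u v, 0 < u -> u <= v -> v <= r ->
      E <= A * (v / (4 * ((u + v) * Num.sqrt (u + v))))].
Proof.
move=> r0 E0 C0; pose q := Num.sqrt (2 * r).
have q0 : 0 < q by rewrite sqrtr_gt0; lra.
pose A1 := E * (8 * q); pose A2 := C * q / r.
have A10 : 0 <= A1 by rewrite !mulr_ge0// ltW.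
have A20 : 0 <= A2 by rewrite divr_ge0 ?mulr_ge0 ?(ltW q0) ?(ltW r0).
exists (A1 + A2); split; first exact: addr_ge0.
  move=> y h; have s0 : 0 < Num.sqrt (r + y) by rewrite sqrtr_gt0; lra.
  have sq : Num.sqrt (r + y) <= q by rewrite ler_wsqrtr//; lra.
  apply: (@le_trans _ _ (A2 * corner r y)); last first.
    by rewrite ler_wpM2r ?lerDr ?corner_ge0//; lra.
  rewrite /A2 /corner (_ : _ * (_ / _) = C * y * (q / Num.sqrt (r + y))); last first.
    by field; rewrite !gt_eqF.
  by rewrite ler_peMr ?mulr_ge0//; [lra|rewrite ler_pdivlMr// mul1r].
move=> u v u0 uv vr; have c := corner_coef u0 uv vr.
have v0 : 0 <= (8 * Num.sqrt (2 * r))^-1 by rewrite invr_ge0 mulr_ge0// ltW.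
apply: (@le_trans _ _ (A1 * (8 * Num.sqrt (2 * r))^-1)).
  by rewrite /A1 -/q mulfK// gt_eqF// mulr_gt0.
apply: (@le_trans _ _ (A1 * (v / (4 * ((u + v) * Num.sqrt (u + v)))))).
  by rewrite ler_wpM2l.
by rewrite ler_wpM2r ?lerDl ?(le_trans v0 c).
Qed.

(** The same scheme in (x, y1, y2, t). On a face where a step is 0 the mixed difference vanishes;
    where a step is r, the Lipschitz estimate bounds it linearly in the other step. The margin 4 r
    pays for the radius r of the cylinder, one step r, and the 2 r required by [lip_interior]. *)
Lemma zyg_interior_le (R : realType) (n : nat) (r M K : R) :
  0 < r -> 0 <= M -> 0 <= K -> exists2 C : R, 0 <= C &
  forall a z, @heat_bounded R n a M K z ->
  forall i j (x : 'rV[R]_n.+1) t y1 y2, a + 4 * r < x 0 ord0 ->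
    0 <= y1 <= r -> 0 <= y2 <= r ->
    dlt i y1 (dlt j y2 z) x t <= C * corner y1 y2.
Proof.
move=> r0 M0 K0; have [CL CL0 HL] := @lip_interior R n r M K r0 M0 K0.
have r20 : 0 < r ^+ 2 by rewrite exprn_gt0.
have [B B0 Br] : exists2 B, 0 <= B & B * r ^+ 2 = 4 * M.
  exists (4 * M / r ^+ 2); last by rewrite divfK// gt_eqF.
  by rewrite divr_ge0 ?(ltW r20)// mulr_ge0.
(* The concavity that contradicts the test: four sources of size K, the penalty in n + 1 directions
   and in time, and 1 to spare. *)
have [E E0 EE] : exists2 E, 0 <= E & E = 4 * K + 2 * B * n.+1%:R + B + 1.
  exists (4 * K + 2 * B * n.+1%:R + B + 1) => //.
  by have : 0 <= B * n.+1%:R by [rewrite mulr_ge0]; lra.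
have [A [A0 cornr co]] := corner_barrier r0 E0 (mulr_ge0 (ler0n R 2) CL0).
exists A => //.
move=> a z Hz0 i j x t y1 y2 xa y1r y2r.
have [cz Hz] := Hz0.
pose T : topologicalType := ('rV[R]_n.+1 * R * R * R)%type.
pose D : set T := ((pcyl r x `*` [set y : R | 0 <= y <= r]) `*` [set y : R | 0 <= y <= r])
  `*` [set s : R | t - r ^+ 2 <= s <= t].
have inD1 (x' : 'rV[R]_n.+1) (z1 z2 : R) : pcyl r x x' -> - r <= z1 <= r -> - r <= z2 <= r ->
    a < (x' + z1 *: basis_vec i + z2 *: basis_vec j) 0 ord0.
  move=> /(_ ord0) h1 h2 h3; rewrite !addZbasisE.
  by case: (ord0 == j); case: (ord0 == i); rewrite ?mulr1 ?mulr0; lra.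
have inD (x' : 'rV[R]_n.+1) (z1 z2 : R) : pcyl r x x' -> 0 <= z1 <= r -> 0 <= z2 <= r ->
    [/\ a < (x' + z1 *: basis_vec i + z2 *: basis_vec j) 0 ord0,
     a < (x' + z1 *: basis_vec i - z2 *: basis_vec j) 0 ord0,
     a < (x' - z1 *: basis_vec i + z2 *: basis_vec j) 0 ord0 &
     a < (x' - z1 *: basis_vec i - z2 *: basis_vec j) 0 ord0].
  by move=> h1 h2 h3; rewrite -!scaleNr; split; apply: inD1 => //; move: h2 h3; clear; lra.
have dltM (x' : 'rV[R]_n.+1) (z1 z2 s : R) : pcyl r x x' -> 0 <= z1 <= r -> 0 <= z2 <= r ->
    dlt i z1 (dlt j z2 z) x' s <= B * r ^+ 2.
  move=> h1 h2 h3; have [/(Hz _ s)[H1 _] /(Hz _ s)[H2 _] /(Hz _ s)[H3 _] /(Hz _ s)[H4 _]]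
    := inD _ _ _ h1 h2 h3.
  by rewrite Br /dlt; move: H1 H2 H3 H4; rewrite !ler_norml; lra.
have side k l (x' : 'rV[R]_n.+1) (z2 s : R) : pcyl r x x' -> 0 <= z2 <= r ->
    dlt k r (dlt l z2 z) x' s <= 2 * CL * z2.
  move=> /(_ ord0) h1 h2.
  have xin (u : R) : - r <= u <= r -> a + 2 * r < (x' + u *: basis_vec k) 0 ord0.
    by move=> hu; rewrite addZbasisE; case: (ord0 == k); rewrite ?mulr1 ?mulr0; lra.
  have := HL a z Hz0 l (x' + r *: basis_vec k) s z2 (xin r _) h2.
  have := HL a z Hz0 l (x' - r *: basis_vec k) s z2 _ h2.
  rewrite -scaleNr => /(_ (xin (- r) ltac:(clear - r0; lra))) + /(_ ltac:(clear - r0; lra)).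
  by rewrite {3}/dlt -scaleNr !ler_norml; lra.
pose F (p : T) := A * corner p.1.1.2 p.1.2 + B * (sqn (p.1.1.1 - x) + (t - p.2))
  - dlt i p.1.1.2 (dlt j p.1.2 z) p.1.1.1 p.2.
have cD : compact D.
  by do !apply: compact_setX; [exact: box_compact|..]; exact: itv_compact.
have cp0 : continuous (fun p : T => p.1.1).
  by apply: contcomp; exact: contfst.
have cp1 : continuous (fun p : T => p.1.1.1) by apply: (contcomp cp0); exact: contfst.
have cp2 : continuous (fun p : T => p.1.1.2) by apply: (contcomp cp0); exact: contsnd.
have cp3 : continuous (fun p : T => p.1.2) by apply: (contcomp (@contfst _ _)); exact: contsnd.
have cp4 : continuous (fun p : T => p.2) by exact: contsnd.
have cN2 : continuous (fun p : T => - p.1.1.2) by move=> p; apply: cvgN; exact: cp2.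
have cN3 : continuous (fun p : T => - p.1.2) by move=> p; apply: cvgN; exact: cp3.
have cF : {within D, continuous F}.
  apply: withinB.
    apply: withinD.
      apply: withinZ; apply: (@corner_continuous R T D (fun p => p.1.1.2) (fun p => p.1.2)) => //.
      by move=> [[[x' z1] z2] s] [[[/= _ /andP[? _]] /andP[? _]] _].
    apply: continuous_subspaceT.
    apply: contM; first exact: contcst.
    apply: contD; last by apply: contB => //; exact: contcst.
    apply: (@contcomp _ _ _ (fun p : T => p.1.1.1 - x) (@sqn R n.+1)); last exact: sqn_continuous.
    move=> p; apply: (@cvgB R 'rV[R]_n.+1); [exact: cp1|exact: cvg_cst].
  have W (f1 f2 : T -> R) : continuous f1 -> continuous f2 ->
      (forall p, D p -> - r <= f1 p <= r /\ - r <= f2 p <= r) ->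
      {within D, continuous (fun p : T => z (p.1.1.1 + f1 p *: basis_vec i + f2 p *: basis_vec j) p.2)}.
    move=> c1 c2 H; apply: (within_comp cz) => //.
    - move=> p Dp; have [h1 h2] := H p Dp; apply: inD1 => //.
      by case: p {h1 h2} Dp => [[[x' z1] z2] s] [[[/= ? _] _] _].
    - by apply: addZ_continuous => //; exact: addZ_continuous.
  rewrite /dlt (_ : (fun p : T => _) = (fun p : T =>
     (z (p.1.1.1 + p.1.1.2 *: basis_vec i + p.1.2 *: basis_vec j) p.2 -
      z (p.1.1.1 + p.1.1.2 *: basis_vec i + (- p.1.2) *: basis_vec j) p.2) -
     (z (p.1.1.1 + (- p.1.1.2) *: basis_vec i + p.1.2 *: basis_vec j) p.2 -
      z (p.1.1.1 + (- p.1.1.2) *: basis_vec i + (- p.1.2) *: basis_vec j) p.2))); last first.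
    by apply/funext => p; rewrite !scaleNr.
  have DD p : D p -> 0 <= p.1.1.2 <= r /\ 0 <= p.1.2 <= r.
    by case: p => [[[x' z1] z2] s] [[[/= _ ?] ?] _].
  by apply: withinB; apply: withinB; apply: W => // p /DD[h1 h2]; move: h1 h2; clear; lra.
have xx : pcyl r x x by move=> k; lra.
have D0 : D (x, y1, y2, t) by split; [split => //=|move=> /=; lra].
have [[[[x' z1] z2] s] [[[/= h1 h2] h2'] h3] Hmin] := EVT_min (ex_intro _ _ D0) cD cF.
suff F0 : 0 <= F (x', z1, z2, s).
  have := le_trans F0 (Hmin _ D0).
  by rewrite /F /= subrr sqn0 subrr addr0 mulr0 addr0 subr_ge0.
rewrite leNgt; apply/negP => F0; rewrite /F/= in F0.
have Hm (x2 : 'rV[R]_n.+1) (z3 z4 s2 : R) : pcyl r x x2 -> 0 <= z3 <= r -> 0 <= z4 <= r ->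
    t - r ^+ 2 <= s2 <= t ->
    A * corner z1 z2 + B * (sqn (x' - x) + (t - s)) - dlt i z1 (dlt j z2 z) x' s <=
    A * corner z3 z4 + B * (sqn (x2 - x) + (t - s2)) - dlt i z3 (dlt j z4 z) x2 s2.
  by move=> *; apply: (Hmin (x2, z3, z4, s2)).
clear F cF D0 Hmin cD cp0 cp1 cp2 cp3 cp4 cN2 cN3 D T inD1 xx HL.
have q0' : 0 <= sqn (x' - x) + (t - s) by have := sqn_ge0 (x' - x); lra.
have /andP[z10 _] := h2; have /andP[z20 _] := h2'.
have Ay0 : 0 <= A * corner z1 z2 by rewrite !mulr_ge0// corner_ge0.
have Bq0 : 0 <= B * (sqn (x' - x) + (t - s)) by rewrite mulr_ge0.
have z1lo : 0 < z1.
  rewrite lt_neqAle eq_sym z10 andbT.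
  by apply/eqP => Ez; move: F0; rewrite Ez dlt0 -Ez; lra.
have z2lo : 0 < z2.
  rewrite lt_neqAle eq_sym z20 andbT.
  by apply/eqP => Ez; move: F0; rewrite dltC Ez dlt0 -Ez; lra.
have z1hi : z1 < r.
  rewrite lt_neqAle; apply/andP; split; last by lra.
  apply/eqP => Ez; move: F0; rewrite Ez.
  by have := side i j x' z2 s h1 h2'; have := cornr z2 h2'; lra.
have z2hi : z2 < r.
  rewrite lt_neqAle; apply/andP; split; last by lra.
  apply/eqP => Ez; move: F0; rewrite Ez dltC cornerC.
  by have := side j i x' z1 s h1 h2; have := cornr z1 h2; lra.
have qlt : sqn (x' - x) + (t - s) < r ^+ 2.
  rewrite ltNge; apply/negP => h; have := dltM x' z1 z2 s h1 h2 h2'; move: F0.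
  have : B * r ^+ 2 <= B * (sqn (x' - x) + (t - s)) by rewrite ler_wpM2l.
  lra.
have xin := @pcyl_interior R n r x x' (ltW r0).
have {}xin : forall k, x 0 k - r < x' 0 k < x 0 k + r by apply: xin; lra.
have slo : t - r ^+ 2 < s by have := sqn_ge0 (x' - x); lra.
have [/(Hz _ s)[_ [g1 g1K H1]] /(Hz _ s)[_ [g2 g2K H2]] /(Hz _ s)[_ [g3 g3K H3]]
  /(Hz _ s)[_ [g4 g4K H4]]] := inD _ _ _ h1 h2 h2'.
(* [l] is the direction of the smaller of the two steps, the one in which the barrier is uniformly
   concave; its second difference in space is exchanged for one in that step. *)
have [l Hl] : exists l, exists2 d : R, 0 < d & forall e : R, 0 < e < d ->
    dlt i z1 (dlt j z2 z) (x' + e *: basis_vec l) s +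
    dlt i z1 (dlt j z2 z) (x' - e *: basis_vec l) s - 2 * dlt i z1 (dlt j z2 z) x' s <=
    - E * e ^+ 2.
  have [z12|z21] := leP z1 z2.
    exists i, (Num.min z1 (r - z1)); first by rewrite lt_min z1lo subr_gt0.
    move=> e /andP[e0]; rewrite lt_min => /andP[e1 e2]; rewrite dlt_swap.
    have cd := corner_d2 z2lo e0 e1; have coe := co _ _ z1lo z12 (ltW z2hi).
    have := Hm x' (z1 + e) z2 s h1; have := Hm x' (z1 - e) z2 s h1; rewrite /=.
    move=> E1 E2; have {}E1 := E1 ltac:(clear - e0 e1 e2 z1lo; lra) h2' h3.
    have {}E2 := E2 ltac:(clear - e0 e1 e2 z1lo; lra) h2' h3.
    have {}cd := ler_wpM2l A0 cd; have {}coe := ler_wpM2r (sqr_ge0 e) coe.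
    by move: E1 E2 cd coe; clear; lra.
  exists j, (Num.min z2 (r - z2)); first by rewrite lt_min z2lo subr_gt0.
  move=> e /andP[e0]; rewrite lt_min => /andP[e1 e2]; rewrite !(dltC i j) dlt_swap.
  have cd := corner_d2 z1lo e0 e1; have coe := co _ _ z2lo (ltW z21) (ltW z1hi).
  have := Hm x' z1 (z2 + e) s h1 h2; have := Hm x' z1 (z2 - e) s h1 h2.
  rewrite !(cornerC z1) !(dltC i j).
  move=> E1 E2; have {}E1 := E1 ltac:(clear - e0 e1 e2 z2lo; lra) h3.
  have {}E2 := E2 ltac:(clear - e0 e1 e2 z2lo; lra) h3.
  have {}cd := ler_wpM2l A0 cd; have {}coe := ler_wpM2r (sqr_ge0 e) coe.
  by move: E1 E2 cd coe; clear; lra.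
have := @heat_max_test R n.+1 _ x' s _ (- B) 0
  (fun k => 2 * B - (k == l)%:R * (E + 2 * B))
  (heat_at_dlt (heat_at_dlt H1 H2) (heat_at_dlt H3 H4)).
rewrite sum_delta => test; have {test} :
    - B - (2 * B * n.+1%:R - (E + 2 * B)) <= g1 - g2 - (g3 - g4).
  apply: test.
    exists (s - (t - r ^+ 2)); first by rewrite subr_gt0.
    move=> e /andP[e0 e1]; have := Hm x' z1 z2 (s - e) h1 h2 h2'; move=> H.
    have {}H := H ltac:(clear - e0 e1 h3; lra).
    by move: H; rewrite !mulrDr; clear; lra.
  move=> k; have [->|kj] := eqVneq k l.
    have [d d0 Hd] := Hl; exists d => // e /Hd; rewrite mulr1n mul1r; clear; lra.
  have [d d0 Hd] := box_near h1 (xin k).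
  exists d => // e /Hd[b1 b2]; rewrite mul0r subr0.
  have := Hm _ _ _ _ b1 h2 h2' h3; have := Hm _ _ _ _ b2 h2 h2' h3.
  by have := congr1 (fun u => B * u) (sqn_d2 x' x e k) => /=; clear; lra.
by move: g1K g2K g3K g4K EE B0; rewrite !ler_norml; clear; lra.
Qed.

Lemma C21_d1t (R : realType) (k : nat) (D : set 'rV[R]_k) u x t :
  C21_on D u -> D x -> has_d1 (fun s => u x (t + s)) (dt u x t).
Proof.
move=> [_ [H _] _ _] Dx; apply/has_d1_R; rewrite /dt derive1E.
exact/derivableP/H.
Qed.

Lemma C21_d1x (R : realType) (k : nat) (D : set 'rV[R]_k) u x t j :
  C21_on D u -> D x -> has_d1 (fun s => u (x + s *: basis_vec j) t) (dx j u x t).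
Proof.
move=> [_ _ H _] Dx; have [Hd _] := H j.
by apply/(has_d1_is_derive (u ^~ t)); exact/derivableP/Hd.
Qed.

Lemma C21_d1xx (R : realType) (k : nat) (D : set 'rV[R]_k) u x t i j :
  C21_on D u -> D x -> has_d1 (fun s => dx j u (x + s *: basis_vec i) t) (dx i (dx j u) x t).
Proof.
move=> [_ _ _ H] Dx; have [Hd _] := H i j.
by apply/(has_d1_is_derive (dx j u ^~ t)); exact/derivableP/Hd.
Qed.

Lemma halfspace_near (R : realType) (n : nat) (x : 'rV[R]_n.+1) j (s a : R) :
  `|s| < x 0 ord0 - a -> a < (x + s *: basis_vec j) 0 ord0.
Proof.
by rewrite addZbasisE ltr_norml; case: (ord0 == j); rewrite ?mulr1 ?mulr0; lra.
Qed.

Lemma C21_heat (R : realType) (n : nat) (u : 'rV[R]_n.+1 -> R -> R) x t :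
  C21_on half_space u -> half_space x -> heat_at u x t (dt u x t - laplacian u x t).
Proof.
move=> Hu Hx; exists (dt u x t), (fun j => dx j (dx j u) x t); split => //.
  exact: C21_d1t Hu Hx.
move=> j; apply: (@has_d2_of_d1 _ _ (fun s => dx j u (x + s *: basis_vec j) t)).
  exists (x 0 ord0) => // s sx.
  have /(C21_d1x t j Hu) : half_space (x + s *: basis_vec j).
    by apply: halfspace_near; rewrite subr0.
  by apply: has_d1_ext => h; rewrite scalerDl addrA.
exact: C21_d1xx Hu Hx.
Qed.

Lemma has_d1_bound (R : realType) (g : R -> R) (c C : R) :
  has_d1 g c -> (exists2 d : R, 0 < d & forall h : R, 0 < h < d -> `|g h - g 0| <= C * h) ->
  `|c| <= C.
Proof.
move=> gc [d d0 Hd]; rewrite ler_norml; apply/andP; split.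
  rewrite lerNl; apply: (@has_d1_le _ (fun s => g (- s)) _ C 0); first exact: has_d1_oppl.
  by exists d => // s /Hd; rewrite oppr0 !opprK ler_norml; lra.
rewrite -[c]opprK; apply: (@has_d1_le _ (fun s => - g (- s)) _ C 0).
  by rewrite -mulN1r; apply: has_d1_ext (has_d1Z (-1) (has_d1_oppl gc)) => s; exact: mulN1r.
by exists d => // s /Hd; rewrite oppr0 !opprK ler_norml; lra.
Qed.

(** For y <= r the difference is centred at the midpoint; for y > r the trivial bound 2 M is at most
    (2 M / r) y. Shifts with y >= 0 never leave the half-space, so y can be arbitrarily large. *)
Lemma lip_shift (R : realType) (n : nat) (r M K : R) :
  0 < r -> 0 <= M -> 0 <= K -> exists2 C : R, 0 <= C &
  forall a z, @heat_bounded R n a M K z ->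
  forall j (x : 'rV[R]_n.+1) t y, a + r < x 0 ord0 -> 0 <= y ->
    `|z (x + y *: basis_vec j) t - z x t| <= C * y.
Proof.
move=> r0 M0 K0; have r20 : 0 < r / 2 by lra.
have [C C0 H] := @lip_interior R n (r / 2) M K r20 M0 K0.
exists (C + 2 * M / r); first by rewrite addr_ge0// divr_ge0 ?(ltW r0)// mulr_ge0.
move=> a z Hz j x t y xa y0.
have Mr : 0 <= 2 * M / r by rewrite divr_ge0 ?(ltW r0)// mulr_ge0.
have [yr|ry] := leP y r.
  apply: (@le_trans _ _ (C * y)); last by rewrite ler_wpM2r// lerDl.
  have := H a z Hz j (x + (y / 2) *: basis_vec j) t (y / 2).
  have -> : a + 2 * (r / 2) < (x + (y / 2) *: basis_vec j) 0 ord0.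
    by rewrite addZbasisE; case: (ord0 == j); rewrite ?mulr1 ?mulr0; lra.
  rewrite /dlt addrK -addrA -scalerDl -splitr => /(_ isT) H'.
  by apply: le_trans (H' _) _; [lra|rewrite ler_wpM2l//; lra].
have [_ Hb] := Hz; have [zx _] := Hb x t ltac:(lra).
have [zy _] : `|z (x + y *: basis_vec j) t| <= M /\ True.
  have [|//] := Hb (x + y *: basis_vec j) t.
  by rewrite addZbasisE; case: (ord0 == j); rewrite ?mulr1 ?mulr0; lra.
have : 2 * M / r * r <= 2 * M / r * y by rewrite ler_wpM2l// ltW.
rewrite divfK ?gt_eqF// mulrDl => h; have := mulr_ge0 C0 y0.
by move: zx zy; rewrite !ler_norml; lra.
Qed.

(** Vertices of a path from [x] to [x'] along coordinate directions. Such a path stays in any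
    product set, in particular in a half-space x_1 > r and in the orthant, and reduces arbitrary
    increments to directional ones. *)
Definition mix (R : realType) (k l : nat) (x x' : 'rV[R]_k) : 'rV[R]_k :=
  \row_j (if (j < l)%N then x' 0 j else x 0 j).

Lemma mix0 (R : realType) (k : nat) (x x' : 'rV[R]_k) : mix 0 x x' = x.
Proof. by apply/rowP => j; rewrite mxE. Qed.

Lemma mix_full (R : realType) (k : nat) (x x' : 'rV[R]_k) : mix k x x' = x'.
Proof. by apply/rowP => j; rewrite mxE ltn_ord. Qed.

Lemma mixS (R : realType) (k : nat) (l : 'I_k) (x x' : 'rV[R]_k) :
  mix l.+1 x x' = mix l x x' + (x' 0 l - x 0 l) *: basis_vec l.
Proof.
apply/rowP => j; rewrite addZbasisE !mxE ltnS leq_eqVlt.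
have [->|jl] := eqVneq j l; first by rewrite eqxx ltnn mulr1; ring.
by rewrite (_ : _ == _ = false) ?mulr0 ?addr0//; apply/negbTE.
Qed.

(** * Moduli of continuity on inner half-spaces *)

Section uniform_continuity.
Context {R : realType} {n : nat}.
Implicit Types (z p : 'rV[R]_n.+1 -> R -> R) (x : 'rV[R]_n.+1).

Definition unif_dir z : Prop := forall r e : R, 0 < r -> 0 < e ->
  exists2 d : R, 0 < d & forall j x (t y : R), r < x 0 ord0 -> 0 <= y < d ->
    `|z (x + y *: basis_vec j) t - z x t| <= e.

Definition unif_time z : Prop := forall r e : R, 0 < r -> 0 < e ->
  exists2 d : R, 0 < d & forall x (t s : R), r < x 0 ord0 -> `|s - t| < d ->
    `|z x s - z x t| <= e.

(** Uniform in t and in the tangential variables, but only on each {x_1 > r}: precisely what limits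
    of tangential and time translates inherit. *)
Definition unif_cont z : Prop := forall r e : R, 0 < r -> 0 < e ->
  exists2 d : R, 0 < d & forall x x' (t s : R), r < x 0 ord0 -> r < x' 0 ord0 ->
    (forall j, `|x' 0 j - x 0 j| < d) -> `|s - t| < d -> `|z x' s - z x t| <= e.

Definition unif_bound z : Prop := forall r : R, 0 < r ->
  exists2 C : R, 0 <= C & forall x (t : R), r < x 0 ord0 -> `|z x t| <= C.

Lemma unif_dir_time z : unif_dir z -> unif_time z -> unif_cont z.
Proof.
(* The n + 1 coordinate steps and one step in time share [e]. *)
move=> Hd Ht r e r0 e0; have e1 : 0 < e / n.+2%:R by rewrite divr_gt0.
have [d d0 {}Hd] := Hd r _ r0 e1; have [d' d'0 {}Ht] := Ht r _ r0 e1.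
exists (Num.min d d'); first by rewrite lt_min d0.
move=> x x' t s xr x'r Hx; rewrite lt_min => /andP[_ /(Ht _ _ _ x'r) Hs].
have mixr l : r < mix l x x' 0 ord0 by rewrite mxE; case: ifP.
have step l : (l <= n.+1)%N -> `|z (mix l x x') t - z x t| <= l%:R * (e / n.+2%:R).
  elim: l => [|l IH] ln; first by rewrite mix0 subrr normr0 mul0r.
  have := IH (ltnW ln); rewrite -[l.+1%:R]natr1 mulrDl mul1r => {}IH.
  rewrite -(subrK (z (mix l x x') t) (z (mix l.+1 x x') t)) -addrA addrC.
  apply: le_trans (ler_normD _ _) _; apply: lerD => //.
  pose l' := Ordinal ln; have E := mixS l' x x'; rewrite /= in E.
  have := Hx l'; rewrite lt_min => /andP[hl _].
  have [h|h] := leP (x 0 l') (x' 0 l').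
    by rewrite E; apply: Hd => //; move: hl; rewrite ger0_norm ?subr_ge0// h.
  have -> : mix l x x' = mix l.+1 x x' + (x 0 l' - x' 0 l') *: basis_vec l'.
    by rewrite E -addrA -scalerDl -(opprB (x' 0 l') (x 0 l')) subrr scale0r addr0.
  rewrite distrC; apply: Hd => //; move: hl; rewrite ltr0_norm ?subr_lt0// => hl.
  by lra.
have := step n.+1 (leqnn _); rewrite mix_full => st.
rewrite -(subrK (z x' t) (z x' s)) -addrA.
apply: le_trans (ler_normD _ _) _.
have -> : e = e / n.+2%:R + n.+1%:R * (e / n.+2%:R).
  by rewrite -[X in _ = X + _]mul1r -mulrDl nat1r mulrC divfK// pnatr_eq0.
exact: lerD.
Qed.

Lemma MVT_dir z p x t j (y : R) :
  (forall x t, 0 < x 0 ord0 -> has_d1 (fun s => z (x + s *: basis_vec j) t) (p x t)) ->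
  0 < x 0 ord0 -> 0 < y ->
  exists2 c, 0 < c < y & z (x + y *: basis_vec j) t - z x t = p (x + c *: basis_vec j) t * y.
Proof.
move=> H x0 y0.
have [|c cy] := @MVT_d1 R (fun s => z (x + s *: basis_vec j) t)
  (fun s => p (x + s *: basis_vec j) t) 0 y y0; last first.
  by rewrite scale0r addr0 subr0; exists c.
move=> s /andP[s0 _]; apply: has_d1_ext (H (x + s *: basis_vec j) t _).
  by move=> h; rewrite scalerDl addrA.
by rewrite addZbasisE; case: (ord0 == j); rewrite ?mulr1 ?mulr0; lra.
Qed.

(** Interpolation: p is within e / 4 of a difference quotient of z with a fixed step s, and the time
    increment of that quotient is small once those of z are at most (e / 4) s. No time derivative of
    p is involved. *)
Lemma unif_time_d1 z p j :
  (forall x t, 0 < x 0 ord0 -> has_d1 (fun s => z (x + s *: basis_vec j) t) (p x t)) ->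
  unif_time z -> unif_dir p -> unif_time p.
Proof.
move=> H Hz Hp r e r0 e0; have e40 : 0 < e / 4 by lra.
have [d d0 {}Hp] := Hp r _ r0 e40.
pose s := d / 2; have s0 : 0 < s by rewrite /s; lra.
have [d' d'0 {}Hz] := Hz r (e / 4 * s) r0 (mulr_gt0 e40 s0).
exists d' => // x t t' xr tt'.
have x0 : 0 < x 0 ord0 by lra.
have [c /andP[c0 cs] Ec] := MVT_dir t H x0 s0.
have [c' /andP[c'0 c's] Ec'] := MVT_dir t' H x0 s0.
have p1 := Hp j x t c xr ltac:(rewrite /s in cs; lra).
have p2 := Hp j x t' c' xr ltac:(rewrite /s in c's; lra).
have xr' : r < (x + s *: basis_vec j) 0 ord0.
  by rewrite addZbasisE; case: (ord0 == j); rewrite ?mulr1 ?mulr0; lra.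
have z1 := Hz x t t' xr tt'; have z2 := Hz _ t t' xr' tt'.
have : `|p (x + c' *: basis_vec j) t' - p (x + c *: basis_vec j) t| <= e / 2.
  rewrite -(ler_pM2r s0) -{1}(gtr0_norm s0) -normrM mulrBl -Ec -Ec'.
  by move: z1 z2; rewrite !ler_norml; lra.
by move: p1 p2; rewrite !ler_norml; lra.
Qed.

Lemma unif_dir_d1 z (p : 'I_n.+1 -> 'rV[R]_n.+1 -> R -> R) :
  (forall j x t, 0 < x 0 ord0 -> has_d1 (fun s => z (x + s *: basis_vec j) t) (p j x t)) ->
  (forall j, unif_bound (p j)) -> unif_dir z.
Proof.
move=> H Hp r e r0 e0.
have [C C0 HC] : exists2 C : R, 0 < C & forall j x t, r < x 0 ord0 -> `|p j x t| <= C.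
  have /fin_all_exists2 [C C0 HC] j := Hp j r r0.
  exists (1 + \sum_j C j); first by rewrite ltr_pwDl// sumr_ge0.
  move=> j x t /(HC j _ t)/le_trans; apply; rewrite (bigD1 j)//= addrCA lerDl.
  by rewrite addr_ge0// sumr_ge0.
exists (e / C); first by rewrite divr_gt0.
move=> j x t y xr /andP[]; rewrite le_eqVlt => /predU1P[<-|y0 yd].
  by rewrite scale0r addr0 subrr normr0 ltW.
have [c /andP[c0 cy] ->] := MVT_dir t (H j) (lt_trans r0 xr) y0.
rewrite normrM (gtr0_norm y0); apply: (@le_trans _ _ (C * y)).
  rewrite ler_wpM2r ?(ltW y0)// HC// addZbasisE.
  by case: (ord0 == j); rewrite ?mulr1 ?mulr0; lra.
by rewrite mulrC -ler_pdivlMr// ltW.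
Qed.

Lemma unif_cont_time z : unif_cont z -> unif_time z.
Proof.
move=> H r e r0 e0; have [d d0 Hd] := H r e r0 e0; exists d => // x t s xr st.
by apply: Hd => // j; rewrite subrr normr0.
Qed.

Lemma unif_contD z p : unif_cont z -> unif_cont p -> unif_cont (fun x t => z x t + p x t).
Proof.
move=> Hz Hp r e r0 e0; have e20 : 0 < e / 2 by lra.
have [d d0 {}Hz] := Hz r _ r0 e20; have [d' d'0 {}Hp] := Hp r _ r0 e20.
exists (Num.min d d'); first by rewrite lt_min d0.
move=> x x' t s xr x'r Hx; rewrite lt_min => /andP[s1 s2].
have := Hz x x' t s xr x'r (fun j => lt_le_trans (Hx j) _) s1.
have := Hp x x' t s xr x'r (fun j => lt_le_trans (Hx j) _) s2.
rewrite !ge_min !lexx orbT => /(_ isT) + /(_ isT).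
by rewrite !ler_norml; lra.
Qed.

Lemma unif_cont_sum (I : Type) (r : seq I) (z : I -> 'rV[R]_n.+1 -> R -> R) :
  (forall k, unif_cont (z k)) -> unif_cont (fun x t => \sum_(k <- r) z k x t).
Proof.
move=> Hz; elim: r => [|k r IH].
  rewrite (_ : (fun x t => _) = fun _ _ => 0); last by do 2 apply/funext => ?; rewrite big_nil.
  by move=> r e r0 e0; exists 1 => // *; rewrite subrr normr0 ltW.
rewrite (_ : (fun x t => _) = fun x t => z k x t + \sum_(j <- r) z j x t).
  exact: unif_contD.
by do 2 apply/funext => ?; rewrite big_cons.
Qed.

End uniform_continuity.

(** * Functions of class C^1 on the orthant *)

Lemma fin_min (R : realType) (k : nat) (d : 'I_k -> R) :
  (forall j, 0 < d j) -> exists2 e : R, 0 < e & forall j, e <= d j.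
Proof.
move=> d0; have s0 : 0 <= \sum_j (d j)^-1 by apply: sumr_ge0 => j _; rewrite invr_ge0 ltW.
exists (1 + \sum_j (d j)^-1)^-1; first by rewrite invr_gt0; lra.
move=> j; rewrite -[leRHS]invrK lef_pV2 ?posrE ?invr_gt0//; last by lra.
rewrite (bigD1 j)//= addrCA lerDl addr_ge0// sumr_ge0// => i _.
by rewrite invr_ge0 ltW.
Qed.

Lemma within_comp1 (R : realType) (T U : topologicalType) (K : set T) (D : set U)
    (f : U -> R) (X : T -> U) :
  {within D, continuous f} -> (forall p, K p -> D (X p)) -> continuous X ->
  {within K, continuous (fun p => f (X p))}.
Proof.
move=> /subspace_continuousP fc KD Xc; apply/subspace_continuousP => p Kp.
apply: (@cvg_comp _ _ _ X f _ _ _ _ (fc (X p) (KD p Kp))) => A /= HA.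
have h := Xc p _ HA; apply: (@filterS _ (nbhs p) _ _ _ _ h) => q /= Aq Kq.
by apply: Aq; exact: KD.
Qed.

Section orthant_calculus.
Context {R : realType} {m : nat}.
Variable f : 'rV[R]_m -> R.
Hypothesis fC1 : C1_on orthant f.

Local Notation D := (partial_on orthant f).

(** Positive increments stay in the orthant even from a point on a face, so the limit defining
    [partial_on] is unique there too. *)
Lemma increments_proper j (a : 'rV[R]_m) : orthant a -> ProperFilter (increments orthant j a).
Proof.
move=> oa; apply: Build_ProperFilter_ex.
move=> P HP; have {HP}/nbhs_normP[d /= d0 Hd] :
  \forall h \near (0 : R), h != 0 -> orthant (a + h *: basis_vec j) -> P h by exact: HP.
exists (d / 2); apply: Hd.
- by rewrite /ball_ /= sub0r normrN gtr0_norm; lra.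
- by apply/eqP; lra.
- move=> i; rewrite addZbasisE; have := oa i.
  by case: (i == j); rewrite ?mulr1 ?mulr0; lra.
Qed.

Lemma orthant_d1 j (a : 'rV[R]_m) : orthant a -> 0 < a 0 j ->
  has_d1 (fun s => f (a + s *: basis_vec j)) (D j a).
Proof.
move=> oa aj e e0; have [_ /(_ j)[/(_ a oa) + _]] := fC1.
rewrite cvg_ex => -[l fl]; have : D j a = l.
  have FF := increments_proper j oa; exact: cvg_lim fl.
have FF := increments_proper j oa; move=> ->; move/cvgrPdist_le: fl => /(_ e e0).
rewrite !near_withinE => /nbhs_normP[d /= d0 Hd].
exists (Num.min d (a 0 j)); first by rewrite lt_min d0.
move=> s; rewrite lt_min => /andP[sd sa].
have [->|s0] := eqVneq s 0.
  by rewrite scale0r addr0 !subrr mulr0 subr0 normr0 mulr0.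
have := Hd s; rewrite /ball_ /= sub0r normrN => /(_ sd s0) {}Hd.
have {}Hd : `|l - diff_quot f j a s| <= e.
  apply: Hd => i; rewrite addZbasisE; have := oa i.
  have [->|_] := eqVneq i j; last by rewrite mulr0 addr0.
  by rewrite mulr1 => _; move: sa; rewrite ltr_norml; lra.
rewrite scale0r addr0 (_ : _ - _ - _ = - s * (l - diff_quot f j a s)).
  by rewrite normrM normrN mulrC ler_wpM2r.
by rewrite /diff_quot; field.
Qed.

(** Differentiability is used only inside the segment, where the j-th coordinate is positive; at an
    end point on a face continuity suffices. *)
Lemma orthant_step_pos j (a : 'rV[R]_m) (v : R) : orthant a -> 0 < v ->
  exists2 s, 0 <= s <= v &
    f (a + v *: basis_vec j) - f a = D j (a + s *: basis_vec j) * v.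
Proof.
move=> oa v0.
have os (s : R) : 0 <= s -> orthant (a + s *: basis_vec j).
  move=> s0 i; rewrite addZbasisE; have := oa i.
  by case: (i == j); rewrite ?mulr1 ?mulr0; lra.
have [s||s /[!in_itv]/= /andP[s0 sv]] := @MVT R (fun s => f (a + s *: basis_vec j))
  (fun s => D j (a + s *: basis_vec j)) 0 v v0.
- rewrite in_itv/= => /andP[s0 sv]; apply/has_d1_R.
  apply: has_d1_ext (orthant_d1 (os s (ltW s0)) _).
    by move=> h; rewrite scalerDl addrA.
  by rewrite addZbasisE eqxx mulr1; have := oa j; lra.
- have [fc _] := fC1; apply: (within_comp1 fc).
    by move=> p /=; rewrite in_itv/= => /andP[p0 _]; exact: os.
  by apply: addZ_continuous; [move=> p; exact: cvg_cst|exact: contid].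
- rewrite scale0r addr0 subr0 => E; exists s => //; lra.
Qed.

Lemma orthant_step j (a b : 'rV[R]_m) (v : R) : orthant a -> orthant b ->
  b = a + v *: basis_vec j ->
  exists2 xi : 'rV[R]_m, (forall l, Num.min (a 0 l) (b 0 l) <= xi 0 l <= Num.max (a 0 l) (b 0 l)) &
    f b - f a = D j xi * v.
Proof.
move=> oa ob E; have [v0|v0|v0] := ltgtP 0 v.
- have [s sv Es] := orthant_step_pos j oa v0; exists (a + s *: basis_vec j); last by rewrite E.
  move=> l; rewrite E !addZbasisE ge_min le_max.
  by case: (l == j); rewrite ?mulr1 ?mulr0; apply/andP; split; apply/orP; [left|right|left|right]; lra.
- have E' : a = b + (- v) *: basis_vec j by rewrite E scaleNr addrK.
  have v0' : 0 < - v by lra.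
  have [s sv Es] := orthant_step_pos j ob v0'; exists (b + s *: basis_vec j).
    move=> l; rewrite E' !addZbasisE ge_min le_max.
    by case: (l == j); rewrite ?mulr1 ?mulr0; apply/andP; split; apply/orP; [right|left|right|left]; lra.
  by move: Es; rewrite -E' mulrN; lra.
- exists a; first by move=> l; rewrite ge_min le_max lexx.
  by rewrite E -v0 scale0r addr0 subrr mulr0.
Qed.

(** Going from a to b one coordinate at a time reduces the claim to one-variable mean values. The
    points [xi j] may differ from each other, but each lies in the box spanned by a and b. *)
Lemma orthant_mean_value (a b : 'rV[R]_m) : orthant a -> orthant b ->
  exists xi : 'I_m -> 'rV[R]_m,
    (forall j l, Num.min (a 0 l) (b 0 l) <= xi j 0 l <= Num.max (a 0 l) (b 0 l)) /\
    f b - f a = \sum_j D j (xi j) * (b 0 j - a 0 j).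
Proof.
move=> oa ob; have om l : orthant (mix l a b) by move=> j; rewrite mxE; case: ifP.
have /fin_all_exists2[xi Hxi Exi] (j : 'I_m) := orthant_step (om j) (om j.+1) (mixS j a b).
exists xi; split.
  move=> j l; have := Hxi j l; rewrite !mxE !ge_min !le_max.
  by do 2 case: ifP => _; case: (a 0 l <= _); case: (b 0 l <= _);
    case: (_ <= a 0 l); case: (_ <= b 0 l).
have := telescope_sumr (fun l => f (mix l a b)) (leq0n m); rewrite mix_full mix0 => <-.
by rewrite big_mkord; apply: eq_bigr => j _; rewrite Exi.
Qed.

Lemma partial_bounded (M : R) : 0 <= M -> exists2 L : R, 0 <= L &
  forall j (x : 'rV[R]_m), (forall l, 0 <= x 0 l <= M) -> `|D j x| <= L.
Proof.
move=> M0; suff /fin_all_exists2[L L0 HL] (j : 'I_m) : exists2 L : R, 0 <= L &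
    forall (x : 'rV[R]_m), (forall l, 0 <= x 0 l <= M) -> `|D j x| <= L.
  exists (\sum_j L j); first by rewrite sumr_ge0.
  move=> j x /HL/le_trans; apply.
  by rewrite (bigD1 j)//= lerDl sumr_ge0.
have [_ /(_ j)[_ cD]] := fC1.
have B0 : box (fun=> 0) (fun=> M) (0 : 'rV[R]_m) by move=> l; rewrite mxE lexx.
have [|c Bc Hc] := EVT_min (f := fun x => - `|D j x|) (ex_intro _ _ B0)
  (@box_compact _ _ (fun=> 0) (fun=> M)).
  have c1 : {within box (fun=> 0) (fun=> M), continuous (D j)}.
    by apply: (continuous_subspaceW _ cD) => x Bx l; have /andP[] := Bx l.
  by move=> x; apply: cvgN; apply: cvg_norm; exact: c1.
exists `|D j c| => // x Bx.
by have := Hc x Bx; rewrite lerN2.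
Qed.

Lemma partial_near0 (e : R) : 0 < e -> exists2 d : R, 0 < d &
  forall j (x : 'rV[R]_m), (forall l, 0 <= x 0 l < d) -> `|D j x - D j 0| <= e.
Proof.
move=> e0; suff /fin_all_exists2[d d0 Hd] (j : 'I_m) : exists2 d : R, 0 < d &
    forall (x : 'rV[R]_m), (forall l, 0 <= x 0 l < d) -> `|D j x - D j 0| <= e.
  have [d' d'0 Hd'] := fin_min d0; exists d' => // j x Hx; apply: Hd => l.
  by have /andP[-> /lt_le_trans] := Hx l; apply.
have [_ /(_ j)[_ /subspace_continuousP/(_ 0)]] := fC1.
have o0 : orthant (0 : 'rV[R]_m) by move=> l; rewrite mxE.
move=> /(_ o0)/cvgrPdist_le/(_ e e0); rewrite near_withinE => /nbhs_ballP[d /= d0 Hd].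
exists d => // x Hx; rewrite distrC; apply: Hd; last by move=> l; have /andP[] := Hx l.
split => // i l; rewrite mxE /ball/= sub0r normrN ord1.
by have /andP[x0 xd] := Hx l; rewrite ger0_norm.
Qed.

Lemma orthant_lip (M : R) : 0 <= M -> exists2 L : R, 0 <= L &
  forall (a b : 'rV[R]_m), (forall l, 0 <= a 0 l <= M) -> (forall l, 0 <= b 0 l <= M) ->
    `|f b - f a| <= L * \sum_j `|b 0 j - a 0 j|.
Proof.
move=> M0; have [L L0 HL] := partial_bounded M0; exists L => // a b Ha Hb.
have oa : orthant a by move=> l; have /andP[] := Ha l.
have ob : orthant b by move=> l; have /andP[] := Hb l.
have [xi [Hxi ->]] := orthant_mean_value oa ob.
rewrite mulr_sumr; apply: (le_trans (ler_norm_sum _ _ _)); apply: ler_sum => j _.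
rewrite normrM ler_wpM2r// HL// => l; have /andP[h1 h2] := Hxi j l.
have /andP[a0 aM] := Ha l; have /andP[b0 bM] := Hb l; apply/andP; split.
  by apply: le_trans h1; rewrite le_min a0.
by apply: le_trans h2 _; rewrite ge_max aM.
Qed.

End orthant_calculus.

(** * Regularity of bounded solutions *)

Lemma zyg_interior (R : realType) (n : nat) (r M K : R) :
  0 < r -> 0 <= M -> 0 <= K -> exists2 C : R, 0 <= C &
  forall a z, @heat_bounded R n a M K z ->
  forall i j (x : 'rV[R]_n.+1) t y1 y2, a + 4 * r < x 0 ord0 ->
    0 <= y1 <= r -> 0 <= y2 <= r ->
    `|dlt i y1 (dlt j y2 z) x t| <= C * corner y1 y2.
Proof.
move=> r0 M0 K0; have [C C0 H] := @zyg_interior_le R n r M K r0 M0 K0.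
exists C => // a z Hz i j x t y1 y2 xa y1r y2r; rewrite ler_norml (H a z Hz)// andbT.
have := H a _ (heat_boundedN Hz) i j x t y1 y2 xa y1r y2r; rewrite /dlt; lra.
Qed.

Lemma fin_bound (R : realType) (k : nat) (P : 'I_k -> R -> Prop) :
  (forall j C C', C <= C' -> P j C -> P j C') ->
  (forall j, exists2 C : R, 0 <= C & P j C) -> exists2 C : R, 0 <= C & forall j, P j C.
Proof.
move=> mono /fin_all_exists2[C C0 HC]; exists (\sum_j C j); first by rewrite sumr_ge0.
by move=> j; apply: mono (HC j); rewrite (bigD1 j)//= lerDl sumr_ge0.
Qed.

Lemma has_d1_dlt (R : realType) (k : nat) (j i : 'I_k) (y : R) (z p : 'rV[R]_k -> R -> R) x t :
  has_d1 (fun s => z (x + y *: basis_vec j + s *: basis_vec i) t) (p (x + y *: basis_vec j) t) ->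
  has_d1 (fun s => z (x - y *: basis_vec j + s *: basis_vec i) t) (p (x - y *: basis_vec j) t) ->
  has_d1 (fun s => dlt j y z (x + s *: basis_vec i) t) (dlt j y p x t).
Proof.
move=> h1 h2; apply: has_d1_ext (has_d1B h1 h2) => s.
by rewrite /dlt (addrAC x _ (s *: _)) (addrAC x (- _) (s *: _)).
Qed.

Lemma ge_halfspace (R : realType) (n : nat) (x : 'rV[R]_n.+1) (j : 'I_n.+1) (a y : R) :
  0 <= y -> a < x 0 ord0 -> a < (x + y *: basis_vec j) 0 ord0.
Proof.
by rewrite addZbasisE; case: (ord0 == j); rewrite ?mulr1 ?mulr0; lra.
Qed.

Section regularity.
Context {R : realType} {n m : nat}.
Variables (f : 'I_m -> 'rV[R]_m -> R) (u : 'I_m -> 'rV[R]_n.+1 -> R -> R) (M : R).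
Hypothesis fC1 : forall i, C1_on orthant (f i).
Hypothesis f0 : forall i, f i 0 = 0.
Hypothesis usol : solution f u.
Hypothesis unn : nonnegative u.
Hypothesis M0 : 0 <= M.
Hypothesis uM : forall i x t, closed_half_space x -> `|u i x t| <= M.

Lemma state_range x t l : closed_half_space x -> 0 <= state u x t 0 l <= M.
Proof.
by move=> Hx; rewrite mxE unn//= (le_trans (ler_norm _))// uM.
Qed.

Lemma sol_C21 i : C21_on half_space (u i).
Proof. by have [] := usol i. Qed.

Lemma sol_heat i x t : half_space x -> heat_at (u i) x t (f i (state u x t)).
Proof.
move=> Hx; have [Hu _ H _] := usol i; rewrite -(H _ _ Hx).
exact: C21_heat.
Qed.

Lemma src_lip : exists2 L : R, 0 <= L & forall i x x' t t',
  closed_half_space x -> closed_half_space x' ->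
  `|f i (state u x' t') - f i (state u x t)| <= L * \sum_j `|u j x' t' - u j x t|.
Proof.
have [||L L0 HL] := @fin_bound R m (fun i L => forall x x' t t',
  closed_half_space x -> closed_half_space x' ->
  `|f i (state u x' t') - f i (state u x t)| <= L * \sum_j `|u j x' t' - u j x t|).
- move=> i C C' CC' H x x' t t' Hx Hx'; apply: le_trans (H _ _ _ _ Hx Hx') _.
  by rewrite ler_wpM2r// sumr_ge0.
- move=> i; have [L L0 HL] := orthant_lip (fC1 i) M0; exists L => // x x' t t' Hx Hx'.
  have := HL (state u x t) (state u x' t').
  rewrite (eq_bigr (fun j => `|u j x' t' - u j x t|)); last by move=> j _; rewrite !mxE.
  by apply => l; exact: state_range.
by exists L => // i x x' t t'; exact: HL.
Qed.

Lemma src_bound : exists2 K : R, 0 <= K & forall i x t,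
  closed_half_space x -> `|f i (state u x t)| <= K.
Proof.
have [||K K0 HK] := @fin_bound R m (fun i K => forall x t,
  closed_half_space x -> `|f i (state u x t)| <= K).
- by move=> i C C' CC' H x t Hx; apply: le_trans (H _ _ Hx) _.
- move=> i; have [L L0 HL] := orthant_lip (fC1 i) M0.
  exists (L * \sum_(j < m) M); first by rewrite mulr_ge0// sumr_ge0.
  move=> x t Hx; have := HL 0 (state u x t); rewrite f0 subr0.
  move=> H; apply: le_trans (H _ _) _.
  + by move=> l; rewrite mxE lexx.
  + by move=> l; exact: state_range.
  + rewrite ler_wpM2l// ler_sum// => j _; rewrite !mxE subr0.
    exact: uM.
by exists K => // i x t; exact: HK.
Qed.

Lemma sol_heat_bounded : exists2 K : R, 0 <= K & forall i, heat_bounded 0 M K (u i).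
Proof.
have [K K0 HK] := src_bound; exists K => // i; split; first by have [] := sol_C21 i.
move=> x t x0; split; first by apply: uM; left.
by exists (f i (state u x t)); [apply: HK; left|exact: sol_heat].
Qed.

Lemma sol_lip r : 0 < r -> exists2 C : R, 0 <= C & forall i j (x : 'rV[R]_n.+1) t y,
  r < x 0 ord0 -> 0 <= y -> `|u i (x + y *: basis_vec j) t - u i x t| <= C * y.
Proof.
move=> r0; have [K K0 HK] := sol_heat_bounded.
have [C C0 HC] := @lip_shift R n r M K r0 M0 K0; exists C => // i j x t y xr y0.
by apply: (HC 0 _ (HK i)) => //; rewrite add0r.
Qed.

(** The source of a difference quotient is a difference quotient of f(u), bounded uniformly in h
    because f is Lipschitz on the range of u and u is Lipschitz by [sol_lip]. The interior estimates
    can thus be applied a second time. *)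
Lemma quot_heat_bounded r : 0 < r -> exists2 C : R, 0 <= C & forall i k h, 0 < h ->
  heat_bounded r C C (fun x t => h^-1 * (u i (x + h *: basis_vec k) t - u i x t)).
Proof.
move=> r0; have [C C0 HC] := sol_lip r0; have [L L0 HL] := src_lip.
have Cm : 0 <= C * (m%:R) by rewrite mulr_ge0.
exists (C + L * (C * m%:R)); first by rewrite addr_ge0// mulr_ge0.
move=> i k h h0; split.
  have [cu _ _ _] := sol_C21 i.
  apply: withinZ; apply: withinB; apply: (within_comp cu).
  - move=> [x t] [/= xr _]; apply: ge_halfspace; [exact: ltW|].
    exact: lt_trans r0 xr.
  - apply: addZ_continuous; first exact: contfst.
    exact: contcst.
  - exact: contsnd.
  - by move=> [x t] [/= xr _]; exact: lt_trans r0 xr.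
  - exact: contfst.
  - exact: contsnd.
move=> x t xr; have x0 := lt_trans r0 xr; have h0' := ltW h0.
have xh := ge_halfspace k h0' x0.
have bd A B : 0 <= B -> `|A| <= B * h -> `|h^-1 * A| <= B.
  by move=> B0 H; rewrite normrM normfV (gtr0_norm h0) mulrC ler_pdivrMr.
split; first by apply: bd; [rewrite addr_ge0// mulr_ge0|
  apply: le_trans (HC i k x t h xr h0') _; rewrite ler_wpM2r// lerDl mulr_ge0].
exists (h^-1 * (f i (state u (x + h *: basis_vec k) t) - f i (state u x t))); last first.
  apply: heat_atZ; apply: heat_atB; last exact: sol_heat.
  by apply: heat_at_shiftx; exact: sol_heat.
apply: bd; first by rewrite addr_ge0// mulr_ge0.
apply: le_trans (HL i x (x + h *: basis_vec k) t t _ _) _; [by left|by left|].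
apply: (@le_trans _ _ (L * (C * m%:R) * h)); last by rewrite ler_wpM2r// lerDr.
rewrite -mulrA ler_wpM2l//; apply: (@le_trans _ _ (\sum_(j < m) C * h)).
  by apply: ler_sum => j _; exact: HC.
by rewrite sumr_const card_ord -[_ *+ _]mulr_natr mulrAC.
Qed.

Lemma sol_d1x i k (x : 'rV[R]_n.+1) t : 0 < x 0 ord0 ->
  has_d1 (fun s => u i (x + s *: basis_vec k) t) (dx k (u i) x t).
Proof. exact: C21_d1x (sol_C21 i). Qed.

Lemma sol_d1xx i k l (x : 'rV[R]_n.+1) t : 0 < x 0 ord0 ->
  has_d1 (fun s => dx k (u i) (x + s *: basis_vec l) t) (dx l (dx k (u i)) x t).
Proof. exact: C21_d1xx (sol_C21 i). Qed.

Lemma sol_d1t i (x : 'rV[R]_n.+1) t : 0 < x 0 ord0 ->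
  has_d1 (fun s => u i x (t + s)) (dt (u i) x t).
Proof. exact: C21_d1t (sol_C21 i). Qed.

Lemma grad_bound r : 0 < r -> exists2 C : R, 0 <= C & forall i k (x : 'rV[R]_n.+1) t,
  r < x 0 ord0 -> `|dx k (u i) x t| <= C.
Proof.
move=> r0; have [C C0 HC] := sol_lip r0; exists C => // i k x t xr.
apply: (has_d1_bound (sol_d1x i k t (lt_trans r0 xr))); exists 1 => // h /andP[h0 _].
by rewrite scale0r addr0 HC// ltW.
Qed.

Lemma grad_lip r : 0 < r -> exists2 C : R, 0 <= C & forall i k j (x : 'rV[R]_n.+1) t y,
  r < x 0 ord0 -> 0 <= y ->
  `|dx k (u i) (x + y *: basis_vec j) t - dx k (u i) x t| <= C * y.
Proof.
move=> r0; have r20 : 0 < r / 2 by lra.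
have [K K0 HK] := quot_heat_bounded r20.
have [C C0 HC] := @lip_shift R n (r / 2) K K r20 K0 K0.
exists C => // i k j x t y xr y0; have x0 := lt_trans r0 xr.
have xy := ge_halfspace j y0 x0.
apply: (has_d1_bound (has_d1B (sol_d1x i k t xy) (sol_d1x i k t x0))).
exists 1 => // h /andP[h0 _]; rewrite !scale0r !addr0.
have := HC (r / 2) _ (HK i k h h0) j x t y; rewrite -splitr => /(_ xr y0).
rewrite -mulrBr normrM normfV (gtr0_norm h0) mulrC ler_pdivrMr//.
by rewrite (addrAC x _ (h *: _)) => H; apply: le_trans H; rewrite le_eqVlt; apply/orP; left;
  apply/eqP; congr `|_|; ring.
Qed.

Lemma hess_bound r : 0 < r -> exists2 C : R, 0 <= C & forall i k l (x : 'rV[R]_n.+1) t,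
  r < x 0 ord0 -> `|dx l (dx k (u i)) x t| <= C.
Proof.
move=> r0; have [C C0 HC] := grad_lip r0; exists C => // i k l x t xr.
apply: (has_d1_bound (sol_d1xx i k l t (lt_trans r0 xr))); exists 1 => // h /andP[h0 _].
by rewrite scale0r addr0 HC// ltW.
Qed.

(** [zyg_interior] with radius r / 8 for difference quotients above height r / 4, then h tends to 0;
    the margins fit since r / 4 + 4 (r / 8) < r. *)
Lemma grad_zyg r : 0 < r -> exists2 C : R, 0 <= C & forall i k l j (x : 'rV[R]_n.+1) t y1 y2,
  r < x 0 ord0 -> 0 <= y1 <= r / 8 -> 0 <= y2 <= r / 8 ->
  `|dlt l y1 (dlt j y2 (dx k (u i))) x t| <= C * corner y1 y2.
Proof.
move=> r0; have r20 : 0 < r / 4 by lra. have r80 : 0 < r / 8 by lra.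
have [K K0 HK] := quot_heat_bounded r20.
have [C C0 HC] := @zyg_interior R n (r / 8) K K r80 K0 K0.
exists C => // i k l j x t y1 y2 xr y1r y2r.
have pos s1 s2 : - (r / 8) <= s1 <= r / 8 -> - (r / 8) <= s2 <= r / 8 ->
    0 < (x + s1 *: basis_vec l + s2 *: basis_vec j) 0 ord0.
  move=> h1 h2; rewrite !addZbasisE.
  by case: (ord0 == l); case: (ord0 == j); rewrite ?mulr1 ?mulr0; lra.
have d1 : has_d1 (fun s => dlt l y1 (dlt j y2 (u i)) (x + s *: basis_vec k) t)
    (dlt l y1 (dlt j y2 (dx k (u i))) x t).
  by apply: has_d1_dlt; apply: has_d1_dlt; apply: sol_d1x; rewrite -?scaleNr; apply: pos; lra.
apply: (has_d1_bound d1); exists 1 => // h /andP[h0 _].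
have := HC _ _ (HK i k h h0) l j x t y1 y2 _ y1r y2r => /(_ ltac:(lra)).
rewrite (_ : dlt l y1 _ x t = h^-1 * (dlt l y1 (dlt j y2 (u i)) (x + h *: basis_vec k) t -
  dlt l y1 (dlt j y2 (u i)) (x + 0 *: basis_vec k) t)).
  by rewrite normrM normfV (gtr0_norm h0) mulrC ler_pdivrMr.
have sw v w : x + v + w + h *: basis_vec k = x + h *: basis_vec k + v + w.
  by rewrite (addrAC _ w) (addrAC _ v).
by rewrite scale0r addr0 /dlt !sw; ring.
Qed.

(** Dividing the mixed difference of the gradient with steps h and y / 2, centred at the midpoint,
    by h and letting h tend to 0 gives twice the increment of the Hessian over y, while
    [corner h (y / 2)] is at most h sqrt y. *)
Lemma hess_holder r : 0 < r -> exists2 C : R, 0 <= C & forall i k l j (x : 'rV[R]_n.+1) t y,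
  r < x 0 ord0 -> 0 < y <= r / 8 ->
  `|dx l (dx k (u i)) (x + y *: basis_vec j) t - dx l (dx k (u i)) x t| <= C * Num.sqrt y.
Proof.
move=> r0; have [C C0 HC] := grad_zyg r0; exists C => // i k l j x t y xr /andP[y0 yr].
pose c := x + (y / 2) *: basis_vec j.
have cx : c - (y / 2) *: basis_vec j = x by rewrite /c addrK.
have cy : c + (y / 2) *: basis_vec j = x + y *: basis_vec j.
  by rewrite /c -addrA -scalerDl -splitr.
have y20 : 0 <= y / 2 by lra.
have cr : r < c 0 ord0 by exact: ge_halfspace.
have xp := lt_trans r0 xr; have yp := ge_halfspace j (ltW y0) xp.
suff : `|2 * (dx l (dx k (u i)) (x + y *: basis_vec j) t - dx l (dx k (u i)) x t)| <=
    2 * (C * Num.sqrt y).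
  rewrite normrM ger0_norm// => H.
  by rewrite -(@ler_pM2l _ 2).
have d1 : has_d1 (fun s => dlt l s (dlt j (y / 2) (dx k (u i))) c t)
    (2 * (dx l (dx k (u i)) (x + y *: basis_vec j) t - dx l (dx k (u i)) x t)).
  have hp := has_d1B (sol_d1xx i k l t yp) (sol_d1xx i k l t xp).
  have hm := has_d1_oppl hp.
  have := has_d1B hp hm; rewrite opprK -mulr2n -[_ *+ 2]mulr_natl.
  apply: has_d1_ext => s.
  rewrite /dlt -cy -{1 2}cx !scaleNr (addrAC c (s *: _)) (addrAC c (- (s *: _))).
  by rewrite (addrAC c (s *: _)) (addrAC c (- (s *: _))) (addrAC c (y / 2 *: _)).
apply: (has_d1_bound d1); exists (r / 8); first by lra.
move=> h /andP[h0 hr]; rewrite dlt0 subr0.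
have := HC i k l j c t h (y / 2) cr ltac:(lra) ltac:(lra).
move/le_trans; apply; have S0 : 0 < Num.sqrt (h + y / 2) by rewrite sqrtr_gt0; lra.
have Sy : Num.sqrt (y / 2) <= Num.sqrt (h + y / 2) by rewrite ler_wsqrtr//; lra.
have Sy' : Num.sqrt (y / 2) <= Num.sqrt y by rewrite ler_wsqrtr//; lra.
have E := sqr_sqrtr y20; have s0 := sqrtr_ge0 (y / 2); have sy0 := sqrtr_ge0 y.
have {E s0 Sy Sy'} key : y / 2 <= Num.sqrt y * Num.sqrt (h + y / 2).
  by rewrite -{1}E expr2 ler_pM.
have : corner h (y / 2) <= h * Num.sqrt y.
  by rewrite /corner ler_pdivrMr// -mulrA ler_wpM2l// ltW.
move=> /(ler_wpM2l C0) H; have := mulr_ge0 (mulr_ge0 C0 sy0) (ltW h0).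
by move: H; rewrite mulrCA; lra.
Qed.

Lemma unif_bound_u i : unif_bound (u i).
Proof. by move=> r r0; exists M => // x t xr; apply: uM; left; exact: lt_trans r0 xr. Qed.

Lemma unif_bound_grad i k : unif_bound (dx k (u i)).
Proof.
by move=> r r0; have [C C0 HC] := grad_bound r0; exists C => // x t; exact: HC.
Qed.

Lemma unif_bound_hess i k l : unif_bound (dx l (dx k (u i))).
Proof.
by move=> r r0; have [C C0 HC] := hess_bound r0; exists C => // x t; exact: HC.
Qed.

Lemma dtE i x t : half_space x -> dt (u i) x t = laplacian (u i) x t + f i (state u x t).
Proof. by move=> Hx; have [_ _ /(_ x t Hx) <- _] := usol i; rewrite addrC subrK. Qed.

Lemma unif_bound_dt i : unif_bound (dt (u i)).
Proof.
move=> r r0; have [C C0 HC] := hess_bound r0; have [K K0 HK] := src_bound.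
exists (\sum_(j < n.+1) C + K); first by rewrite addr_ge0// sumr_ge0.
move=> x t xr; have x0 : half_space x := lt_trans r0 xr.
rewrite dtE//; apply: le_trans (ler_normD _ _) _; apply: lerD; last by apply: HK; left.
apply: le_trans (ler_norm_sum _ _ _) _; apply: ler_sum => j _; exact: HC.
Qed.

Lemma unif_cont_u i : unif_cont (u i).
Proof.
apply: unif_dir_time.
  by apply: (@unif_dir_d1 _ _ _ (fun k => dx k (u i))) => [k x t|k];
    [exact: sol_d1x|exact: unif_bound_grad].
move=> r e r0 e0; have [C C0 HC] := unif_bound_dt i r0.
have C10 : 0 < C + 1 by rewrite ltr_wpDl.
exists (e / (C + 1)); first by rewrite divr_gt0.
move=> x; suff main t s : r < x 0 ord0 -> t <= s -> `|s - t| < e / (C + 1) ->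
    `|u i x s - u i x t| <= e.
  move=> t s xr st; have [ts|ts] := leP t s; first exact: main.
  by rewrite distrC main ?ltW// distrC.
move=> xr; have x0 := lt_trans r0 xr.
rewrite le_eqVlt => /predU1P[->|ts]; first by rewrite !subrr normr0 ltW.
rewrite gtr0_norm ?subr_gt0// => st.
have [s' _|c _ ->] := @MVT_d1 R (u i x) (dt (u i) x) t s ts; first exact: sol_d1t.
rewrite normrM (gtr0_norm (_ : 0 < s - t)) ?subr_gt0//.
apply: (@le_trans _ _ ((C + 1) * (s - t))).
  rewrite ler_wpM2r ?subr_ge0 ?(ltW ts)// (le_trans (HC _ _ xr))//; lra.
by rewrite mulrC -ler_pdivlMr// ltW.
Qed.

Lemma unif_cont_grad i k : unif_cont (dx k (u i)).
Proof.
have ud : unif_dir (dx k (u i)).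
  by apply: (@unif_dir_d1 _ _ _ (fun l => dx l (dx k (u i)))) => [l x t|l];
    [exact: sol_d1xx|exact: unif_bound_hess].
apply: unif_dir_time => //; apply: (@unif_time_d1 _ _ (u i) _ k) => //.
  by move=> x t; exact: sol_d1x.
exact: unif_cont_time (unif_cont_u i).
Qed.

(** The space modulus is [hess_holder]; the time modulus is inherited from the gradient by
    [unif_time_d1], just as the gradient inherits its own from u. *)
Lemma unif_cont_hess i k l : unif_cont (dx l (dx k (u i))).
Proof.
have ud : unif_dir (dx l (dx k (u i))).
  move=> r e r0 e0; have [C C0 HC] := hess_holder r0.
  have C1 : 0 < C + 1 by rewrite ltr_wpDl.
  have q0 : 0 < (e / (C + 1)) ^+ 2 by rewrite exprn_gt0// divr_gt0.
  exists (Num.min (r / 8) ((e / (C + 1)) ^+ 2)); first by rewrite lt_min q0 andbT; lra.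
  move=> j x t y xr /andP[]; rewrite le_eqVlt => /predU1P[<- _|y0].
    by rewrite scale0r addr0 subrr normr0 ltW.
  rewrite lt_min => /andP[yr yq]; have yy : 0 < y <= r / 8 by rewrite y0 ltW.
  apply: le_trans (HC i k l j x t y xr yy) _.
  have : Num.sqrt y <= e / (C + 1).
    rewrite -[leRHS]ger0_norm; last by rewrite ltW// divr_gt0.
    by rewrite -sqrtr_sqr ler_wsqrtr// ltW.
  rewrite ler_pdivlMr// => h; have := sqrtr_ge0 y.
  by move: h; lra.
apply: unif_dir_time => //; apply: (@unif_time_d1 _ _ (dx k (u i)) _ l) => //.
  by move=> x t; exact: sol_d1xx.
exact: unif_cont_time (unif_cont_grad i k).
Qed.

Lemma unif_cont_src i : unif_cont (fun x t => f i (state u x t)).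
Proof.
move=> r e r0 e0; have [L L0 HL] := src_lip.
have p0 : 0 < L * m%:R + 1 by rewrite ltr_wpDl// mulr_ge0.
have [d d0 Hd] : exists2 d : R, 0 < d & forall j (x x' : 'rV[R]_n.+1) (t s : R),
    r < x 0 ord0 -> r < x' 0 ord0 -> (forall j, `|x' 0 j - x 0 j| < d) -> `|s - t| < d ->
    `|u j x' s - u j x t| <= e / (L * m%:R + 1).
  have q0 : 0 < e / (L * m%:R + 1) by rewrite divr_gt0.
  have /fin_all_exists2[d d0 Hd] j := unif_cont_u j r0 q0.
  have [d' d'0 Hd'] := fin_min d0; exists d' => // j x x' t s xr x'r Hx Hs.
  apply: Hd => // [l|]; first exact: lt_le_trans (Hx l) _.
  exact: lt_le_trans Hs _.
exists d => // x x' t s xr x'r Hx Hs.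
have [Hx0 Hx'0] : half_space x /\ half_space x' by split; exact: lt_trans r0 _.
apply: le_trans (HL i x x' t s _ _) _; [by left|by left|].
apply: (@le_trans _ _ (L * \sum_(j < m) e / (L * m%:R + 1))).
  by rewrite ler_wpM2l// ler_sum// => j _; exact: Hd.
rewrite sumr_const card_ord -[_ *+ _]mulr_natr.
rewrite (_ : L * _ = e * (L * m%:R / (L * m%:R + 1))); last by ring.
by rewrite ler_piMr ?(ltW e0)// ler_pdivrMr// mul1r lerDl.
Qed.

Lemma unif_cont_dt i : unif_cont (dt (u i)).
Proof.
have H : unif_cont (fun x t => laplacian (u i) x t + f i (state u x t)).
  apply: unif_contD; last exact: unif_cont_src.
  by apply: (@unif_cont_sum _ _ _ _ (fun k => dx k (dx k (u i)))) => k; exact: unif_cont_hess.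
move=> r e r0 e0; have [d d0 Hd] := H r e r0 e0; exists d => // x x' t s xr x'r Hx Hs.
by rewrite !dtE; [exact: Hd|exact: lt_trans r0 _|exact: lt_trans r0 _].
Qed.

End regularity.

(** An ultrafilter converges to each of its cluster points, and a compact interval provides one.
    With [U] fixed, all bounded sequences converge simultaneously, which replaces a diagonal
    extraction over points and derivatives. *)
Lemma ultra_cvg_bounded (R : realType) (U : set_system nat) (a : nat -> R) (C : R) :
  UltraFilter U -> (forall k, `|a k| <= C) -> cvg (a @ U).
Proof.
move=> UU aC; have PU : ProperFilter U by exact: ultra_proper.
have : compact [set y : R | - C <= y <= C] by exact: itv_compact.
move=> /(_ (a @ U) _)[|l [_ cl]].
  by apply: (@filterE _ U) => k /=; have := aC k; rewrite ler_norml.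
apply/cvg_ex; exists l => V Vl; have [//|h] := in_ultra_setVsetC (a @^-1` V) UU.
have [y []] := cl (~` V) V h Vl.
by [].
Qed.

(** * Linear bound at the boundary *)

Section boundary.
Context {R : realType} {n m : nat}.
Variables (f : 'I_m -> 'rV[R]_m -> R) (u : 'I_m -> 'rV[R]_n.+1 -> R -> R) (M : R).
Hypothesis fC1 : forall i, C1_on orthant (f i).
Hypothesis f0 : forall i, f i 0 = 0.
Hypothesis usol : solution f u.
Hypothesis unn : nonnegative u.
Hypothesis M0 : 0 <= M.
Hypothesis uM : forall i x t, closed_half_space x -> `|u i x t| <= M.

Lemma closedP (x : 'rV[R]_n.+1) : closed_half_space x <-> 0 <= x 0 ord0.
Proof.
split; first by move=> [/ltW//|/= ->].
by rewrite le_eqVlt => /predU1P[h|h]; [right; rewrite /half_space_boundary /= -h|left].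
Qed.

(** Barrier A x_1 (2 - x_1) plus a penalty of weight M on a box attached to the boundary, where u
    vanishes; its second derivative - 2 A beats source and penalty. The bound makes translates
    equicontinuous at the boundary and u small near it. *)
Lemma boundary_bound : exists2 C : R, 0 <= C & forall i x t, closed_half_space x ->
  u i x t <= C * x 0 ord0.
Proof.
have [K K0 HK] := src_bound fC1 f0 unn M0 uM.
have M1 : 0 <= M by exact: M0.
pose A := K + M * n.+2%:R + 1.
have MN : M <= M * n.+2%:R by rewrite ler_peMr// ler1n.
have A0 : 0 <= A by rewrite /A; lra.
have AM : M <= A by rewrite /A; lra.
exists (2 * A); first by rewrite mulr_ge0.
move=> i x t /closedP x0; have uMx (y : 'rV[R]_n.+1) s : 0 <= y 0 ord0 -> u i y s <= M.
  by move=> /closedP Hy; apply: le_trans (uM i s Hy); exact: ler_norm.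
have [x1|x1] := leP 1 (x 0 ord0).
  by apply: le_trans (uMx x t x0) _; nra.
pose lo k := if k == ord0 then 0 else x 0 k - 1.
pose hi k := if k == ord0 then 1 else x 0 k + 1.
pose T : topologicalType := ('rV[R]_n.+1 * R)%type.
pose D : set T := box lo hi `*` [set s : R | t - 1 <= s <= t].
pose F (p : T) := A * (p.1 0 ord0 * (2 - p.1 0 ord0)) + M * (sqn (p.1 - x) + (t - p.2))
  - u i p.1 p.2.
have cD : compact D by apply: compact_setX; [exact: box_compact|exact: itv_compact].
have cp1 : continuous (fun p : T => p.1) by exact: contfst.
have cp2 : continuous (fun p : T => p.2) by exact: contsnd.
have cx0 : continuous (fun p : T => p.1 0 ord0) by exact: contcoord.
have box0 (y : 'rV[R]_n.+1) : box lo hi y -> 0 <= y 0 ord0 <= 1.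
  by move=> /(_ ord0); rewrite /lo /hi eqxx.
have cF : {within D, continuous F}.
  apply: withinB.
    apply: continuous_subspaceT; apply: contD.
      apply: contM; first exact: contcst.
      by apply: contM => //; apply: contB => //; exact: contcst.
    apply: contM; first exact: contcst.
    apply: contD; last by apply: contB => //; exact: contcst.
    apply: (@contcomp _ _ _ (fun p : T => p.1 - x) (@sqn R n.+1)); last exact: sqn_continuous.
    move=> p; apply: (@cvgB R 'rV[R]_n.+1); [exact: cp1|exact: cvg_cst].
  have [_ cu _ _] := usol i; apply: (within_comp cu) => //.
  by move=> [y s] [/= /box0/andP[y0 _] _]; apply/closedP.
have D0 : D (x, t).
  split => /=; last by lra.
  move=> k; rewrite /lo /hi; case: eqP => [->|_]; last by lra.
  by rewrite x0 ltW.
have [[x' s] [/= h1 h3] Hmin] := EVT_min (ex_intro _ _ D0) cD cF.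
suff F0 : 0 <= F (x', s).
  have := le_trans F0 (Hmin _ D0); rewrite /F /= subrr sqn0 subrr addr0 mulr0 addr0 subr_ge0.
  move/le_trans; apply; rewrite (_ : 2 * A * _ = A * (x 0 ord0 * 2)); last by ring.
  by rewrite ler_wpM2l// ler_wpM2l//; lra.
rewrite leNgt; apply/negP => F0; rewrite /F /= in F0.
have Hm (x2 : 'rV[R]_n.+1) (s2 : R) : box lo hi x2 -> t - 1 <= s2 <= t ->
    A * (x' 0 ord0 * (2 - x' 0 ord0)) + M * (sqn (x' - x) + (t - s)) - u i x' s <=
    A * (x2 0 ord0 * (2 - x2 0 ord0)) + M * (sqn (x2 - x) + (t - s2)) - u i x2 s2.
  by move=> b2 s2t; apply: (Hmin (x2, s2)).
clear F cF D0 Hmin cD D cp1 cp2 cx0 T.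
have /andP[x'0 x'1] := box0 _ h1.
have q0 : 0 <= sqn (x' - x) + (t - s) by have := sqn_ge0 (x' - x); lra.
have Ay0 : 0 <= A * (x' 0 ord0 * (2 - x' 0 ord0)) by rewrite !mulr_ge0//; lra.
have Bq0 : 0 <= M * (sqn (x' - x) + (t - s)) by rewrite mulr_ge0.
have xlo : 0 < x' 0 ord0.
  rewrite lt_neqAle x'0 andbT; apply/eqP => E.
  have [_ _ _ ub] := usol i; have := ub x' s (esym E); move: F0 => /[swap] ->; lra.
have xhi : x' 0 ord0 < 1.
  rewrite lt_neqAle x'1 andbT; apply/eqP => E; have := uMx x' s x'0; move: F0.
  have : M <= A * (x' 0 ord0 * (2 - x' 0 ord0)) by rewrite E; lra.
  lra.
have qlt : sqn (x' - x) + (t - s) < 1.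
  rewrite ltNge; apply/negP => h; have := uMx x' s x'0; move: F0.
  have : M * 1 <= M * (sqn (x' - x) + (t - s)) by rewrite ler_wpM2l.
  lra.
have xin k : lo k < x' 0 k < hi k.
  have := @pcyl_interior R n 1 x x' ler01; rewrite expr1n => /(_ _ k); rewrite /lo /hi.
  by move=> H; have {}H := H ltac:(lra); case: eqP => [->|//]; rewrite xlo.
have slo : t - 1 < s by have := sqn_ge0 (x' - x); lra.
have Hh := sol_heat usol i s (xlo : half_space x').
have := @heat_max_test R n.+1 _ x' s _ (- M) 0 (fun k => 2 * M - (k == ord0)%:R * (2 * A)) Hh.
rewrite sum_delta => test; have {test} : - M - (2 * M * n.+1%:R - 2 * A) <= f i (state u x' s).
  apply: test.
    exists (s - (t - 1)); first by lra.
    move=> e /andP[e0 e1]; have H := Hm x' (s - e) h1 ltac:(lra).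
    by move: H; rewrite !mulrDr; lra.
  move=> k; have [d d0 Hd] := box_near h1 (xin k).
  exists d => // e /Hd[b1 b2].
  have := Hm _ _ b1 h3; have := Hm _ _ b2 h3.
  have := congr1 (fun v => M * v) (sqn_d2 x' x e k) => /=.
  rewrite -!(scaleNr e) !addZbasisE (eq_sym ord0 k).
  by case: (k == ord0); rewrite ?mulr1n ?mulr0n ?mulr1 ?mul1r ?mulr0 ?addr0 ?mul0r ?subr0;
    [nra|lra].
have := HK i x' s (or_introl xlo).
by rewrite /A -[n.+2]addn1 natrD ler_norml; lra.
Qed.

End boundary.

(** * Limits of translates *)

Lemma has_d1_near (R : realType) (g h : R -> R) (c : R) :
  (exists2 d : R, 0 < d & forall s : R, `|s| < d -> g s = h s) -> has_d1 g c -> has_d1 h c.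
Proof.
move=> [d d0 E] H e e0; have [d' d'0 Hd] := H e e0.
exists (Num.min d d'); first by rewrite lt_min d0.
move=> s; rewrite lt_min => /andP[sd sd']; rewrite -!E ?normr0//; exact: Hd.
Qed.

Lemma taylor1 (R : realType) (g g' : R -> R) (h e : R) :
  (forall s : R, `|s| <= `|h| -> has_d1 (fun y => g (s + y)) (g' s)) ->
  (forall s : R, `|s| <= `|h| -> `|g' s - g' 0| <= e) ->
  `|g h - g 0 - g' 0 * h| <= e * `|h|.
Proof.
move=> H He; have [h0|h0|<-] := ltgtP 0 h.
- have [|c /andP[c0 ch] E] := @MVT_d1 R g g' 0 h h0.
    by move=> s /andP[s0 sh]; apply: H; rewrite !ger0_norm// ltW.
  rewrite E subr0 -mulrBl normrM ler_wpM2r// He// !ger0_norm ?ltW//.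
- have [|c /andP[c0 ch] E] := @MVT_d1 R g g' h 0 h0.
    by move=> s /andP[s0 sh]; apply: H; rewrite !ler0_norm ?lerN2// ltW.
  rewrite -(opprB (g 0) (g h)) E sub0r mulrN opprK -mulrBl normrM ler_wpM2r// He//.
  by rewrite !ler0_norm ?lerN2 ?ltW.
- by rewrite subrr mulr0 subr0 normr0 mulr0.
Qed.

Lemma unif_cont_on (R : realType) (n : nat) (z : 'rV[R]_n.+1 -> R -> R) :
  unif_cont z -> continuous_on half_space z.
Proof.
move=> Hz; apply/subspace_continuousP => -[x t] [/= x0 _].
apply/cvgrPdist_le => e e0; rewrite near_withinE.
have r0 : 0 < x 0 ord0 / 2 by rewrite divr_gt0.
have [d d0 Hd] := Hz _ e r0 e0.
apply/nbhs_ballP; exists (Num.min d (x 0 ord0 / 2)) => /=; first by rewrite lt_min d0.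
move=> [y s] [/= [_ Hy] Hs] _; rewrite distrC.
have Hy' j : `|y 0 j - x 0 j| < Num.min d (x 0 ord0 / 2) by rewrite distrC; exact: Hy.
apply: Hd => //.
- by rewrite ltr_pdivrMr// mulr_natr mulr2n ltrDl.
- by have := Hy' ord0; rewrite lt_min => /andP[_]; rewrite ltr_norml /=; lra.
- by move=> j; have := Hy' j; rewrite lt_min => /andP[].
- by move: Hs; rewrite /ball/= distrC lt_min => /andP[].
Qed.

Lemma unif_cont_eq (R : realType) (n : nat) (z w : 'rV[R]_n.+1 -> R -> R) :
  (forall x t, half_space x -> z x t = w x t) -> unif_cont z -> unif_cont w.
Proof.
move=> E Hz r e r0 e0; have [d d0 Hd] := Hz r e r0 e0; exists d => // x x' t s xr x'r Hx Hs.
by rewrite -!E; [exact: Hd|exact: lt_trans r0 _|exact: lt_trans r0 _].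
Qed.

Lemma cvg_all_le (R : realType) (F : set_system nat) (a : nat -> R) (l c : R) :
  ProperFilter F -> a @ F --> l -> (forall k, a k <= c) -> l <= c.
Proof. by move=> PF al H; apply: (cvgr_to_le al); exact: (@filterE _ F). Qed.

Lemma cvg_all_ge (R : realType) (F : set_system nat) (a : nat -> R) (l c : R) :
  ProperFilter F -> a @ F --> l -> (forall k, c <= a k) -> c <= l.
Proof. by move=> PF al H; apply: (cvgr_to_ge al); exact: (@filterE _ F). Qed.

Section translates.
Context {R : realType} {n : nat}.
Variables (U : set_system nat) (X : nat -> 'rV[R]_n.+1) (T : nat -> R).
Hypothesis UU : UltraFilter U.
Hypothesis X0 : forall k, X k 0 ord0 = 0.
Implicit Types (z p : 'rV[R]_n.+1 -> R -> R) (x : 'rV[R]_n.+1).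

Let PU : ProperFilter U.
Proof. exact: ultra_proper. Qed.

(** By [X0] the translations are tangential, so all translates live on the same half-space. The
    value is meaningful where the sequence is bounded, since it then converges along [U]. *)
Definition ultralim z x t : R := lim ((fun k => z (x + X k) (t + T k)) @ U).

Lemma translate0 x k : (x + X k) 0 ord0 = x 0 ord0.
Proof. by rewrite mxE X0 addr0. Qed.

Lemma ultralim_cvg z x t : unif_bound z -> half_space x ->
  (fun k => z (x + X k) (t + T k)) @ U --> ultralim z x t.
Proof.
move=> Hz x0; have r0 : 0 < x 0 ord0 / 2 by rewrite divr_gt0.
have [C C0 HC] := Hz _ r0; apply: (@ultra_cvg_bounded _ U _ C) => // k.
by apply: HC; rewrite translate0 ltr_pdivrMr// mulr_natr mulr2n ltrDl.
Qed.

Lemma ultralim_unif_cont z : unif_bound z -> unif_cont z -> unif_cont (ultralim z).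
Proof.
move=> Hb Hz r e r0 e0; have [d d0 Hd] := Hz r e r0 e0; exists d => // x x' t s xr x'r Hx Hs.
have c1 := ultralim_cvg (t := t) Hb (lt_trans r0 xr : half_space x).
have c2 := ultralim_cvg (t := s) Hb (lt_trans r0 x'r : half_space x').
apply: (cvg_all_le PU (cvg_norm (cvgB c2 c1))) => k; apply: Hd; rewrite ?translate0//.
  by move=> j; rewrite !mxE opprD addrACA subrr addr0.
by rewrite opprD addrACA subrr addr0.
Qed.

(** By [taylor1] and the modulus of p, the remainder of the first-order expansion is at most e |s|
    within a radius independent of k; this inequality passes to the limit. *)
Lemma ultralim_d1x z p x t j : unif_bound z -> unif_bound p -> unif_cont p ->
  (forall x t, half_space x -> has_d1 (fun s => z (x + s *: basis_vec j) t) (p x t)) ->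
  half_space x -> has_d1 (fun s => ultralim z (x + s *: basis_vec j) t) (ultralim p x t).
Proof.
move=> zb pb pc H x0 e e0; have r0 : 0 < x 0 ord0 / 2 by rewrite divr_gt0.
have x0' : 0 < x 0 ord0 by [].
have [d d0 Hd] := pc _ e r0 e0.
exists (Num.min d (x 0 ord0 / 2)); first by rewrite lt_min d0.
move=> s; rewrite lt_min => /andP[sd sx].
have inx y : `|y| <= `|s| -> x 0 ord0 / 2 < (x + y *: basis_vec j) 0 ord0.
  by move=> ys; apply: halfspace_near; lra.
have c1 := ultralim_cvg (t := t) zb (lt_trans r0 (inx s (lexx _)) : half_space (x + s *: basis_vec j)).
have c0 := ultralim_cvg (t := t) zb x0; have cp := ultralim_cvg (t := t) pb x0.
rewrite scale0r addr0.
apply: (cvg_all_le PU (cvg_norm (cvgB (cvgB c1 c0) (cvgM cp (cvg_cst s))))) => k.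
have := @taylor1 R (fun y => z (x + X k + y *: basis_vec j) (t + T k))
  (fun y => p (x + X k + y *: basis_vec j) (t + T k)) s e.
rewrite !scale0r !addr0 (addrAC x (X k) (s *: _)); apply.
  move=> y ys; apply: has_d1_ext (H (x + X k + y *: basis_vec j) _ _).
    by move=> y'; rewrite scalerDl addrA.
  by rewrite (addrAC x (X k)) /half_space/= translate0; exact: lt_trans r0 (inx y ys).
move=> y ys; apply: Hd.
- by rewrite translate0; lra.
- by rewrite (addrAC x (X k)) translate0; exact: inx.
- move=> i; rewrite addZbasisE addrAC subrr add0r normrM.
  by case: (i == j); rewrite ?normr1 ?normr0 ?mulr1 ?mulr0//; lra.
- by rewrite subrr normr0.
Qed.

Lemma ultralim_d1t z p x t : unif_bound z -> unif_bound p -> unif_cont p ->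
  (forall x t, half_space x -> has_d1 (fun s => z x (t + s)) (p x t)) ->
  half_space x -> has_d1 (fun s => ultralim z x (t + s)) (ultralim p x t).
Proof.
move=> zb pb pc H x0 e e0; have r0 : 0 < x 0 ord0 / 2 by rewrite divr_gt0.
have x0' : 0 < x 0 ord0 by [].
have [d d0 Hd] := pc _ e r0 e0.
exists d => // s sd.
have c1 := ultralim_cvg (t := t + s) zb x0.
have c0 := ultralim_cvg (t := t) zb x0; have cp := ultralim_cvg (t := t) pb x0.
rewrite addr0.
apply: (cvg_all_le PU (cvg_norm (cvgB (cvgB c1 c0) (cvgM cp (cvg_cst s))))) => k.
have := @taylor1 R (fun y => z (x + X k) (t + T k + y))
  (fun y => p (x + X k) (t + T k + y)) s e.
rewrite !addr0 (addrAC t (T k)); apply.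
  move=> y ys; apply: has_d1_ext (H (x + X k) (t + T k + y) _).
    by move=> y'; rewrite addrA.
  by rewrite /half_space/= translate0.
move=> y ys; apply: Hd.
- by rewrite translate0; lra.
- by rewrite translate0; lra.
- by move=> i; rewrite subrr normr0.
- by rewrite addrAC subrr add0r; exact: le_lt_trans ys sd.
Qed.

End translates.

(** * The limit of translates is a solution *)

Section limit_solution.
Context {R : realType} {n m : nat}.
Variables (f : 'I_m -> 'rV[R]_m -> R) (u : 'I_m -> 'rV[R]_n.+1 -> R -> R) (M : R).
Hypothesis fC1 : forall i, C1_on orthant (f i).
Hypothesis f0 : forall i, f i 0 = 0.
Hypothesis usol : solution f u.
Hypothesis unn : nonnegative u.
Hypothesis M0 : 0 <= M.
Hypothesis uM : forall i x t, closed_half_space x -> `|u i x t| <= M.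
Variables (U : set_system nat) (X : nat -> 'rV[R]_n.+1) (T : nat -> R).
Hypothesis UU : UltraFilter U.
Hypothesis X0 : forall k, X k 0 ord0 = 0.

Let PU : ProperFilter U.
Proof. exact: ultra_proper. Qed.

Let ub i := unif_bound_u M0 uM i.
Let gb i k := unif_bound_grad fC1 f0 usol unn M0 uM i k.
Let hb i k l := unif_bound_hess fC1 f0 usol unn M0 uM i k l.
Let tb i := unif_bound_dt fC1 f0 usol unn M0 uM i.
Let uc i := unif_cont_u fC1 f0 usol unn M0 uM i.
Let gc i k := unif_cont_grad fC1 f0 usol unn M0 uM i k.
Let hc i k l := unif_cont_hess fC1 f0 usol unn M0 uM i k l.
Let tc i := unif_cont_dt fC1 f0 usol unn M0 uM i.

Local Notation lim_ := (ultralim U X T).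

Definition limit_sol i : 'rV[R]_n.+1 -> R -> R := lim_ (u i).

Lemma closed_translate (x : 'rV[R]_n.+1) k : closed_half_space x -> closed_half_space (x + X k).
Proof. by move=> /closedP h; apply/closedP; rewrite translate0. Qed.

Lemma limit_sol_cvg i x t : closed_half_space x ->
  (fun k => u i (x + X k) (t + T k)) @ U --> limit_sol i x t.
Proof.
move=> x0; apply: (@ultra_cvg_bounded _ U _ M) => // k.
by apply: uM; exact: closed_translate.
Qed.

Lemma limit_sol_ge0 : nonnegative limit_sol.
Proof.
move=> i x t Hx; apply: (cvg_all_ge PU (limit_sol_cvg (i := i) (t := t) Hx)) => k.
by apply: unn; exact: closed_translate.
Qed.

Lemma limit_sol_le i x t : closed_half_space x -> `|limit_sol i x t| <= M.
Proof.
move=> Hx; rewrite ger0_norm ?limit_sol_ge0//.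
apply: (cvg_all_le PU (limit_sol_cvg (i := i) (t := t) Hx)) => k.
by apply: le_trans (uM i _ (closed_translate k Hx)); exact: ler_norm.
Qed.

Lemma limit_sol_unif_cont i : unif_cont (limit_sol i).
Proof. exact: ultralim_unif_cont. Qed.

Lemma limit_dx i k x t : half_space x ->
  is_derive x (basis_vec k) (limit_sol i ^~ t) (lim_ (dx k (u i)) x t).
Proof.
move=> Hx; apply/(has_d1_is_derive (limit_sol i ^~ t)).
by apply: ultralim_d1x => // {x Hx}t' x; exact: sol_d1x.
Qed.

Lemma limit_dxE i k x t : half_space x -> dx k (limit_sol i) x t = lim_ (dx k (u i)) x t.
Proof. by move=> Hx; have H := limit_dx i k t Hx; exact: derive_val. Qed.

Lemma limit_dxx i k l x t : half_space x ->
  is_derive x (basis_vec l) (dx k (limit_sol i) ^~ t) (lim_ (dx l (dx k (u i))) x t).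
Proof.
move=> Hx; apply/(has_d1_is_derive (dx k (limit_sol i) ^~ t)).
apply: (@has_d1_near _ (fun s => lim_ (dx k (u i)) (x + s *: basis_vec l) t)).
  exists (x 0 ord0) => // s sx; rewrite limit_dxE//.
  by apply: halfspace_near; rewrite subr0.
by apply: ultralim_d1x => // {x Hx}t' x; exact: sol_d1xx.
Qed.

Lemma limit_dxxE i k l x t : half_space x ->
  dx l (dx k (limit_sol i)) x t = lim_ (dx l (dx k (u i))) x t.
Proof. by move=> Hx; have H := limit_dxx i k l t Hx; exact: derive_val. Qed.

Lemma limit_dt i x (t : R) : half_space x -> is_derive t (1 : R) (limit_sol i x) (lim_ (dt (u i)) x t).
Proof.
move=> Hx; apply/has_d1_R.
by apply: ultralim_d1t => // {x Hx}t' x; exact: sol_d1t.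
Qed.

Lemma limit_dtE i x t : half_space x -> dt (limit_sol i) x t = lim_ (dt (u i)) x t.
Proof. by move=> Hx; have H := limit_dt i t Hx; rewrite /dt derive1E; exact: derive_val. Qed.

Lemma limit_C21 i : C21_on half_space (limit_sol i).
Proof.
split.
- exact/unif_cont_on/limit_sol_unif_cont.
- split; first by move=> x t Hx; have H := limit_dt i t Hx; exact: ex_derive.
  apply: unif_cont_on; apply: unif_cont_eq (ultralim_unif_cont T UU X0 (tb i) (tc i)).
  by move=> x t Hx; rewrite limit_dtE.
- move=> k; split; first by move=> x t Hx; have H := limit_dx i k t Hx; exact: ex_derive.
  apply: unif_cont_on; apply: unif_cont_eq (ultralim_unif_cont T UU X0 (gb i k) (gc i k)).
  by move=> x t Hx; rewrite limit_dxE.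
- move=> l k; split; first by move=> x t Hx; have H := limit_dxx i k l t Hx; exact: ex_derive.
  apply: unif_cont_on; apply: unif_cont_eq (ultralim_unif_cont T UU X0 (hb i k l) (hc i k l)).
  by move=> x t Hx; rewrite limit_dxxE.
Qed.

(** Inside, by the modulus common to all translates; at the boundary, by u <= C x_1, which holds for
    all translates with the same C. *)
Lemma limit_closed i : continuous_on closed_half_space (limit_sol i).
Proof.
apply/subspace_continuousP => -[x t] [/= Hx _].
have /closedP := Hx; rewrite le_eqVlt => /predU1P[x0|x0]; last first.
  have /subspace_continuousP/(_ (x, t) (conj x0 I)) := unif_cont_on (@limit_sol_unif_cont i).
  move=> /cvgrPdist_le H; apply/cvgrPdist_le => e e0.
  have := H e e0; rewrite !near_withinE /= => /nbhs_ballP[d /= d0 Hd].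
  apply/nbhs_ballP; exists (Num.min d (x 0 ord0)) => /=; first by rewrite lt_min d0.
  move=> [y s] /= Hys _; apply: (Hd (y, s)).
    by apply: le_ball Hys; rewrite ge_min lexx.
  split => //; case: Hys => [[_ h] _]; have := h ord0 ord0; rewrite /ball/= lt_min => /andP[_].
  by rewrite ltr_norml /half_space/=; lra.
have [C C0 HC] := boundary_bound fC1 f0 usol unn M0 uM.
have bd (y : 'rV[R]_n.+1) s : closed_half_space y -> `|limit_sol i y s| <= C * y 0 ord0.
  move=> Hy; rewrite ger0_norm ?limit_sol_ge0//.
  apply: (cvg_all_le PU (limit_sol_cvg (i := i) (t := s) Hy)) => k.
  rewrite -(translate0 X0 y k); apply: HC.
  exact: closed_translate.
apply/cvgrPdist_le => e e0; rewrite near_withinE.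
have C1 : 0 < C + 1 by rewrite ltr_wpDl.
apply/nbhs_ballP; exists (e / (C + 1)) => /=; first by rewrite divr_gt0.
move=> [y s] /= [[_ /(_ ord0 ord0)] + _] [Hy _]; rewrite /ball/= -x0 sub0r normrN => Hy0.
have {}Hy0 : `|y 0 ord0| < e / (C + 1) by exact: Hy0.
change (`|limit_sol i x t - limit_sol i y s| <= e).
have := bd x t Hx; rewrite -x0 mulr0 normr_le0 => /eqP ->; rewrite sub0r normrN.
apply: le_trans (bd y s Hy) _; have /closedP y0 := Hy.
move: Hy0; rewrite ger0_norm// ltr_pdivlMr// => Hy0; lra.
Qed.

Lemma limit_solution : solution f limit_sol.
Proof.
move=> i; split; [exact: limit_C21|exact: limit_closed| |].
  move=> x t Hx; rewrite limit_dtE// /laplacian.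
  under eq_bigr do rewrite limit_dxxE//.
  have cl : (fun k => \sum_j dx j (dx j (u i)) (x + X k) (t + T k)) @ U -->
      \sum_j lim_ (dx j (dx j (u i))) x t.
    elim: (index_enum _) => [|j s IH].
      under eq_fun do rewrite big_nil; rewrite big_nil; exact: cvg_cst.
    under eq_fun do rewrite big_cons; rewrite big_cons; apply: cvgD => //.
    exact: ultralim_cvg.
  have ct := ultralim_cvg (T := T) UU X0 (t := t) (tb i) Hx.
  (* The source converges because the states converge pointwise and [f i] is Lipschitz on the cube
     [0, M]^m. *)
  have [L L0 HL] := orthant_lip (fC1 i) M0.
  have cs : (fun k => L * \sum_j `|limit_sol j x t - u j (x + X k) (t + T k)|) @ U --> L * 0.
    apply: cvgM; first exact: cvg_cst.
    elim: (index_enum _) => [|j s IH].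
      under eq_fun do rewrite big_nil; exact: cvg_cst.
    under eq_fun do rewrite big_cons.
    have cj := limit_sol_cvg (i := j) (t := t) (or_introl Hx : closed_half_space x).
    have := cvgD (cvg_norm (cvgB (cvg_cst (limit_sol j x t)) cj)) IH.
    by rewrite subrr normr0 addr0; apply.
  set A := _ - _; apply/eqP; rewrite -subr_eq0 -normr_le0 -(mulr0 L).
  rewrite -normrN opprB.
  have cA : (fun k => `|f i (state limit_sol x t) - (dt (u i) (x + X k) (t + T k) -
      \sum_j dx j (dx j (u i)) (x + X k) (t + T k))|) @ U --> `|f i (state limit_sol x t) - A|.
    by apply: cvg_norm; apply: cvgB; [exact: cvg_cst|exact: cvgB].
  apply: (ler_cvg_to cA cs).
  apply: filterE => k /=.
  have Hk : half_space (x + X k) by rewrite /half_space/= translate0.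
  have [_ _ /(_ _ (t + T k) Hk) + _] := usol i; rewrite /laplacian => ->.
  have := HL (state u (x + X k) (t + T k)) (state limit_sol x t).
  rewrite (eq_bigr (fun j => `|limit_sol j x t - u j (x + X k) (t + T k)|)).
    apply => l; first by apply: (state_range unn uM); left.
    by apply: (state_range limit_sol_ge0 limit_sol_le); left.
  by move=> j _; rewrite !mxE.
move=> x t Hx; have Hc : closed_half_space x by right.
apply/(@cvg_lim R) => //; rewrite (_ : (fun k => _) = (fun=> 0)); first exact: cvg_cst.
apply/funext => k; have [_ _ _ ub0] := usol i; apply: ub0.
by rewrite /half_space_boundary/= translate0.
Qed.

End limit_solution.

(** * Propagation of positivity *)

(** A paraboloid over a ball whose centre travels from y at s = 0 to y + d e_1 at s = 1. Being
    quadratic, it is expanded exactly instead of being differentiated. *)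
Definition bump (R : realType) (n : nat) (r d : R) (y x : 'rV[R]_n.+1) (s : R) : R :=
  r ^+ 2 - sqn (x - (y + (s * d) *: basis_vec ord0)).

Lemma bump_addx (R : realType) (n : nat) (r d : R) (y x : 'rV[R]_n.+1) (s e : R) k :
  bump r d y (x + e *: basis_vec k) s =
  bump r d y x s - 2 * e * (x - (y + (s * d) *: basis_vec ord0)) 0 k - e ^+ 2.
Proof. by rewrite /bump addrAC sqn_addZbasis; ring. Qed.

Lemma bump_subt (R : realType) (n : nat) (r d : R) (y x : 'rV[R]_n.+1) (s e : R) :
  bump r d y x (s - e) = bump r d y x s -
    e * (2 * d * (x - (y + (s * d) *: basis_vec ord0)) 0 ord0 + e * d ^+ 2).
Proof.
rewrite /bump (_ : x - (y + ((s - e) * d) *: basis_vec ord0) =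
  x - (y + (s * d) *: basis_vec ord0) + (e * d) *: basis_vec ord0).
  by rewrite sqn_addZbasis; ring.
rewrite mulrBl scalerBl addrA opprB addrA -addrA -addrA; congr (_ + _).
by rewrite opprD addrC -addrA addrCA.
Qed.

Lemma bump_continuous (R : realType) (n : nat) (r d : R) (y : 'rV[R]_n.+1) :
  continuous (fun p : 'rV[R]_n.+1 * R => bump r d y p.1 p.2).
Proof.
apply: contB; first exact: contcst.
apply: (@contcomp _ _ _ (fun p : 'rV[R]_n.+1 * R => p.1 - (y + (p.2 * d) *: basis_vec ord0))
  (@sqn R n.+1)); last exact: sqn_continuous.
have c : continuous (fun p : 'rV[R]_n.+1 * R => y + (p.2 * d) *: basis_vec ord0).
  apply: addZ_continuous; first by move=> q; exact: cvg_cst.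
  by apply: contM; [exact: contsnd|exact: contcst].
by move=> p; apply: (@cvgB R 'rV[R]_n.+1); [exact: cvg_fst|exact: c].
Qed.

Lemma sqn_coord_le (R : realType) (k : nat) (r : R) (x : 'rV[R]_k) j :
  0 <= r -> sqn x <= r ^+ 2 -> `|x 0 j| <= r.
Proof.
move=> r0 h; rewrite -ler_sqr ?nnegrE// real_normK ?num_real//.
exact: le_trans (sqr_le_sqn x j) h.
Qed.

Lemma bump_compact (R : realType) (n : nat) (r d : R) (y : 'rV[R]_n.+1) : 0 <= r ->
  compact [set p : 'rV[R]_n.+1 * R | 0 <= p.2 <= 1 /\ 0 <= bump r d y p.1 p.2].
Proof.
move=> r0.
pose B := box (fun k => y 0 k - (r + `|d|)) (fun k => y 0 k + (r + `|d|)).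
have -> : [set p : 'rV[R]_n.+1 * R | 0 <= p.2 <= 1 /\ 0 <= bump r d y p.1 p.2] =
    (B `*` [set s : R | 0 <= s <= 1]) `&` [set p | 0 <= bump r d y p.1 p.2].
  apply/seteqP; split => [[x s] /= [s01 H]|[x s] [[/= _ H1] H2]] //.
  do 2 split => //=; move=> k; have /andP[s0 s1] := s01.
  have := @sqn_coord_le R n.+1 r _ k r0 _; move: H; rewrite /bump subr_ge0 => H /(_ _ H).
  rewrite mxE mxE addZbasisE.
  have h : `|s * d * (k == ord0)%:R| <= `|d|.
    rewrite !normrM (ger0_norm s0); case: (k == ord0); rewrite ?normr1 ?normr0 ?mulr1 ?mulr0//.
    by rewrite ler_piMl.
  by move: h; rewrite !ler_norml; lra.
apply: compact_closedI.
  by apply: compact_setX; [exact: box_compact|exact: itv_compact].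
apply: (@preimage_closed _ _ (fun p : 'rV[R]_n.+1 * R => bump r d y p.1 p.2) [set u : R | 0 <= u]).
  by move=> p _; exact: bump_continuous.
exact: closed_ge.
Qed.

(* The comparison function is [kap / r ^+ 4 * expR (- A * s) * bump ^+ 2]: near
   the lateral boundary of the moving ball its Laplacian is positive because
   [bump] is small, elsewhere the factor [expR (- A * s)] makes it a
   subsolution. *)
Lemma positivity_spreads (R : realType) (n : nat) (r d K : R) : 0 < r -> 0 <= K ->
  exists2 c : R, 0 < c &
  forall (D : set 'rV[R]_n.+1) (w : 'rV[R]_n.+1 -> R -> R) y (t kap : R),
    continuous_on D w -> 0 <= kap ->
    (forall x s, 0 <= s <= 1 -> 0 <= bump r d y x s ->
      [/\ D x, 0 <= w x (t + s) &
        exists2 g, - K * w x (t + s) <= g & heat_at w x (t + s) g]) ->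
    (forall x, 0 <= bump r d y x 0 -> kap <= w x t) ->
    c * kap <= w (y + d *: basis_vec ord0) (t + 1).
Proof.
move=> r0 K0; have r20 : 0 < r ^+ 2 by rewrite exprn_gt0.
(* [Bq] collects the terms linear in e = [bump] of the final inequality: motion of the centre and
   Laplacian. In [A], K absorbs the zeroth-order term, and the rest leads to v^2 - v r + 8 r^2 <= 0
   with v = Bq e / r, which is impossible. *)
pose Bq := 4 * `|d| * r + 8 + 4 * n.+1%:R.
pose A := K + Bq ^+ 2 / r ^+ 2.
have Bq0 : 0 <= Bq by rewrite !addr_ge0// !mulr_ge0// ltW.
have A0 : 0 <= A by rewrite addr_ge0// divr_ge0 ?sqr_ge0.
exists (expR (- A)); first exact: expR_gt0.
move=> D w y t kap cw; rewrite le_eqVlt => /predU1P[<-|kap0] Hw Hi.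
  rewrite mulr0; have [||_ + _] := Hw (y + d *: basis_vec ord0) 1; first lra.
    by rewrite /bump mul1r subrr sqn0 subr0 ltW.
  by [].
pose Q := [set p : 'rV[R]_n.+1 * R | 0 <= p.2 <= 1 /\ 0 <= bump r d y p.1 p.2].
pose P := kap / r ^+ 4.
have r40 : 0 < r ^+ 4 by rewrite exprn_gt0.
have P0 : 0 < P by rewrite divr_gt0.
have Pr : P * (r ^+ 2) ^+ 2 = kap by rewrite /P -exprM divfK// gt_eqF.
pose h x s := P * expR (- A * s) * bump r d y x s ^+ 2.
pose F (p : 'rV[R]_n.+1 * R) := w p.1 (t + p.2) - h p.1 p.2.
have Q1 : Q (y + d *: basis_vec ord0, 1).
  by split => /=; [lra|rewrite /bump mul1r subrr sqn0 subr0 ltW].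
have cF : {within Q, continuous F}.
  apply: withinB.
    apply: (within_comp cw) => [p [p1 p2]||]; first by have [] := Hw _ _ p1 p2.
      exact: contfst.
    by apply: contD; [exact: contcst|exact: contsnd].
  apply: continuous_subspaceT; rewrite /h; apply: contM.
    apply: contM; first exact: contcst.
    apply: (contcomp _ (@continuous_expR R)).
    by apply: contM; [exact: contcst|exact: contsnd].
  by apply: contM; exact: bump_continuous.
have [[x s] [/= s01 e0] Hmin] := EVT_min (ex_intro _ _ Q1) (@bump_compact R n r d y (ltW r0)) cF.
suff F0 : 0 <= F (x, s).
  have := le_trans F0 (Hmin _ Q1); rewrite /F /h /= /bump mul1r subrr sqn0 subr0 mulr1 subr_ge0.
  by rewrite (_ : P * _ * _ = expR (- A) * kap)//; rewrite -Pr; ring.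
rewrite leNgt; apply/negP; rewrite /F /= subr_lt0 => F0.
have Hm x2 s2 : 0 <= s2 <= 1 -> 0 <= bump r d y x2 s2 ->
    w x (t + s) - h x s <= w x2 (t + s2) - h x2 s2.
  by move=> h1 h2; exact: (Hmin (x2, s2)).
clear F cF Hmin Q1 Q.
have [Dx w0 [g gK Hg]] := Hw x s s01 e0.
pose E := P * expR (- A * s).
have E0 : 0 < E by rewrite mulr_gt0// expR_gt0.
set e := bump r d y x s in e0 *.
have hE : h x s = E * e ^+ 2 by [].
have ele : e <= r ^+ 2 by rewrite /e /bump lerBlDr lerDl sqn_ge0.
have epos : 0 < e.
  rewrite lt_neqAle e0 andbT; apply/eqP => Ee; move: F0.
  by rewrite hE -Ee expr0n/= mulr0 ltNge w0.
(* At s = 0 the normalization by r^4 keeps the comparison function below kap, hence below w. *)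
have spos : 0 < s.
  rewrite lt_neqAle; have /andP[-> _] := s01; rewrite andbT; apply/eqP => Es.
  have e1 : 0 <= bump r d y x 0 by have := e0; rewrite /e -Es.
  have := Hi x e1; move: F0; rewrite hE /E -Es mulr0 expR0 mulr1 addr0.
  have : P * e ^+ 2 <= kap by rewrite -Pr ler_wpM2l ?(ltW P0)// ler_sqr ?nnegrE// ltW.
  lra.
set z := x - (y + (s * d) *: basis_vec ord0).
have ez : sqn z = r ^+ 2 - e by rewrite /e /bump -/z; ring.
have zr : `|z 0 ord0| <= r by apply: sqn_coord_le; [exact: ltW|rewrite ez; lra].
have test : g <= E * (4 * d * z 0 ord0 * e - A * e ^+ 2) -
    \sum_k E * (8 * z 0 k ^+ 2 - 4 * e).
  apply: (@heat_min_test R n.+1 w x (t + s) g _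
    (E * (2 * d ^+ 2 * e + 2 * A * (`|2 * d * z 0 ord0| + d ^+ 2) * e)) _ Hg).
    pose q1 := `|2 * d * z 0 ord0| + d ^+ 2 + 1.
    have q10 : 0 < q1 by rewrite ltr_wpDl// addr_ge0// sqr_ge0.
    exists (Num.min s (Num.min 1 (e / q1))); first by rewrite !lt_min spos ltr01 divr_gt0.
    move=> v /andP[v0]; rewrite !lt_min => /andP[vs /andP[v1 vq]].
    have bs := bump_subt r d y x s v; rewrite -/e -/z in bs.
    set q := 2 * d * z 0 ord0 + v * d ^+ 2 in bs.
    have qq1 : `|q| <= `|2 * d * z 0 ord0| + d ^+ 2.
      apply: le_trans (ler_normD _ _) _; rewrite lerD2l normrM (gtr0_norm v0) (ger0_norm (sqr_ge0 _)).
      by rewrite ler_piMl ?sqr_ge0// ltW.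
    have bpos : 0 <= bump r d y x (s - v).
      rewrite bs subr_ge0; apply: (@le_trans _ _ (v * q1)).
        by rewrite ler_wpM2l ?(ltW v0)// (le_trans (ler_norm _))// (le_trans qq1)// lerDl.
      by rewrite -ler_pdivlMr// ltW.
    have := Hm x (s - v) ltac:(lra) bpos; rewrite addrA hE.
    (* The inequality exp x >= 1 + x linearizes the time factor from the right side; what remains is
       polynomial in v. *)
    have hlow : E * (1 + A * v) * (e - v * q) ^+ 2 <= h x (s - v).
      rewrite /h bs ler_wpM2r ?sqr_ge0// (_ : - A * (s - v) = - A * s + A * v); last by ring.
      by rewrite expRD mulrA -/E ler_wpM2l ?(ltW E0)// expR_ge1Dx.
    have qe : A * v ^+ 2 * (e * q) <= A * v ^+ 2 * (e * (`|2 * d * z 0 ord0| + d ^+ 2)).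
      apply: ler_wpM2l; first exact: mulr_ge0 A0 (sqr_ge0 v).
      by apply: ler_wpM2l => //; exact: le_trans (ler_norm _) qq1.
    have sq0 : 0 <= (1 + A * v) * (v * q) ^+ 2.
      apply: mulr_ge0 (sqr_ge0 _); apply: addr_ge0 => //.
      exact: mulr_ge0 A0 (ltW v0).
    have fin : e ^+ 2 - (1 + A * v) * (e - v * q) ^+ 2 <=
        (4 * d * z 0 ord0 * e - A * e ^+ 2) * v +
        (2 * d ^+ 2 * e + 2 * A * (`|2 * d * z 0 ord0| + d ^+ 2) * e) * v ^+ 2.
      have -> : e ^+ 2 - (1 + A * v) * (e - v * q) ^+ 2 =
        (4 * d * z 0 ord0 * e - A * e ^+ 2) * v + 2 * d ^+ 2 * e * v ^+ 2 +
        2 * (A * v ^+ 2 * (e * q)) - (1 + A * v) * (v * q) ^+ 2 by rewrite /q; ring.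
      by lra.
    have := ler_wpM2l (ltW E0) fin; move: hlow; clear; lra.
  move=> k; pose q1 := 2 * `|z 0 k| + 1.
  have q10 : 0 < q1 by rewrite ltr_wpDl// mulr_ge0.
  exists (Num.min 1 (e / q1)); first by rewrite lt_min ltr01 divr_gt0.
  move=> v /andP[v0]; rewrite lt_min => /andP[v1 vq].
  have b1 := bump_addx r d y x s v k; have b2 := bump_addx r d y x s (- v) k.
  rewrite -/e -/z in b1 b2; rewrite scaleNr in b2.
  have bnd : 2 * v * `|z 0 k| + v ^+ 2 <= e.
    move: vq; rewrite ltr_pdivlMr// /q1 => vq.
    have : v * v <= v * 1 by rewrite ler_wpM2l// ltW.
    by rewrite expr2; lra.
  have vz : `|v * z 0 k| <= v * `|z 0 k| by rewrite normrM (gtr0_norm v0).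
  move: vz; rewrite ler_norml => vz.
  have p1 : 0 <= bump r d y (x + v *: basis_vec k) s by rewrite b1; lra.
  have p2 : 0 <= bump r d y (x - v *: basis_vec k) s by rewrite b2 sqrrN; lra.
  have := Hm _ s s01 p1; have := Hm _ s s01 p2; rewrite hE /h -/E b1 b2 sqrrN.
  have : 0 <= E * (2 * (v ^+ 2) ^+ 2).
    by apply: mulr_ge0 (ltW E0) _; apply: mulr_ge0 => //; exact: sqr_ge0.
  clear; lra.
move: test; rewrite -mulr_sumr -mulrBr.
have -> : \sum_k (8 * z 0 k ^+ 2 - 4 * e) = 8 * (r ^+ 2 - e) - 4 * n.+1%:R * e.
  by rewrite -ez /sqn sumrB -mulr_sumr sumr_const card_ord -[_ *+ _]mulr_natr; ring.
move=> test.
have wK : - K * (E * e ^+ 2) <= g.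
  apply: le_trans gK; rewrite !mulNr lerN2 ler_wpM2l// -hE ltW//.
have : 0 <= E * (4 * d * z 0 ord0 * e - (A - K) * e ^+ 2 - 8 * (r ^+ 2 - e) + 4 * n.+1%:R * e).
  by move: test wK; clear; lra.
rewrite pmulr_rge0//; have -> : A - K = Bq ^+ 2 / r ^+ 2 by rewrite /A addrAC subrr add0r.
have dz : d * z 0 ord0 * e <= `|d| * r * e.
  by rewrite ler_wpM2r// (le_trans (ler_norm _))// normrM ler_wpM2l.
pose v := Bq * e / r.
have -> : Bq ^+ 2 / r ^+ 2 * e ^+ 2 = v ^+ 2 by rewrite /v; field; rewrite gt_eqF.
have vr : v * r = Bq * e by rewrite /v divfK// gt_eqF.
move=> H; have : v ^+ 2 - v * r + 8 * r ^+ 2 <= 0.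
  rewrite vr /Bq; move: dz H; clear; lra.
have := sqr_ge0 (v - r / 2); move: r20; clear; rewrite !expr2; lra.
Qed.

(** * Moving planes *)

Section moving_planes.
Context {R : realType} {n m : nat}.
Variables (f : 'I_m -> 'rV[R]_m -> R) (u : 'I_m -> 'rV[R]_n.+1 -> R -> R) (M : R).
Hypothesis fC1 : forall i, C1_on orthant (f i).
Hypothesis fcoop : forall (i j : 'I_m) (a : 'rV[R]_m), i != j -> orthant a ->
  0 <= partial_on orthant (f i) j a.
Hypothesis fsum : forall i : 'I_m, \sum_(j < m) partial_on orthant (f i) j 0 <= 0.
Hypothesis usol : solution f u.
Hypothesis unn : nonnegative u.
Hypothesis M0 : 0 <= M.
Hypothesis uM : forall i x t, closed_half_space x -> `|u i x t| <= M.

Definition reflection_ordered (l : R) : Prop := forall i (x : 'rV[R]_n.+1) t,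
  0 <= x 0 ord0 <= l -> u i x t <= u i (refl l x) t.

Definition refl_diff (l : R) i (x : 'rV[R]_n.+1) t : R := u i (refl l x) t - u i x t.

Lemma state_orthant x t : closed_half_space x -> orthant (state u x t).
Proof. by move=> Hx l; have /andP[] := state_range unn uM t l Hx. Qed.

Lemma partials_bounded : exists2 L : R, 0 <= L & forall i j (a : 'rV[R]_m),
  (forall l, 0 <= a 0 l <= M) -> `|partial_on orthant (f i) j a| <= L.
Proof.
apply: (@fin_bound R m (fun i L => forall j (a : 'rV[R]_m),
  (forall l, 0 <= a 0 l <= M) -> `|partial_on orthant (f i) j a| <= L)).
  by move=> i C C' CC' H j a Ha; apply: le_trans (H j a Ha) _.
by move=> i; exact: partial_bounded.
Qed.

Lemma between_range (a b xi : 'rV[R]_m) (c : R) :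
  (forall l, 0 <= a 0 l <= c) -> (forall l, 0 <= b 0 l <= c) ->
  (forall l, Num.min (a 0 l) (b 0 l) <= xi 0 l <= Num.max (a 0 l) (b 0 l)) ->
  forall l, 0 <= xi 0 l <= c.
Proof.
move=> Ha Hb Hxi l; have /andP[h1 h2] := Hxi l.
have /andP[a0 ac] := Ha l; have /andP[b0 bc] := Hb l; apply/andP; split.
  by apply: le_trans h1; rewrite le_min a0.
by apply: le_trans h2 _; rewrite ge_max ac.
Qed.

(* Linearization along coordinate segments: cooperativity makes the
   off-diagonal coefficients nonnegative. *)
Lemma refl_diff_linear i l (x : 'rV[R]_n.+1) t :
  closed_half_space x -> closed_half_space (refl l x) ->
  exists xi : 'I_m -> 'rV[R]_m,
    [/\ forall j k, Num.min (state u x t 0 k) (state u (refl l x) t 0 k) <= xi j 0 k <=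
          Num.max (state u x t 0 k) (state u (refl l x) t 0 k),
        forall j k, 0 <= xi j 0 k <= M,
        forall j, i != j -> 0 <= partial_on orthant (f i) j (xi j) &
        f i (state u (refl l x) t) - f i (state u x t) =
          \sum_j partial_on orthant (f i) j (xi j) * refl_diff l j x t].
Proof.
move=> Hx Hr; have [xi [H1 H2]] := orthant_mean_value (fC1 i)
  (state_orthant t Hx) (state_orthant t Hr).
have H3 j : forall k, 0 <= xi j 0 k <= M.
  by apply: between_range (H1 j) => k; apply: (state_range unn uM).
exists xi; split => //.
  by move=> j ij; apply: fcoop => // k; have /andP[] := H3 j k.
by rewrite H2; apply: eq_bigr => j _; rewrite !mxE.
Qed.

End moving_planes.

(** [del] and [eps] are uniform in l <= Lam. This serves twice: with Lam = 1 it orders narrow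
    strips, and it provides points of failure that survive a passage to the limit in l. *)
Lemma reflection_failure (R : realType) (n m : nat) (f : 'I_m -> 'rV[R]_m -> R)
    (u : 'I_m -> 'rV[R]_n.+1 -> R -> R) (M : R)
    (fC1 : forall i, C1_on orthant (f i))
    (fcoop : forall (i j : 'I_m) (a : 'rV[R]_m), i != j -> orthant a ->
      0 <= partial_on orthant (f i) j a)
    (fsum : forall i : 'I_m, \sum_(j < m) partial_on orthant (f i) j 0 <= 0)
    (usol : solution f u) (unn : nonnegative u) (M0 : 0 <= M)
    (uM : forall i x t, closed_half_space x -> `|u i x t| <= M) (Lam : R) : 0 < Lam ->
  exists2 del : R, 0 < del & exists2 eps : R, 0 < eps &
  forall l : R, 0 < l <= Lam -> ~ reflection_ordered u l ->
  exists i (x : 'rV[R]_n.+1) t, [/\ del <= x 0 ord0 <= l - del,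
    refl_diff u l i x t < 0 & eps <= \sum_j (u j x t + u j (refl l x) t)].
Proof.
move=> Lam0.
have [L L0 HL] := partials_bounded fC1 M0.
(* [K] exceeds every row sum of the coefficients. With c = 1 / (2 K), the inequality 1 <= phi K
   forces x_1 (l - x_1) >= c, whence the distance c / Lam from both ends. *)
pose K := m%:R * L + 1; have K0 : 0 < K by rewrite ltr_wpDl// mulr_ge0.
pose c := (2 * K)^-1; have c0 : 0 < c by rewrite invr_gt0 mulr_gt0.
have cK : c * K = 1 / 2 by rewrite /c; field; rewrite gt_eqF.
have K1 : 1 <= K by rewrite /K lerDr mulr_ge0.
have c1 : c <= 1 / 2 by rewrite -cK ler_peMr// ltW.
pose Phi := c + Lam ^+ 2; have Phi0 : 0 < Phi by rewrite addr_gt0// exprn_gt0.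
(* If the partial derivatives are within [e1] of their values at 0, the row sum is at most m e1 and
   its product with phi at most 1 / 2, against the lower bound 1. *)
pose e1 := (2 * Phi * m.+1%:R)^-1; have e10 : 0 < e1 by rewrite invr_gt0 !mulr_gt0.
have /fin_all_exists2[d d0 Hd] (i : 'I_m) := partial_near0 (fC1 i) e10.
have [eps eps0 Heps] := fin_min d0.
exists (c / Lam); first by rewrite divr_gt0.
exists eps => // l /andP[l0 lLam] nord.
pose w := refl_diff u l.
have rpos (x : 'rV[R]_n.+1) : 0 <= x 0 ord0 <= l -> closed_half_space (refl l x).
  by move=> h; apply/closedP; rewrite reflE eqxx; lra.
have xpos (x : 'rV[R]_n.+1) : 0 <= x 0 ord0 <= l -> closed_half_space x.
  by move=> /andP[h _]; apply/closedP.
have [i1 [x1 [t1 [x1l w1]]]] : exists i (x : 'rV[R]_n.+1) t,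
    0 <= x 0 ord0 <= l /\ w i x t < 0.
  apply: contrapT => H; apply: nord => i x t hx; rewrite leNgt; apply/negP => hlt.
  by apply: H; exists i, x, t; rewrite /w /refl_diff subr_lt0.
pose phi (s : R) := c + s * (l - s).
have phic s : 0 <= s <= l -> c <= phi s.
  by move=> h; rewrite /phi lerDl mulr_ge0//; lra.
have phiPhi s : 0 <= s <= l -> phi s <= Phi.
  move=> h; rewrite /phi /Phi lerD2l expr2.
  by apply: ler_pM; clear - h l0 lLam Lam0; lra.
pose S := [set r | exists i (x : 'rV[R]_n.+1) t,
  0 <= x 0 ord0 <= l /\ r = - w i x t / phi (x 0 ord0)].
have wM i (x : 'rV[R]_n.+1) t : 0 <= x 0 ord0 <= l -> - w i x t <= 2 * M.
  move=> h; have := uM i _ t (rpos x h); have := uM i _ t (xpos x h).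
  by rewrite /w /refl_diff !ler_norml; lra.
have phi0 s : 0 <= s <= l -> 0 < phi s by move=> h; exact: lt_le_trans c0 (phic s h).
have hS : has_sup S.
  split; first by exists (- w i1 x1 t1 / phi (x1 0 ord0)); exists i1, x1, t1.
  exists (2 * M / c) => _ [i [x [t [h ->]]]].
  rewrite ler_pdivrMr ?phi0// mulrAC ler_pdivlMr//.
  apply: (@le_trans _ _ (2 * M * c)); first by rewrite ler_wpM2r ?wM// ltW.
  by rewrite ler_wpM2l ?phic// mulr_ge0.
pose mu := sup S.
have wlow i (x : 'rV[R]_n.+1) t : 0 <= x 0 ord0 <= l -> 0 <= w i x t + mu * phi (x 0 ord0).
  move=> h; have : - w i x t / phi (x 0 ord0) <= mu.
    by apply: sup_upper_bound => //; exists i, x, t.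
  by rewrite ler_pdivrMr ?phi0//; lra.
have mu0 : 0 < mu.
  apply: (@lt_le_trans _ _ (- w i1 x1 t1 / phi (x1 0 ord0))).
    by rewrite divr_gt0 ?oppr_gt0// phi0.
  by apply: sup_upper_bound => //; exists i1, x1, t1.
pose G := L + 5 + 4 * n.+1%:R.
have G0 : 0 < G by rewrite /G; have : 0 <= n.+1%:R :> R by []; lra.
(* Relative error of the almost extremal point, so small that all localization terms cost at most mu
   out of the 2 mu supplied by - mu phi''. *)
pose ep := c / (Phi * G * 2); have ep0 : 0 < ep by rewrite divr_gt0// !mulr_gt0.
have epG : ep * Phi * G = c / 2 by rewrite /ep; field; rewrite !gt_eqF.
have epPhi0 : 0 < ep * Phi by rewrite mulr_gt0.
have epc : ep * Phi < c.
  have : ep * Phi * 1 <= ep * Phi * G.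
    rewrite ler_wpM2l ?(ltW epPhi0)// /G; have : 0 <= n.+1%:R :> R by []; lra.
  lra.
have [_ [i [x0 [t0 [x0l ->]]]] Hadh] : exists2 y, S y & mu - ep * mu < y.
  by apply: sup_adherent => //; rewrite mulr_gt0.
have {Hadh} w0 : w i x0 t0 + mu * phi (x0 0 ord0) < ep * mu * Phi.
  move: Hadh; rewrite ltr_pdivlMr ?phi0// mulrBl => h.
  have : ep * mu * phi (x0 0 ord0) <= ep * mu * Phi.
    by rewrite ler_wpM2l ?phiPhi// mulr_ge0// ltW.
  lra.
pose B := 2 * (ep * mu * Phi).
have eB : ep * mu * Phi = B / 2 by rewrite /B; lra.
clearbody ep mu.
have B0 : 0 < B by rewrite /B mulr_gt0// mulr_gt0// mulr_gt0.
pose lo k := if k == ord0 then 0 else x0 0 k - 1.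
pose hi k := if k == ord0 then l else x0 0 k + 1.
pose D : set ('rV[R]_n.+1 * R) := box lo hi `*` [set s : R | t0 - 1 <= s <= t0 + 1].
pose F (p : 'rV[R]_n.+1 * R) := w i p.1 p.2 + (mu * phi (p.1 0 ord0) +
  B * (sqn (p.1 - x0) + (p.2 - t0) * (p.2 - t0))).
have box0 (y : 'rV[R]_n.+1) : box lo hi y -> 0 <= y 0 ord0 <= l.
  by move=> /(_ ord0); rewrite /lo /hi eqxx.
have cD : compact D by apply: compact_setX; [exact: box_compact|exact: itv_compact].
have cp1 : continuous (fun p : 'rV[R]_n.+1 * R => p.1) by exact: contfst.
have cp2 : continuous (fun p : 'rV[R]_n.+1 * R => p.2) by exact: contsnd.
have cx0 : continuous (fun p : 'rV[R]_n.+1 * R => p.1 0 ord0) by exact: contcoord.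
have cF : {within D, continuous F}.
  have [_ cu _ _] := usol i.
  apply: withinD.
    apply: withinB; apply: (within_comp cu) => //.
    - by move=> [y s] [/= /box0 /rpos].
    - by apply: (contcomp cp1); exact: refl_continuous.
    - by move=> [y s] [/= /box0 /xpos].
  apply: continuous_subspaceT; apply: contD.
    apply: contM; first exact: contcst.
    apply: contD; first exact: contcst.
    by apply: contM => //; apply: contB => //; exact: contcst.
  apply: contM; first exact: contcst.
  have c2 : continuous (fun p : 'rV[R]_n.+1 * R => p.2 - t0).
    by apply: contB => //; exact: contcst.
  apply: contD; last exact: contM.
  apply: (@contcomp _ _ _ (fun p : 'rV[R]_n.+1 * R => p.1 - x0) (@sqn R n.+1));
    last exact: sqn_continuous.
  move=> p; apply: (@cvgB R 'rV[R]_n.+1); [exact: cp1|exact: cvg_cst].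
have D0 : D (x0, t0).
  split => /=; last by clear; lra.
  by move=> k; rewrite /lo /hi; case: eqP => [->//|_]; clear; lra.
have [[x s] [/= h1 h3] Hmin] := EVT_min (ex_intro _ _ D0) cD cF.
(* The value at (x0, t0) is below B / 2 while w_i + mu phi >= 0: the minimum is thus attained where
   the penalty is small, which keeps it off the lateral and time faces, and w_i is negative
   there. *)
have F0 : F (x, s) < B / 2.
  apply: le_lt_trans (Hmin _ D0) _.
  by rewrite /F/= !subrr sqn0 mulr0 addr0 mulr0 addr0 -eB.
rewrite /F/= in F0.
have Hm (x2 : 'rV[R]_n.+1) (s2 : R) : box lo hi x2 -> t0 - 1 <= s2 <= t0 + 1 ->
    w i x s + (mu * phi (x 0 ord0) + B * (sqn (x - x0) + (s - t0) * (s - t0))) <=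
    w i x2 s2 + (mu * phi (x2 0 ord0) + B * (sqn (x2 - x0) + (s2 - t0) * (s2 - t0))).
  by move=> b2 s2t; exact: (Hmin (x2, s2)).
clear Hmin cF F D0 cD cp1 cp2 cx0 D hS wM w1 x1l t1 x1 i1.
have xl := box0 _ h1; have Hx := xpos _ xl; have Hr := rpos _ xl.
have q0 := sqn_ge0 (x - x0); have s20 : 0 <= (s - t0) * (s - t0) by rewrite -expr2 sqr_ge0.
have Bq0 : 0 <= B * (sqn (x - x0) + (s - t0) * (s - t0)).
  by rewrite mulr_ge0 ?(ltW B0)// addr_ge0.
have wl := wlow i x s xl; have mphi := ler_wpM2l (ltW mu0) (phic _ xl).
have Bc : B / 2 < mu * c by rewrite -eB (mulrC ep) -mulrA ltr_pM2l.
have wneg : w i x s < 0 by clear - F0 Bq0 mphi Bc; lra.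
have xlo : 0 < x 0 ord0.
  rewrite lt_neqAle; have /andP[-> _] := xl; rewrite andbT; apply/eqP => E.
  have [_ _ _ ub] := usol i; have := ub x s (esym E); have := unn i _ s Hr.
  by move: wneg; rewrite /w /refl_diff; clear; lra.
have xhi : x 0 ord0 < l.
  rewrite lt_neqAle; have /andP[_ ->] := xl; rewrite andbT; apply/eqP => E.
  by move: wneg; rewrite /w /refl_diff /refl E subrr scale0r addr0 subrr ltxx.
have qlt : sqn (x - x0) + (s - t0) * (s - t0) < 1.
  rewrite ltNge; apply/negP => h.
  have : B * 1 <= B * (sqn (x - x0) + (s - t0) * (s - t0)) by rewrite ler_wpM2l// ltW.
  by clear - F0 wl B0; lra.
have xin k : lo k < x 0 k < hi k.
  have := @pcyl_interior R n 1 x0 x ler01; rewrite expr1n => /(_ ltac:(clear - qlt s20; lra) k).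
  rewrite /lo /hi.
  by case: eqP => [->|//]; rewrite xlo.
have st : -1 < s - t0 < 1 by clear - qlt q0; nra.
have Hh : heat_at (w i) x s (f i (state u (refl l x) s) - f i (state u x s)).
  apply: heat_atB; last exact: sol_heat.
  apply: heat_at_refl; apply: sol_heat => //.
  by rewrite /half_space/= reflE eqxx; clear - xhi l0; lra.
have := @heat_min_test R n.+1 _ x s _ (- (2 * B * (s - t0))) B
  (fun k => - (2 * B) - (k == ord0)%:R * (- (2 * mu))) Hh.
rewrite sum_delta => test.
have {test} gup : f i (state u (refl l x) s) - f i (state u x s) <=
    - (2 * B * (s - t0)) - (- (2 * B) * n.+1%:R - - (2 * mu)).
  apply: test.
    exists (s - (t0 - 1)); first by clear - st; lra.
    move=> v /andP[v0 v1]; have H := Hm x (s - v) h1 ltac:(clear - v0 v1 h3; lra).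
    by move: H; rewrite expr2; clear; lra.
  move=> k; have [dd dd0 Hdd] := box_near h1 (xin k).
  exists dd => // v /Hdd[b1 b2].
  have := Hm _ _ b1 h3; have := Hm _ _ b2 h3.
  have := congr1 (fun a => B * a) (sqn_d2 x x0 v k) => /=.
  rewrite -!(scaleNr v) !addZbasisE (eq_sym ord0 k) /phi.
  case: (k == ord0); rewrite ?mulr1n ?mulr0n ?mulr1 ?mul1r ?mulr0 ?addr0 ?mul0r ?subr0;
    clear; lra.
have [xi [Hxi1 Hxi2 Hxi3 Hxi4]] := refl_diff_linear fC1 fcoop unn uM i s Hx Hr.
pose SD := \sum_j partial_on orthant (f i) j (xi j).
(* Each w_j is replaced by its lower bound - mu phi: off the diagonal this lowers the sum since the
   coefficients are nonnegative, on the diagonal the error is at most L B / 2 as w_i is within B / 2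
   of that bound. *)
have glow : - (mu * phi (x 0 ord0)) * SD - L * (B / 2) <=
    f i (state u (refl l x) s) - f i (state u x s).
  rewrite Hxi4 /SD mulr_sumr (bigD1 i)//= [leRHS](bigD1 i)//=.
  rewrite addrAC; apply: lerD.
    have h : `|partial_on orthant (f i) i (xi i)| <= L by exact: HL.
    have wB : w i x s + mu * phi (x 0 ord0) <= B / 2 by clear - F0 Bq0; lra.
    have := ler_wpM2l L0 wB.
    have hn : - (L * (w i x s + mu * phi (x 0 ord0))) <=
      partial_on orthant (f i) i (xi i) * (w i x s + mu * phi (x 0 ord0)).
      rewrite -mulNr ler_wpM2r//; move: h; rewrite ler_norml => /andP[] //.
    by rewrite -/w; move: hn; clear; lra.
  apply: ler_sum => j ji; rewrite mulrC -subr_ge0 -mulrBr.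
  have := wlow j x s xl; rewrite /w => wj.
  by rewrite mulr_ge0 ?Hxi3 1?eq_sym//; clear - wj; lra.
have key : 1 <= phi (x 0 ord0) * SD.
  have : mu * (phi (x 0 ord0) * SD) >= mu * 1.
    have hB : B * (L / 2 + 2 + 2 * n.+1%:R) <= mu.
      have E : B = 2 * (mu * (ep * Phi)) by rewrite /B; ring.
      have : ep * Phi * (L + 4 + 4 * n.+1%:R) <= 1.
        apply: (@le_trans _ _ (ep * Phi * G)); last by rewrite epG; clear - c1; lra.
        by rewrite ler_wpM2l ?(ltW epPhi0)// /G; clear; lra.
      by move=> /(ler_wpM2l (ltW mu0)); rewrite E; clear; lra.
    have : - (2 * B * (s - t0)) <= 2 * B by clear - st B0; nra.
    by move: glow gup hB; clear; lra.
  by rewrite ler_pM2l.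
have phix := phi0 _ xl.
have SDK : SD <= K.
  apply: (@le_trans _ _ (\sum_(j < m) L)).
    by apply: ler_sum => j _; apply: le_trans (ler_norm _) _; exact: HL.
  by rewrite sumr_const card_ord -[_ *+ _]mulr_natl /K lerDl.
have phiK : 1 <= phi (x 0 ord0) * K.
  by apply: le_trans key _; rewrite ler_wpM2l// ltW.
have xc : c <= x 0 ord0 * (l - x 0 ord0).
  by rewrite -(ler_pM2r K0); move: phiK cK; rewrite /phi; clear; lra.
exists i, x, s; split => //.
  apply/andP; split.
    rewrite ler_pdivrMr//; apply: le_trans xc _; rewrite ler_wpM2l ?(ltW xlo)//; clear - lLam xlo; lra.
  rewrite lerBrDr addrC -lerBrDr ler_pdivrMr//; apply: le_trans xc _.
  by rewrite mulrC ler_wpM2l//; clear - lLam xlo xhi; lra.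
rewrite leNgt; apply/negP => small.
have comp y k : (y = x \/ y = refl l x) -> 0 <= state u y s 0 k < eps.
  move=> yx; have Hy : closed_half_space y by case: yx => ->.
  rewrite mxE unn//=; apply: le_lt_trans small.
  rewrite (bigD1 k)//=; have h1' := unn k _ s Hx; have h2' := unn k _ s Hr.
  have h3' : 0 <= \sum_(j < m | j != k) (u j x s + u j (refl l x) s).
    by apply: sumr_ge0 => j _; apply: addr_ge0; exact: unn.
  by case: yx => ->; move: h1' h2' h3'; clear; lra.
have SDs : SD <= m%:R * e1.
  apply: (@le_trans _ _ (\sum_j (partial_on orthant (f i) j 0 + e1))).
    apply: ler_sum => j _; rewrite -lerBlDl; apply: le_trans (ler_norm _) _; apply: Hd => k.
    have /andP[g1 g2] := Hxi1 j k.
    have /andP[a0 a1] := comp x k (or_introl erefl).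
    have /andP[b0 b1] := comp (refl l x) k (or_intror erefl).
    apply/andP; split; first by apply: le_trans g1; rewrite le_min a0.
    by apply: le_lt_trans g2 _; rewrite gt_max !(lt_le_trans _ (Heps i)).
  by rewrite big_split/= sumr_const card_ord -[_ *+ _]mulr_natl; have := fsum i; clear; lra.
have : phi (x 0 ord0) * SD <= 1 / 2.
  apply: (@le_trans _ _ (phi (x 0 ord0) * (m%:R * e1))); first by rewrite ler_wpM2l// ltW.
  apply: (@le_trans _ _ (Phi * (m.+1%:R * e1))).
    apply: ler_pM; rewrite ?(ltW phix) ?phiPhi ?mulr_ge0 ?(ltW e10)//.
    by rewrite ler_wpM2r ?(ltW e10)// ler_nat.
  by rewrite /e1 le_eqVlt; apply/orP; left; apply/eqP; field; rewrite !gt_eqF.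
by move: key; clear; lra.
Qed.

Lemma bump_ge0_coord (R : realType) (n : nat) (r d : R) (y x : 'rV[R]_n.+1) (s : R) j :
  0 <= r -> 0 <= bump r d y x s -> `|x 0 j - (y 0 j + s * d * (j == ord0)%:R)| <= r.
Proof.
move=> r0; rewrite /bump subr_ge0 => /(sqn_coord_le j r0).
by rewrite mxE mxE addZbasisE.
Qed.

(** * Strict inequalities from weak ones *)

Section strict_positivity.
Context {R : realType} {n m : nat}.
Variables (f : 'I_m -> 'rV[R]_m -> R) (u : 'I_m -> 'rV[R]_n.+1 -> R -> R) (M : R).
Hypothesis fC1 : forall i, C1_on orthant (f i).
Hypothesis f0 : forall i, f i 0 = 0.
Hypothesis fcoop : forall (i j : 'I_m) (a : 'rV[R]_m), i != j -> orthant a ->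
  0 <= partial_on orthant (f i) j a.
Hypothesis usol : solution f u.
Hypothesis unn : nonnegative u.
Hypothesis M0 : 0 <= M.
Hypothesis uM : forall i x t, closed_half_space x -> `|u i x t| <= M.
Hypothesis upos : forall i x t, half_space x -> 0 < u i x t.

Lemma cooperative_lower : exists2 L : R, 0 <= L & forall i (a b : 'rV[R]_m),
  (forall k, 0 <= a 0 k <= M) -> (forall k, 0 <= b 0 k <= M) ->
  (forall k, a 0 k <= b 0 k) -> - L * (b 0 i - a 0 i) <= f i b - f i a.
Proof.
have [L L0 HL] := partials_bounded fC1 M0; exists L => // i a b Ha Hb ab.
have oa : orthant a by move=> k; have /andP[] := Ha k.
have ob : orthant b by move=> k; have /andP[] := Hb k.
have [xi [H1 ->]] := orthant_mean_value (fC1 i) oa ob.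
have H3 j k : 0 <= xi j 0 k <= M by exact: between_range Ha Hb (H1 j) k.
rewrite (bigD1 i)//= ler_wpDr//.
  apply: sumr_ge0 => j ji; rewrite mulr_ge0 ?subr_ge0// fcoop 1?eq_sym// => k.
  by have /andP[] := H3 j k.
rewrite ler_wpM2r ?subr_ge0//.
by have := HL i i _ (H3 i); rewrite ler_norml => /andP[].
Qed.

(** At the foot of x on the boundary u vanishes while its reflected value is positive. So at time t
    - 1 the difference is bounded below on a small ball near the foot, and a ball moving up to x
    inside the strip carries positivity to time t. *)
Lemma reflection_strict l i (x : 'rV[R]_n.+1) t : reflection_ordered u l ->
  0 < x 0 ord0 < l -> 0 < refl_diff u l i x t.
Proof.
move=> ord /andP[x0 xl]; have l0 : 0 < l := lt_trans x0 xl.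
have [L L0 HL] := cooperative_lower.
pose y0 := x - x 0 ord0 *: basis_vec ord0.
have y0E : y0 0 ord0 = 0 by rewrite /y0 -scaleNr addZbasisE eqxx mulr1 subrr.
pose P := u i (refl l y0) (t - 1).
have P0 : 0 < P by apply: upos; rewrite /half_space/= reflE eqxx y0E; lra.
have [C C0 HC] := boundary_bound fC1 f0 usol unn M0 uM.
have [del del0 Hdel] := unif_cont_u fC1 f0 usol unn M0 uM i
  (divr_gt0 l0 (ltr0Sn _ 1)) (divr_gt0 P0 (ltr0Sn _ 3)).
have C1 : 0 < C + 1 by rewrite ltr_wpDl.
pose b := P / (4 * (C + 1)); have b0 : 0 < b by rewrite divr_gt0// mulr_gt0.
have bC : C * b <= P / 4.
  have -> : P / 4 = (C + 1) * b by rewrite /b; field; rewrite gt_eqF.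
  by rewrite ler_wpM2r ?(ltW b0)// lerDl.
(* The radius is q / 4. The bounds x_1 and l - x_1 keep the moving ball in the strip, [b] makes u at
   most P / 4 on the initial ball, and [del] keeps the reflected values above 3 P / 4. *)
pose q := Num.min (Num.min (x 0 ord0) (l - x 0 ord0)) (Num.min b del).
have q0 : 0 < q by rewrite !lt_min x0 subr_gt0 xl b0.
have [[qx qlx] [qb qd]] : (q <= x 0 ord0 /\ q <= l - x 0 ord0) /\ (q <= b /\ q <= del).
  by rewrite /q !ge_min !lexx /= !orbT.
pose r := q / 4; have r0 : 0 < r by rewrite divr_gt0.
pose d := x 0 ord0 - 2 * r; have d0 : 0 <= d by rewrite /d /r; lra.
pose y := y0 + (2 * r) *: basis_vec ord0.
have Ey : y + d *: basis_vec ord0 = x.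
  by rewrite /y -addrA -scalerDl /d addrCA subrr addr0 subrK.
have yE j : y 0 j = y0 0 j + 2 * r * (j == ord0)%:R by rewrite addZbasisE.
have [c c0 H] := positivity_spreads n d r0 L0.
have strip (z : 'rV[R]_n.+1) : 0 < z 0 ord0 < l ->
    [/\ half_space z, closed_half_space z & half_space (refl l z)].
  by move=> /andP[z0 zl]; split; [|left|rewrite /half_space/= reflE eqxx; lra].
pose D := [set z : 'rV[R]_n.+1 | 0 < z 0 ord0 < l].
have cw : continuous_on D (refl_diff u l i).
  have [_ cu _ _] := usol i; rewrite /continuous_on /refl_diff.
  apply: withinB; apply: (within_comp cu).
  - by move=> [z s] [/= /strip[_ _ h] _]; left.
  - by apply: (contcomp (@contfst _ _)); exact: refl_continuous.
  - exact: contsnd.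
  - by move=> [z s] [/= /strip[]].
  - exact: contfst.
  - exact: contsnd.
have := H D _ y (t - 1) (P / 2) cw ltac:(lra); rewrite Ey subrK.
move=> {}H; apply: lt_le_trans (H _ _); first by rewrite mulr_gt0// divr_gt0.
  move=> z s /andP[s0 s1] zb.
  have := bump_ge0_coord ord0 (ltW r0) zb.
  rewrite eqxx mulr1 yE y0E eqxx mulr1 add0r ler_norml => hz.
  have sd : 0 <= s * d <= d by rewrite mulr_ge0//= ler_piMl.
  have zD : D z by rewrite /D/=; move: hz sd qlx; rewrite /d /r; clear - q0; lra.
  have [Hz Hz' Hr] := strip z zD.
  have ordz k : u k z (t - 1 + s) <= u k (refl l z) (t - 1 + s).
    by apply: ord; case/andP: zD => /ltW-> /ltW->.
  split=> //; first by rewrite subr_ge0.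
  exists (f i (state u (refl l z) (t - 1 + s)) - f i (state u z (t - 1 + s))).
    have := HL i (state u z (t - 1 + s)) (state u (refl l z) (t - 1 + s)).
    rewrite !mxE; apply => k; rewrite ?(state_range unn uM)//; first by left.
    by rewrite !mxE.
  by apply: heat_atB; [apply: heat_at_refl|]; exact: sol_heat.
move=> z zb.
have hz j := bump_ge0_coord j (ltW r0) zb.
have z0 : r <= z 0 ord0 <= 3 * r.
  by have := hz ord0; rewrite yE y0E eqxx !mulr1 ler_norml; lra.
have zl : z 0 ord0 <= l by move: z0; rewrite /r; lra.
have hw j : `|refl l z 0 j - refl l y0 0 j| < del.
  have := hz j; rewrite yE mul0r mul0r addr0 !reflE; case: eqP => [->|_].
    by rewrite y0E mulr1 ler_norml ltr_norml /r; move: q0 qd; clear; lra.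
  by rewrite mulr0 addr0 => /le_lt_trans; apply; rewrite /r; move: q0 qd; clear; lra.
have hr (v : 'rV[R]_n.+1) : v 0 ord0 <= l -> l / 2 < refl l v 0 ord0.
  by rewrite reflE eqxx; lra.
have := Hdel (refl l y0) (refl l z) (t - 1) (t - 1) (hr _ _) (hr _ zl) hw.
rewrite y0E subrr normr0 => /(_ (ltW l0) del0).
have Hz : closed_half_space z by apply/closedP; lra.
have uz := HC i z (t - 1) Hz.
have zb' : C * z 0 ord0 <= C * b by rewrite ler_wpM2l//; move: z0; rewrite /r; clear - qb q0; lra.
by move: uz zb' bC; rewrite -/P /refl_diff !ler_norml; clear; lra.
Qed.

End strict_positivity.

(** Ordered reflections make the increments u(x + h e_1) - u(x) nonnegative supersolutions. Since
    u(x, t - 1) > 0 and u is small near the boundary, some p below x has a positive derivative at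
    time t - 1; around p the increment is at least kap h. Spreading gives c kap h at (x, t) with c
    independent of h, so division by h keeps strictness. *)
Lemma dx_strict (R : realType) (n m : nat) (f : 'I_m -> 'rV[R]_m -> R)
    (u : 'I_m -> 'rV[R]_n.+1 -> R -> R) (M : R)
    (fC1 : forall i, C1_on orthant (f i)) (f0 : forall i, f i 0 = 0)
    (fcoop : forall (i j : 'I_m) (a : 'rV[R]_m), i != j -> orthant a ->
      0 <= partial_on orthant (f i) j a)
    (usol : solution f u) (unn : nonnegative u) (M0 : 0 <= M)
    (uM : forall i x t, closed_half_space x -> `|u i x t| <= M)
    (upos : forall i x t, half_space x -> 0 < u i x t) :
  (forall l, 0 < l -> reflection_ordered u l) ->
  forall i (x : 'rV[R]_n.+1) t, half_space x -> 0 < dx ord0 (u i) x t.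
Proof.
move=> ord i x t x0; have {}x0 : 0 < x 0 ord0 by [].
have incr k (z : 'rV[R]_n.+1) s h : 0 < z 0 ord0 -> 0 <= h ->
    u k z s <= u k (z + h *: basis_vec ord0) s.
  move=> z0 h0; have l0 : 0 < z 0 ord0 + h / 2 by lra.
  have := ord _ l0 k z s ltac:(lra); rewrite /refl.
  by have -> : 2 * (z 0 ord0 + h / 2) - 2 * z 0 ord0 = h by field.
have [L L0 HL] := cooperative_lower fC1 fcoop M0.
pose y0 := x - x 0 ord0 *: basis_vec ord0.
have y0E : y0 0 ord0 = 0 by rewrite /y0 -scaleNr addZbasisE eqxx mulr1 subrr.
have P0 : 0 < u i x (t - 1) by exact: upos.
have [C C0 HC] := boundary_bound fC1 f0 usol unn M0 uM.
have C1 : 0 < C + 1 by rewrite ltr_wpDl.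
(* At height a the linear boundary bound gives a value at most C a < (C + 1) a <= u(x, t - 1), so u
   increases strictly between the two heights. *)
pose a := Num.min (x 0 ord0 / 2) (u i x (t - 1) / (C + 1)).
have a0 : 0 < a by rewrite lt_min !divr_gt0.
have [ax aP] : a <= x 0 ord0 / 2 /\ a * (C + 1) <= u i x (t - 1).
  by rewrite -ler_pdivlMr// /a !ge_min !lexx orbT.
have xa0 : 0 < x 0 ord0 - a by lra.
pose za := y0 + a *: basis_vec ord0.
have zaE : za 0 ord0 = a by rewrite /za addZbasisE y0E eqxx mulr1 add0r.
have zaC : u i za (t - 1) < u i x (t - 1).
  have : closed_half_space za by apply/closedP; rewrite zaE ltW.
  by move=> /(HC i _ (t - 1)); rewrite zaE; lra.
have za0 : 0 < za 0 ord0 by rewrite zaE.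
have [e /andP[e0 ea]] := MVT_dir (t - 1) (sol_d1x usol i ord0) za0 xa0.
have -> : za + (x 0 ord0 - a) *: basis_vec ord0 = x.
  by rewrite /za -addrA -scalerDl addrCA subrr addr0 subrK.
set p := za + e *: basis_vec ord0 => E.
have pE : p 0 ord0 = a + e by rewrite /p addZbasisE zaE eqxx mulr1.
have dp : 0 < dx ord0 (u i) p (t - 1).
  by rewrite -(pmulr_lgt0 _ xa0) -E subr_gt0.
pose kap := dx ord0 (u i) p (t - 1) / 2; have kap0 : 0 < kap by rewrite divr_gt0.
have p0 : 0 < p 0 ord0 by rewrite pE addr_gt0.
have [del del0 Hdel] := unif_cont_grad fC1 f0 usol unn M0 uM i ord0
  (divr_gt0 p0 (ltr0Sn _ 1)) kap0.
pose r := Num.min (p 0 ord0 / 4) (del / 4).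
have r0 : 0 < r by rewrite lt_min !divr_gt0.
have [rp rd] : r <= p 0 ord0 / 4 /\ r <= del / 4 by rewrite /r !ge_min !lexx orbT.
(* As p lies below x, d >= 0: the ball only rises and never approaches the boundary. *)
pose d := x 0 ord0 - p 0 ord0; have d0 : 0 <= d by rewrite /d pE; lra.
have Ep : p + d *: basis_vec ord0 = x.
  rewrite /d pE /p /za -!addrA -!scalerDl.
  have -> : a + (e + (x 0 ord0 - (a + e))) = x 0 ord0 by ring.
  by rewrite addNr addr0.
clearbody p.
have [c c0 H] := positivity_spreads n d r0 L0.
have quot h : 0 < h -> h < r ->
    c * (kap * h) <= u i (x + h *: basis_vec ord0) t - u i x t.
  move=> h0 hr; pose w (z : 'rV[R]_n.+1) s := u i (z + h *: basis_vec ord0) s - u i z s.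
  have shE (z : 'rV[R]_n.+1) : (z + h *: basis_vec ord0) 0 ord0 = z 0 ord0 + h.
    by rewrite addZbasisE eqxx mulr1.
  have shp (z : 'rV[R]_n.+1) : half_space z -> half_space (z + h *: basis_vec ord0).
    by rewrite /half_space/= shE => ?; rewrite addr_gt0.
  have cw : continuous_on half_space w.
    have [_ cu _ _] := usol i; rewrite /continuous_on /w.
    apply: withinB; apply: (within_comp cu).
    - by move=> [z s] [/= /shp h' _]; left.
    - by apply: (@addZ_continuous _ _ _ _ (fun=> h)); [exact: contfst|exact: contcst].
    - exact: contsnd.
    - by move=> [z s] [/= h' _]; left.
    - exact: contfst.
    - exact: contsnd.
  have := H half_space w p (t - 1) (kap * h) cw (mulr_ge0 (ltW kap0) (ltW h0)).
  rewrite Ep subrK; apply.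
    move=> z s /andP[s0 s1] zb.
    have := bump_ge0_coord ord0 (ltW r0) zb; rewrite eqxx mulr1 ler_norml => hz.
    have sd : 0 <= s * d by rewrite mulr_ge0.
    have Hz : half_space z by rewrite /half_space/=; clear - hz sd rp p0; lra.
    have inc k : u k z (t - 1 + s) <= u k (z + h *: basis_vec ord0) (t - 1 + s).
      by apply: incr => //; exact: ltW.
    split=> //; first by rewrite subr_ge0.
    exists (f i (state u (z + h *: basis_vec ord0) (t - 1 + s)) - f i (state u z (t - 1 + s))).
      have := HL i (state u z (t - 1 + s)) (state u (z + h *: basis_vec ord0) (t - 1 + s)).
      rewrite !mxE; apply => k; rewrite ?(state_range unn uM)//; try by left => //; exact: shp.
      by rewrite !mxE.
    apply: heat_atB; last exact: sol_heat.
    by apply: (@heat_at_shiftx _ _ (u i)); apply: sol_heat => //; exact: shp.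
  move=> z zb; have hz j := bump_ge0_coord j (ltW r0) zb.
  have hz0 : `|z 0 ord0 - p 0 ord0| <= r by have := hz ord0; rewrite !mul0r addr0.
  have z0 : 0 < z 0 ord0 by move: hz0; rewrite ler_norml; clear - rp p0; lra.
  rewrite /w; have [e' /andP[e'0 e'h] ->] := MVT_dir (t - 1) (sol_d1x usol i ord0) z0 h0.
  rewrite ler_wpM2r ?(ltW h0)//.
  have ze : (z + e' *: basis_vec ord0) 0 ord0 = z 0 ord0 + e' by rewrite addZbasisE eqxx mulr1.
  have ph : p 0 ord0 / 2 < p 0 ord0 by clear - p0; lra.
  have zh : p 0 ord0 / 2 < (z + e' *: basis_vec ord0) 0 ord0.
    by rewrite ze; move: hz0; rewrite ler_norml; clear - rp p0 e'0; lra.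
  have := Hdel p (z + e' *: basis_vec ord0) (t - 1) (t - 1) ph zh.
  rewrite subrr normr0 => Hd.
  suff hj j : `|(z + e' *: basis_vec ord0) 0 j - p 0 j| < del.
    by have := Hd hj del0; rewrite ler_norml /kap => /andP[hd _]; clear - hd; lra.
  have := hz j; rewrite !mul0r addr0 addZbasisE.
  by case: (j == ord0); rewrite ?mulr1 ?mulr0 ler_norml ltr_norml; clear - e'0 e'h hr rd r0; lra.
have ck : 0 < c * kap by rewrite mulr_gt0.
apply: lt_le_trans ck _; rewrite -lerN2.
apply: (@has_d1_le R (fun s => u i (x - s *: basis_vec ord0) t) _ _ 0).
  by apply: has_d1_ext (has_d1_oppl (sol_d1x usol i ord0 t x0)) => s; rewrite scaleNr.
exists r => // s /andP[s0 sr]; have := quot s s0 sr.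
by rewrite scale0r subr0 scaleNr opprK mul0r addr0; clear; lra.
Qed.

(** * Continuation in the position of the plane *)

Section all_reflections.
Context {R : realType} {n m : nat}.
Variables (f : 'I_m -> 'rV[R]_m -> R) (u : 'I_m -> 'rV[R]_n.+1 -> R -> R) (M : R).
Hypothesis fC1 : forall i, C1_on orthant (f i).
Hypothesis f0 : forall i, f i 0 = 0.
Hypothesis fcoop : forall (i j : 'I_m) (a : 'rV[R]_m), i != j -> orthant a ->
  0 <= partial_on orthant (f i) j a.
Hypothesis fsum : forall i : 'I_m, \sum_(j < m) partial_on orthant (f i) j 0 <= 0.
Hypothesis fpos : forall v : 'I_m -> 'rV[R]_n.+1 -> R -> R,
  solution f v -> nontrivial v -> nonnegative v -> bounded_sol v ->
  forall i x t, half_space x -> 0 < v i x t.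
Hypothesis usol : solution f u.
Hypothesis unn : nonnegative u.
Hypothesis M0 : 0 <= M.
Hypothesis uM : forall i x t, closed_half_space x -> `|u i x t| <= M.

(** Points of failure split into a height and a tangential part. Only the latter can be translated
    away without moving the boundary; the heights converge separately, and the modulus common to all
    translates joins the two limits. *)
Lemma limit_sol_cvg_moving (U : set_system nat) (X : nat -> 'rV[R]_n.+1) (T y : nat -> R)
    (c : R) i : UltraFilter U -> (forall k, X k 0 ord0 = 0) -> 0 < c -> y @ U --> c ->
  (fun k => u i (y k *: basis_vec ord0 + X k) (T k)) @ U -->
    limit_sol u U X T i (c *: basis_vec ord0) 0.
Proof.
move=> UU X0 c0 yc; have PU : ProperFilter U by exact: ultra_proper.
have cE : (c *: basis_vec ord0 : 'rV[R]_n.+1) 0 ord0 = c.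
  by rewrite -[c *: _]add0r addZbasisE eqxx mulr1 mxE add0r.
have cc : closed_half_space (c *: basis_vec ord0 : 'rV[R]_n.+1).
  by apply/closedP; rewrite cE ltW.
have lc := limit_sol_cvg uM UU X0 (i := i) (t := 0) (T := T) cc.
apply/cvgrPdist_le => e e0; have e20 : 0 < e / 2 by rewrite divr_gt0.
have c20 : 0 < c / 2 by rewrite divr_gt0.
have [d d0 Hd] := unif_cont_u fC1 f0 usol unn M0 uM i c20 e20.
have q0 : 0 < Num.min d (c / 2) by rewrite lt_min d0.
have /cvgrPdist_le/(_ _ e20) n1 := lc; have /cvgrPdist_lt/(_ _ q0) n2 := yc.
apply: filterS2 n1 n2 => k /=; rewrite add0r lt_min => h1 /andP[h2 h3].
have yE (b : R) : (b *: basis_vec ord0 + X k) 0 ord0 = b.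
  by rewrite addrC addZbasisE X0 eqxx mulr1 add0r.
have := Hd (c *: basis_vec ord0 + X k) (y k *: basis_vec ord0 + X k) (T k) (T k).
rewrite !yE subrr normr0 => /(_ ltac:(lra)).
move=> /(_ ltac:(move: h3; rewrite ltr_norml; lra)) Hk.
suff hj j : `|(y k *: basis_vec ord0 + X k) 0 j - (c *: basis_vec ord0 + X k) 0 j| < d.
  by have := Hk hj d0; move: h1; rewrite !ler_norml; lra.
rewrite ![_ + X k]addrC !addZbasisE opprD addrACA subrr add0r -mulrBl distrC in h2 *.
by case: (j == ord0); rewrite ?mulr1 ?mulr0 ?normr0// distrC.
Qed.

(** If x_1 < l and q <= l - x_1, the plane at l - q still has x on its lower side, and the two
    reflections of x differ by 2 q only. *)
Lemma reflection_ordered_limit l : 0 < l ->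
  (forall mu, 0 < mu < l -> reflection_ordered u mu) -> reflection_ordered u l.
Proof.
move=> l0 H i x t /andP[x0]; rewrite le_eqVlt => /predU1P[xl|xl].
  by rewrite /refl xl subrr scale0r addr0.
apply/ler_addgt0Pr => e e0; have l20 : 0 < l / 2 by rewrite divr_gt0.
have [d d0 Hd] := unif_cont_u fC1 f0 usol unn M0 uM i l20 e0.
pose q := Num.min (d / 4) (Num.min (l / 4) (l - x 0 ord0)).
have q0 : 0 < q by rewrite !lt_min !divr_gt0// subr_gt0.
have [qd [ql qx]] : q <= d / 4 /\ q <= l / 4 /\ q <= l - x 0 ord0.
  by rewrite /q !ge_min !lexx /= !orbT.
have Hmu : u i x t <= u i (refl (l - q) x) t by apply: H; lra.
apply: le_trans Hmu _.
have := Hd (refl l x) (refl (l - q) x) t t; rewrite subrr normr0.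
rewrite !reflE eqxx => /(_ ltac:(lra) ltac:(lra)) Hk.
suff hj j : `|refl (l - q) x 0 j - refl l x 0 j| < d.
  by have := Hk hj d0; rewrite ler_norml; lra.
by rewrite !reflE; case: (j == ord0); rewrite ?subrr ?normr0// ltr_norml; lra.
Qed.

Lemma reflection_ordered_all l : 0 < l -> reflection_ordered u l.
Proof.
pose Bad := [set l : R | 0 < l /\ ~ reflection_ordered u l].
move=> l0; apply: contrapT => nord.
have Bad_lb : has_lbound Bad by exists 0 => b [/ltW].
have Bad_inf : has_inf Bad by split => //; exists l.
pose ls := inf Bad.
(* A failure at l <= 1 requires del1 <= x_1 <= l - del1, so bad positions cannot accumulate at 0. *)
have [del1 del10 [eps1 _ H1]] := reflection_failure fC1 fcoop fsum usol unn M0 uM ltr01.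
have ls0 : 0 < ls.
  apply: (@lt_le_trans _ _ (Num.min 1 del1)); first by rewrite lt_min ltr01.
  apply: lb_le_inf; first by exists l.
  move=> b [b0 nb]; rewrite ge_min; have [//|b1] := leP 1 b.
  have [|i [x [t [/andP[h1 h2] _ _]]]] := H1 b _ nb; first by rewrite b0 ltW.
  by rewrite orbC; apply/orP; left; lra.
have ord_below mu : 0 < mu < ls -> reflection_ordered u mu.
  move=> /andP[mu0 muls]; apply: contrapT => nmu.
  have : ls <= mu by exact: ge_inf.
  by rewrite leNgt muls.
have ordls := reflection_ordered_limit ls0 ord_below.
have Lam0 : 0 < ls + 1 by rewrite addr_gt0.
have [del del0 [eps eps0 H2]] := reflection_failure fC1 fcoop fsum usol unn M0 uM Lam0.
(* Bad planes within 1 / (k + 1) above [ls]. As this gap is at most 1, they stay below ls + 1, where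
   [del] and [eps] are uniform. *)
have /choice[F HF] (k : nat) : exists q : (R * 'I_m) * ('rV[R]_n.+1 * R),
    [/\ ls <= q.1.1 <= ls + k.+1%:R^-1, del <= q.2.1 0 ord0 <= q.1.1 - del,
      refl_diff u q.1.1 q.1.2 q.2.1 q.2.2 < 0 &
      eps <= \sum_j (u j q.2.1 q.2.2 + u j (refl q.1.1 q.2.1) q.2.2)].
  have k0 : 0 < k.+1%:R^-1 :> R by rewrite invr_gt0.
  have k1 : k.+1%:R^-1 <= 1 :> R by rewrite invf_le1// ler1n.
  have [b [b0 nb] bk] := inf_adherent k0 Bad_inf.
  have lb : ls <= b by apply: ge_inf.
  have [|i [x [t [h1 h2 h3]]]] := H2 b _ nb.
    by rewrite b0/=; apply: le_trans (ltW bk) _; rewrite lerD2l.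
  by exists ((b, i), (x, t)); split => //=; rewrite lb ltW.
pose lk k := (F k).1.1; pose ik k := (F k).1.2; pose T k := (F k).2.2.
pose a k := (F k).2.1 0 ord0.
pose X k := (F k).2.1 - a k *: basis_vec ord0.
have X0 k : X k 0 ord0 = 0 by rewrite /X -scaleNr addZbasisE eqxx mulr1 subrr.
have xE k : (F k).2.1 = a k *: basis_vec ord0 + X k by rewrite addrC subrK.
have rE k : refl (lk k) (F k).2.1 = (2 * lk k - a k) *: basis_vec ord0 + X k.
  rewrite /refl -/(a k) {1}xE addrAC -scalerDl; congr (_ *: _ + _); ring.
have lkb k : ls <= lk k <= ls + k.+1%:R^-1 by case: (HF k).
have ab k : del <= a k <= lk k - del by case: (HF k).
have k1 k : k.+1%:R^-1 <= 1 :> R by rewrite invf_le1// ler1n.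
have [U [UU Uoo]] := ultraFilterLemma eventually_filter.
have PU : ProperFilter U by exact: ultra_proper.
have lkc : lk @ U --> ls.
  apply/cvgrPdist_lt => e e0; apply: Uoo; near=> k.
  have := lkb k; have : k.+1%:R^-1 < e by near: k; exact: (near_infty_natSinv_lt (PosNum e0)).
  by rewrite ltr_norml; move: (_^-1) => z; lra.
have /cvg_ex[/= ai ac] : cvg (a @ U).
  apply: (@ultra_cvg_bounded _ U a (ls + 1)) => // k.
  by have := lkb k; have := ab k; have := k1 k; rewrite ler_norml; move: (_^-1) => z; lra.
have ai_ge : del <= ai by apply: (cvg_all_ge PU ac) => k; case/andP: (ab k).
have ai_le : ai <= ls - del.
  apply: (ler_cvg_to ac (cvgB lkc (cvg_cst del))); apply: (@filterE _ U) => k /=.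
  by case/andP: (ab k).
have rc : (fun k => 2 * lk k - a k) @ U --> 2 * ls - ai.
  by apply: cvgB => //; apply: cvgM => //; exact: cvg_cst.
have ai0 : 0 < ai by lra.
have ri0 : 0 < 2 * ls - ai by lra.
pose v := limit_sol u U X T.
have uc j := limit_sol_cvg_moving (T := T) (i := j) UU X0 ai0 ac.
have urc j := limit_sol_cvg_moving (T := T) (i := j) UU X0 ri0 rc.
rewrite -/v in uc urc.
have vsol : solution f v := limit_solution fC1 f0 usol unn M0 uM T UU X0.
have vnn : nonnegative v := limit_sol_ge0 unn uM T UU X0.
have vM : forall i x t, closed_half_space x -> `|v i x t| <= M := limit_sol_le unn uM T UU X0.
have eE (b : R) : (b *: basis_vec ord0 : 'rV[R]_n.+1) 0 ord0 = b.
  by rewrite -[b *: _]add0r addZbasisE eqxx mulr1 mxE add0r.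
have Hc (b : R) : 0 < b -> closed_half_space (b *: basis_vec ord0 : 'rV[R]_n.+1).
  by move=> b0; apply/closedP; rewrite eE ltW.
(* The lower bound [eps] for the sum of the values at the failure points and their reflections is
   kept in the limit. *)
have vnt : nontrivial v.
  apply: contrapT => N.
  have z i x t : closed_half_space x -> v i x t = 0.
    by move=> Hx; apply: contrapT => nz; apply: N; exists i, x, t.
  have : eps <= \sum_j (v j (ai *: basis_vec ord0) 0 + v j ((2 * ls - ai) *: basis_vec ord0) 0).
    have sc : (fun k => \sum_j (u j (a k *: basis_vec ord0 + X k) (T k) +
        u j ((2 * lk k - a k) *: basis_vec ord0 + X k) (T k))) @ U -->
        \sum_j (v j (ai *: basis_vec ord0) 0 + v j ((2 * ls - ai) *: basis_vec ord0) 0).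
      elim: (index_enum _) => [|j s IH].
        under eq_fun do rewrite big_nil; rewrite big_nil; exact: cvg_cst.
      under eq_fun do rewrite big_cons; rewrite big_cons; apply: cvgD => //.
      exact: cvgD.
    apply: (cvg_all_ge PU sc) => k; have [_ _ _] := HF k.
    by rewrite -/(lk k) rE -xE.
  by rewrite big1 ?leNgt ?eps0// => j _; rewrite !z ?addr0//; exact: Hc.
have vpos := fpos vsol vnt vnn (ex_intro _ M vM).
have vord : reflection_ordered v ls.
  move=> i x t xl; have Hx : closed_half_space x by apply/closedP; case/andP: xl.
  have Hr : closed_half_space (refl ls x) by apply/closedP; rewrite reflE eqxx; lra.
  apply: (ler_cvg_to (limit_sol_cvg uM UU X0 Hx) (limit_sol_cvg uM UU X0 Hr)).
  apply: (@filterE _ U) => k /=.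
  have -> : refl ls x + X k = refl ls (x + X k).
    by rewrite /refl (translate0 X0) addrAC.
  by apply: ordls; rewrite (translate0 X0).
have wpos j : 0 < refl_diff v ls j (ai *: basis_vec ord0) 0.
  apply: (reflection_strict fC1 f0 fcoop vsol vnn M0 vM vpos) => //.
  by rewrite eE ai0/=; lra.
have vrE : refl ls (ai *: basis_vec ord0 : 'rV[R]_n.+1) = (2 * ls - ai) *: basis_vec ord0.
  by rewrite /refl eE -scalerDl; congr (_ *: _); ring.
(* The failing index varies with k. Instead of extracting a constant one, positivity is shown along
   [U] for every index, and finitely many members of [U] are intersected. *)
have near_pos j : \forall k \near U, 0 < refl_diff u (lk k) j (F k).2.1 (T k).
  have dc : (fun k => refl_diff u (lk k) j (F k).2.1 (T k)) @ U -->
      refl_diff v ls j (ai *: basis_vec ord0) 0.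
    rewrite (_ : (fun k => _) = fun k => u j ((2 * lk k - a k) *: basis_vec ord0 + X k) (T k) -
        u j (a k *: basis_vec ord0 + X k) (T k)).
      by rewrite /refl_diff vrE; exact: cvgB.
    by apply/funext => k; rewrite /refl_diff rE -xE.
  have /cvgrPdist_lt H := dc; have := H _ (wpos j).
  by apply: filterS => k /=; rewrite ltr_norml; lra.
have FU : Filter U by exact: PU.
have [k Hk] := filter_ex (filter_forall FU near_pos).
have [_ _ + _] := HF k.
by have := Hk (ik k); rewrite /ik /lk /T; lra.
Unshelve. all: by end_near. Qed.

End all_reflections.

Theorem theorem2p3 (R : realType) (n m : nat) (hm : (2 <= m)%N)
    (f : 'I_m -> 'rV[R]_m -> R)
    (fC1 : forall i : 'I_m, C1_on orthant (f i))
    (f0 : forall i : 'I_m, f i 0 = 0)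
    (fcoop : forall (i j : 'I_m) (a : 'rV[R]_m), i != j -> orthant a ->
       0 <= partial_on orthant (f i) j a)
    (fsum : forall i : 'I_m,
       \sum_(j < m) partial_on orthant (f i) j 0 <= 0)
    (fpos : forall v : 'I_m -> 'rV[R]_n.+1 -> R -> R,
       solution f v -> nontrivial v -> nonnegative v -> bounded_sol v ->
       forall (i : 'I_m) (x : 'rV[R]_n.+1) (t : R),
         half_space x -> 0 < v i x t)
    (u : 'I_m -> 'rV[R]_n.+1 -> R -> R) :
  solution f u -> nontrivial u -> nonnegative u -> bounded_sol u ->
  forall (i : 'I_m) (x : 'rV[R]_n.+1) (t : R),
    half_space x -> 0 < dx ord0 (u i) x t.
Proof.
move=> usol unt unn ub; have upos := fpos u usol unt unn ub.
have [M uM] := ub.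
have M0 : 0 <= M.
  by have [i [x [t [Hx _]]]] := unt; apply: le_trans (uM i x t Hx).
apply: (dx_strict fC1 f0 fcoop usol unn M0 uM upos).
exact: (reflection_ordered_all fC1 f0 fcoop fsum fpos usol unn M0 uM).
Qed.
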